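(* Let $T\in\{\mathbb Z,\mathbb R\}$ and let $f$ be a GSP over $T$ with spectral measure $\rho$ such that $\rho(T^* )=1$, and let $\delta>0$ be such that $m_\delta=m_\delta(\rho)<\infty$. Then there exist $$\beta=\begin{cases}\beta(\delta,m_\delta), & T=\mathbb R,\\ 2\sqrt2, & T=\mathbb Z,\end{cases}\qquad\text{and}\qquad \ell_0=\begin{cases}\ell_0(\delta,m_\delta), & T=\mathbb R,\\ 0, & T=\mathbb Z,\end{cases}$$ (that is, over $\mathbb R$ the positive constants $\beta$ and $\ell_0$ depend only on $\delta$ and $m_\delta$) such that, for all $\ell>\ell_0$ and $N>0$, $$P_f(N)\ge\mathbb P\big(\sigma_N Z>\ell\big)\cdot\mathbb P\big(\beta|Z|<\ell\big)^{N}.$$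
   Context: Let $T\in\{\mathbb Z,\mathbb R\}$; put $T^*=\mathbb R$ if $T=\mathbb R$ and $T^*=[-\pi,\pi]$ if $T=\mathbb Z$. A GSP (Gaussian stationary process) over $T$ is a random function $f:T\to\mathbb R$ whose finite-dimensional marginals are centered multivariate Gaussian and whose distribution is invariant under translations by elements of $T$; throughout, $f$ is assumed almost surely continuous with continuous covariance kernel $r(t)=\mathbb E[f(0)f(t)]$. Its spectral measure is the finite, symmetric, non-negative measure $\rho$ on $T^*$ such that $r(t)=\int_{T^*}e^{-i\lambda t}\,d\rho(\lambda)$ for $t\in T$. The persistence probability is $P_f(N)=\mathbb P\big(f(t)>0\ \ \forall t\in(0,N]\cap T\big)$. For $\delta\in\mathbb R$ put $m_\delta=m_\delta(\rho)=\int_{T^*}|\lambda|^\delta\,d\rho(\lambda)$; for $N>0$ put $\sigma_N^2=\rho([0,\tfrac1N])$, $\sigma_N\ge0$. $Z$ denotes a standard Gaussian random variable, $Z\sim\mathcal N(0,1)$. *)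

(* Defs.v *)
From HB Require Import structures.
From mathcomp Require Import all_boot all_order all_algebra.
From mathcomp Require Import all_classical all_reals all_analysis.
From mathcomp Require Import complex.

Set Implicit Arguments.
Unset Strict Implicit.
Unset Printing Implicit Defensive.

Import Order.TTheory GRing.Theory Num.Theory.
Import numFieldNormedType.Exports.

Local Open Scope classical_set_scope.
Local Open Scope ring_scope.

Variant time := Integers | Reals.

Section time_domain.
Variable R : realType.

Definition time_index (T : time) : zmodType :=
  match T with Integers => int | Reals => R end.

Definition time_val (T : time) : time_index T -> R :=
  match T with Integers => fun n : int => n%:~R | Reals => fun t : R => t end.

(* T^* *)
Definition freq_domain (T : time) : set R :=
  match T with Integers => `[- pi, pi] | Reals => setT end.

(* Continuity for the topology that T inherits from the real line; it holds
   for every function when T = Integers. *)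
Definition time_continuous (T : time) (g : time_index T -> R) : Prop :=
  continuous (g : initial_topology (@time_val T) -> R).

End time_domain.

Section gaussian.
Variable R : realType.

(* The law N(0, s^2). The case s = 0 is separate because the library's
   normal_prob m 0 is not the Dirac mass at m. *)
Definition centered_normal (s : R) (A : set R) : \bar R :=
  if s == 0 then \d_(0 : R) A else normal_prob 0 s A.

Definition centered_gaussian d (O : measurableType d) (P : probability O R)
    (X : O -> R) : Prop :=
  exists2 s : R, 0 <= s &
    forall A, measurable A -> P (X @^-1` A) = centered_normal s A.

Definition centered_gaussian_vector d (O : measurableType d)
    (P : probability O R) n (X : 'I_n -> O -> R) : Prop :=
  forall a : 'I_n -> R, centered_gaussian P (fun w => \sum_(i < n) a i * X i w).

End gaussian.

Section stationary_process.
Context (R : realType) (T : time) (d : measure_display) (O : measurableType d).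
Variable P : probability O R.
Local Notation I := (time_index R T).
Implicit Type f : I -> {RV P >-> R}.

Definition cylinders : set (set (I -> R)) :=
  [set C | exists t : I, exists2 B : set R,
    measurable B & C = [set g | B (g t)]].

(* The law of f is the image of P on the product sigma-algebra of R^T. *)
Definition stationary f : Prop :=
  forall (s : I) (A : set (I -> R)), <<s cylinders >> A ->
    P [set w | A (fun t => f (t + s) w)] = P [set w | A (fun t => f t w)].

Definition cov_kernel f (t : I) : R := fine 'E_P[fun w => f 0 w * f t w].

Record GSP f : Prop := {
  GSP_gaussian : forall n (t : 'I_n -> I),
    centered_gaussian_vector P (fun i => f (t i) : O -> R);
  GSP_stationary : stationary f;
  GSP_continuous : {ae P, forall w, time_continuous (fun t => f t w)};
  GSP_cov_continuous : time_continuous (cov_kernel f) }.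

(* The event need not be measurable when T = Reals, but since f is almost surely
   continuous it differs from a measurable set by a P-negligible set. The outer
   measure of P gives it its probability in the completion of P, and it agrees
   with P on measurable sets. *)
Definition persistence f (N : R) : \bar R :=
  mu_ext P [set w | forall t : I, 0 < time_val t <= N -> 0 < f t w].

End stationary_process.

Section spectral_measure.
Variable R : realType.
Implicit Types (T : time) (rho : {finite_measure set R -> \bar R}).

Definition expi (x : R) : R[i] := (cos x +i* sin x)%C.

Definition cintegral rho (D : set R) (g : R -> R[i]) : R[i] :=
  (Rintegral rho D (fun x => complex.Re (g x)) +i*
   Rintegral rho D (fun x => complex.Im (g x)))%C.

(* A measure on T^* is a measure on R that vanishes off T^*. *)
Record spectral_measure T d (O : measurableType d) (P : probability O R)
    (f : time_index R T -> {RV P >-> R}) rho : Prop := {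
  spectral_support : rho (~` freq_domain T) = 0%E;
  spectral_symmetric : forall A : set R, measurable A -> rho (-%R @^-1` A) = rho A;
  spectral_cov : forall t : time_index R T, ((cov_kernel f t)%:C)%C =
    cintegral rho (freq_domain T) (fun x => expi (- (x * time_val t))) }.

Definition spectral_moment T rho (delta : R) : \bar R :=
  (\int[rho]_(x in freq_domain T) (`|x| `^ delta)%:E)%E.

Definition sigma_ rho (N : R) : R := Num.sqrt (fine (rho `[0, N^-1]%classic)).

End spectral_measure.

(* Main.v *)
(* Let B be a neighbourhood of 0 on which cos (x t) >= 1/2 for all 0 <= t <= N in
   the mean: [-1/N, 1/N], or the whole line when N is small. With s^2 = rho(B) and
   w_t = s^-1 int_B cos (x t) drho(x) >= s / 2, Cauchy-Schwarz in L^2(rho) shows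
   that r(t - u) - w_t w_u is positive semi-definite, so f has the law of w Z + g
   with Z standard normal and g an independent centered Gaussian process of
   smaller variances. Hence f > 0 on [0, N] as soon as s Z > ell and |g| < ell / 2,
   and P(s Z > ell) >= P(sigma_N Z > ell). By Sidak's inequality, the probability
   that finitely many linear forms of g are small is at least the product of the
   individual probabilities. Over the integers the forms are the values of g.
   Over the reals they are the dyadic increments of g: the moment condition gives
   E (g(t) - g(u))^2 <= C |t - u|^min(delta, 1), so slabs of geometrically
   decreasing widths ell lam^j control sup |g|, and the product of their
   probabilities down to any dyadic level is at least P(beta |Z| < ell)^N.

   Equality in law is expressed by characteristic functions, and transferred to
   orthants by approximating indicators with trigonometric polynomials. Sidak's
   inequality follows by induction from Anderson's theorem on symmetric convex
   sets, proved one coordinate at a time through a layer-cake formula. *)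

Require Import Defs.
From HB Require Import structures.
From mathcomp Require Import all_boot all_order all_algebra.
From mathcomp Require Import all_classical all_reals all_analysis.
From mathcomp Require Import measurable_realfun.
From mathcomp Require Import ring lra.

Set Implicit Arguments.
Unset Strict Implicit.
Unset Printing Implicit Defensive.

Import Order.TTheory GRing.Theory Num.Theory.
Import numFieldNormedType.Exports.

Local Open Scope classical_set_scope.
Local Open Scope ring_scope.

(** * Gaussian measures *)

(** No process is constructed beside [f]: each comparison takes place at finitely many times, on a
    Gaussian space with one coordinate for Z and the others for g. Of g only the bound of its
    variances by those of [f] is used.

    Two obstacles shape the constants over the reals. The exponent is N, but level j of the chaining
    has floor(N 2^j) + 1 <= 2^j (floor N + 1) points, and floor N + 1 is at most a fixed multiple of
    N only for N away from 0. On shorter horizons the N-th power is bounded by 1, and the Gaussian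
    threshold drops from ell to a fixed L; this is affordable once ell is large, which is where
    ell_0 comes from. Also, the slab widths must be summable while their ratio to the standard
    deviations grows geometrically, so that Gaussian tails beat the number of points. Sharing the
    decay of the increments equally between both demands gives the base a = 2^(min(delta, 1) / 4).
    Controlling |g| by ell / 4 rather than ell / 2 leaves a margin that survives the passage from
    dyadic times to all times. *)

Section measures_on_R.
Variable R : realType.
Local Open Scope ereal_scope.

(* The library's measures on the real line live on [measurableTypeR R], a copy of
   [R] with another display; here they are transferred to [R] itself. *)
Definition gauss : set R -> \bar R := normal_prob 0%R 1%R.

Let gauss0 : gauss set0 = 0. Proof. exact: measure0. Qed.
Let gauss_ge0 A : 0 <= gauss A. Proof. exact: measure_ge0. Qed.
Let gauss_sigma : semi_sigma_additive gauss.
Proof. exact: (@measure_semi_sigma_additive _ (measurableTypeR R) R (normal_prob 0%R 1%R)). Qed.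

HB.instance Definition _ :=
  isMeasure.Build _ R _ gauss gauss0 gauss_ge0 gauss_sigma.

Let gauss_setT : gauss setT = 1. Proof. exact: probability_setT. Qed.

HB.instance Definition _ := @Measure_isProbability.Build _ R R gauss gauss_setT.

Definition leb : set R -> \bar R := @lebesgue_measure R.

Let leb0 : leb set0 = 0. Proof. exact: measure0. Qed.
Let leb_ge0 A : 0 <= leb A. Proof. exact: measure_ge0. Qed.
Let leb_sigma : semi_sigma_additive leb.
Proof. exact: (@measure_semi_sigma_additive _ (measurableTypeR R) R lebesgue_measure). Qed.

HB.instance Definition _ :=
  isMeasure.Build _ R _ leb leb0 leb_ge0 leb_sigma.

Let leb_sfin : sigma_finite setT leb.
Proof. exact: (@sigma_finiteT _ (measurableTypeR R) R lebesgue_measure). Qed.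

HB.instance Definition _ := Measure_isSigmaFinite.Build _ R _ leb leb_sfin.

Lemma ge0_integral_leb (f : R -> \bar R) : measurable_fun setT f ->
  (forall x, 0 <= f x) -> \int[leb]_x f x = \int[lebesgue_measure]_x f x.
Proof.
move=> mf f0; pose i : measurableTypeR R -> R := idfun.
have mi : measurable_fun setT i by exact: (@measurable_id _ R setT).
by rewrite -(@ge0_integral_pushforward _ _ _ _ R i mi lebesgue_measure setT f).
Qed.

Definition gauss_pdf (x : R) : R := normal_pdf 0 1 x.

Lemma gauss_pdf_ge0 x : (0 <= gauss_pdf x)%R.
Proof. exact: normal_pdf_ge0. Qed.

Lemma measurable_gauss_pdf : measurable_fun setT gauss_pdf.
Proof. exact: measurable_normal_pdf. Qed.

Lemma normal_prob_leb m sg (A : set R) : measurable A ->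
  normal_prob m sg A = \int[leb]_(x in A) (normal_pdf m sg x)%:E.
Proof.
move=> mA; rewrite integral_mkcond ge0_integral_leb.
- by rewrite -integral_mkcond.
- apply/(measurable_restrictT _ mA)/measurable_funTS/measurable_EFinP.
  exact: measurable_normal_pdf.
- by move=> x; rewrite erestrict_ge0// => y _; rewrite lee_fin normal_pdf_ge0.
Qed.

Lemma gauss_leb (A : set R) : measurable A ->
  gauss A = \int[leb]_(x in A) (gauss_pdf x)%:E.
Proof. exact: normal_prob_leb. Qed.

(** An integral against [nu] is one against the Radon-Nikodym derivative, which equals [g] almost
    everywhere because both have the same integral over every measurable set. *)
Lemma ge0_integral_density (nu : {finite_measure set R -> \bar R}) (g : R -> R)
    (f : R -> \bar R) :
  measurable_fun setT g -> leb.-integrable setT (EFin \o g) ->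
  (forall A, measurable A -> nu A = \int[leb]_(x in A) (g x)%:E) ->
  measurable_fun setT f -> (forall x, 0 <= f x) ->
  \int[nu]_x f x = \int[leb]_x (f x * (g x)%:E).
Proof.
move=> mg ig nug mf f0.
have dom : nu `<< leb.
  apply/null_content_dominatesP => A mA A0.
  rewrite nug//; apply: null_set_integral => //.
  by apply/measurable_funTS/measurable_EFinP; exact: mg.
rewrite -(Radon_Nikodym_SigmaFinite.change_of_variables dom)//.
apply: ae_eq_integral => //.
- apply: emeasurable_funM => //.
  exact: measurable_int (Radon_Nikodym_SigmaFinite.f_integrable dom).
- apply: emeasurable_funM => //; exact/measurable_EFinP.
- apply: ae_eqe_mul2l => /=; apply: integral_ae_eq => //=.
  + exact: Radon_Nikodym_SigmaFinite.f_integrable.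
  + exact/measurable_EFinP.
  + move=> E _ mE; rewrite -Radon_Nikodym_SigmaFinite.f_integral//; exact: nug.
Qed.

Lemma integral_leb_normal_pdf m sg : \int[leb]_x (normal_pdf m sg x)%:E = 1.
Proof.
rewrite ge0_integral_leb ?integral_normal_pdf//.
  by apply/measurable_EFinP; exact: measurable_normal_pdf.
by move=> x; rewrite lee_fin normal_pdf_ge0.
Qed.

Lemma leb_integrable_normal_pdf m sg :
  leb.-integrable setT (EFin \o normal_pdf m sg).
Proof.
have mpdf : measurable_fun setT (EFin \o @normal_pdf R m sg).
  by apply/measurable_EFinP; exact: measurable_normal_pdf.
apply/integrableP; split => //.
under eq_integral do rewrite gee0_abs ?lee_fin ?normal_pdf_ge0//.
by rewrite integral_leb_normal_pdf ltry.
Qed.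

Lemma ge0_integral_gauss (f : R -> \bar R) : measurable_fun setT f ->
  (forall x, 0 <= f x) ->
  \int[gauss]_x f x = \int[leb]_x (f x * (gauss_pdf x)%:E).
Proof.
move=> mf f0; apply: ge0_integral_density => //.
- exact: measurable_gauss_pdf.
- exact: leb_integrable_normal_pdf.
- exact: gauss_leb.
Qed.

End measures_on_R.

Section standard_gaussian.
Variable R : realType.
Local Open Scope ereal_scope.

Definition tcons n (p : R * n.-tuple R) : n.+1.-tuple R := [tuple of p.1 :: p.2].

Lemma measurable_tcons n : measurable_fun setT (@tcons n).
Proof. exact: measurable_cons. Qed.

HB.instance Definition _ n := isMeasurableFun.Build _ _ _ _ (@tcons n) (@measurable_tcons n).

(** The standard Gaussian measure on R^n, built by adding a head coordinate: the inductions for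
    linear forms, for Anderson and for Sidak all peel off that coordinate. *)
Fixpoint gaussn n : probability (n.-tuple R) R :=
  match n return probability (n.-tuple R) R with
  | 0 => \d_([tuple] : 0.-tuple R)
  | n'.+1 => distribution (@gauss R \x gaussn n')%E (@tcons n')
  end.

Lemma ge0_integral_gaussnS n (h : n.+1.-tuple R -> \bar R) :
  measurable_fun setT h -> (forall x, 0 <= h x) ->
  \int[gaussn n.+1]_x h x = \int[@gauss R]_y \int[gaussn n]_u h (tcons (y, u)).
Proof.
move=> mh h0; rewrite ge0_integral_distribution//=.
rewrite fubini_tonelli1//=.
exact: measurableT_comp.
Qed.

Lemma measurable_preimage_tcons n (B : set (n.+1.-tuple R)) : measurable B ->
  measurable (@tcons n @^-1` B).
Proof. by move=> mB; rewrite -[X in measurable X]setTI; exact: measurable_tcons. Qed.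

Lemma gaussnS n (B : set (n.+1.-tuple R)) : measurable B ->
  gaussn n.+1 B = \int[@gauss R]_y gaussn n [set u | B (tcons (y, u))].
Proof.
move=> mB; apply: eq_integral => y _ /=; congr (gaussn n _).
by apply/seteqP; split => u; rewrite /xsection /= inE.
Qed.

(** Tonelli with the head coordinate innermost, the order needed in Anderson's step, where fibres in
    the head direction are measured before the others. *)
Lemma gaussnS2 n (B : set (n.+1.-tuple R)) : measurable B ->
  gaussn n.+1 B = \int[gaussn n]_u gauss [set y | B (tcons (y, u))].
Proof.
move=> mB; have mA := measurable_preimage_tcons mB.
have := @indic_fubini_tonelli _ _ _ _ _ (@gauss R) (gaussn n) _ mA.
rewrite indic_fubini_tonelli_FE// indic_fubini_tonelli_GE// => FG.
rewrite [LHS]FG; apply: eq_integral => u _ /=; congr (@gauss R _).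
by apply/seteqP; split => y; rewrite /ysection /= inE.
Qed.

End standard_gaussian.

(** * Sums of independent Gaussian variables *)

Section gaussian_convolution.
Variable R : realType.
Local Open Scope ereal_scope.
Implicit Types (h : R -> R) (m s p q x z : R).
Local Notation gauss := (@gauss R).
Local Notation leb := (@leb R).

Lemma normal_pdf_explicit m s x : (0 < s)%R ->
  normal_pdf m s x =
  ((s * Num.sqrt (pi *+ 2))^-1 * expR (- ((x - m) / s) ^+ 2 / 2))%R.
Proof.
move=> s0; rewrite normal_pdfE ?gt_eqF// /normal_peak /normal_fun.
rewrite -mulrnAr sqrtrM ?sqr_ge0// sqrtr_sqr gtr0_norm//; congr (_ * expR _)%R.
by rewrite -mulr_natr; field; rewrite gt_eqF.
Qed.

Lemma ge0_integral_gauss_affine h m s : (0 < s)%R -> continuous h ->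
  (forall x, 0 <= h x)%R ->
  \int[gauss]_x (h (s * x + m)%R)%:E = \int[leb]_z (h z * normal_pdf m s z)%:E.
Proof.
move=> s0 ch h0.
have caff : continuous (fun x : R => s * x + m)%R.
  by move=> x; apply: cvgD; [apply: cvgM; [exact: cvg_cst|exact: cvg_id]|exact: cvg_cst].
have mh : measurable_fun setT h by exact: continuous_measurable_fun.
have mha : measurable_fun setT (fun x : R => h (s * x + m)%R).
  apply: (@measurableT_comp _ _ _ _ _ _ h) => //.
  exact: continuous_measurable_fun.
rewrite ge0_integral_gauss//; last 2 first.
  exact/measurable_EFinP.
  by move=> x; rewrite lee_fin.
rewrite ge0_integral_leb; last 2 first.
- apply: emeasurable_funM; first exact/measurable_EFinP.
  by apply/measurable_EFinP; exact: measurable_gauss_pdf.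
- by move=> x; rewrite mule_ge0// lee_fin ?gauss_pdf_ge0.
rewrite ge0_integral_leb; last 2 first.
- apply/measurable_EFinP/measurable_funM => //; exact: measurable_normal_pdf.
- by move=> x; rewrite lee_fin mulr_ge0// normal_pdf_ge0.
pose F (x : R^o) : R^o := (s * x + m)%R.
have F'E : F^`()%classic = cst s.
  apply/funext => x; rewrite /F derive1E deriveD// deriveM// derive_cst derive_id.
  by rewrite derive_cst scaler0 !addr0 /GRing.scale /= mulr1.
rewrite (@increasing_ge0_integration_by_substitutionT _ F
  (fun z => h z * normal_pdf m s z)%R)//.
- apply: eq_integral => x _; rewrite -EFinM F'E !fctE /=; congr EFin.
  rewrite /gauss_pdf -mulrA; congr (_ * _)%R.
  rewrite !normal_pdf_explicit// /F addrK subr0 divr1 mul1r mulrAC.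
  rewrite [(s * x)%R]mulrC mulfK ?gt_eqF//; congr (_ * _)%R.
  by rewrite invfM mulrAC mulVf ?mul1r// gt_eqF.
- by move=> x y xy; rewrite /F ltrD2r ltr_pM2l.
- by rewrite F'E => ?; exact: cvg_cst.
- by rewrite F'E; exact: is_cvg_cst.
- by rewrite F'E; exact: is_cvg_cst.
- apply: (@cvg_comp _ _ _ ( *%R s) (fun x => x + m)%R); last exact: cvg_addrr_Ny.
  exact: gt0_cvgMrNy.
- apply: (@cvg_comp _ _ _ ( *%R s) (fun x => x + m)%R); last exact: cvg_addrr.
  exact: gt0_cvgMry.
- move=> z; apply: cvgM; first exact: ch.
  by apply: continuous_normal_pdf; rewrite gt_eqF.
- by move=> z; rewrite mulr_ge0// normal_pdf_ge0.
Qed.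

Lemma ge0_integral_gaussN h : continuous h -> (forall x, 0 <= h x)%R ->
  \int[gauss]_x (h (- x)%R)%:E = \int[gauss]_x (h x)%:E.
Proof.
move=> ch h0; have mh : measurable_fun setT h by exact: continuous_measurable_fun.
have mhN : measurable_fun setT (fun x => h (- x)%R).
  by apply: (measurableT_comp mh); exact: continuous_measurable_fun opp_continuous.
rewrite [LHS]ge0_integral_gauss; last 2 first.
- exact/measurable_EFinP.
- by move=> x; rewrite lee_fin.
rewrite [RHS]ge0_integral_gauss; last 2 first.
- exact/measurable_EFinP.
- by move=> x; rewrite lee_fin.
pose g x : \bar R := ((h x)%:E * (gauss_pdf x)%:E).
have mg : measurable_fun setT g.
  apply: emeasurable_funM; first exact/measurable_EFinP.
  by apply/measurable_EFinP; exact: measurable_gauss_pdf.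
have g0 x : 0 <= g x by rewrite mule_ge0// lee_fin ?gauss_pdf_ge0.
pose o : R -> R := -%R.
have mo : measurable_fun setT o by exact: continuous_measurable_fun opp_continuous.
transitivity (\int[leb]_x (g \o o) x).
  apply: eq_integral => x _; rewrite /g /= /o; congr (_ * _%:E).
  by rewrite /gauss_pdf !normal_pdf_explicit// !subr0 !divr1 sqrrN.
have <- := @ge0_integral_pushforward _ _ _ _ R o mo leb setT g measurableT mg (fun x _ => g0 x).
by apply: eq_measure_integral => A mA _; exact: lebesgue_measureN.
Qed.

(** By symmetry the sign of the slope is immaterial, so the substitution for positive slopes covers
    all nonzero ones. *)
Lemma ge0_integral_gauss_abs h p c : continuous h -> (forall x, 0 <= h x)%R ->
  \int[gauss]_x (h (p * x + c)%R)%:E = \int[gauss]_x (h (`|p| * x + c)%R)%:E.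
Proof.
move=> ch h0; have [p0|p0] := leP 0%R p; first by rewrite ger0_norm.
rewrite ltr0_norm// -[RHS](@ge0_integral_gaussN (fun x => h (- p * x + c)%R))//.
  by apply: eq_integral => x _; rewrite mulrNN.
move=> x; apply: continuous_comp; last exact: ch.
by apply: cvgD; [apply: cvgM; [exact: cvg_cst|exact: cvg_id]|exact: cvg_cst].
Qed.

(* Completing the square. *)
Lemma normal_pdf_mul p q s y z : (0 < p)%R -> (0 < s)%R -> (s ^+ 2 = p ^+ 2 + q ^+ 2)%R ->
  (normal_pdf (q * y) p z * gauss_pdf y =
   normal_pdf 0 s z * normal_pdf (q * z / s ^+ 2) (p / s) y)%R.
Proof.
move=> p0 s0 spq; rewrite /gauss_pdf !normal_pdf_explicit ?divr_gt0//.
have r0 : Num.sqrt (pi *+ 2 : R) != 0%R.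
  by rewrite gt_eqF// sqrtr_gt0 pmulrn_lgt0// pi_gt0.
have pn : p != 0%R by rewrite gt_eqF.
have sn : s != 0%R by rewrite gt_eqF.
rewrite !subr0 divr1 mul1r mulrACA -expRD [RHS]mulrACA -expRD.
congr (_ * expR _)%R; first by field; rewrite r0 pn sn.
rewrite !exprMn !exprVn !exprMn !exprVn spq.
have s2 : (p ^+ 2 + q ^+ 2 != 0)%R by rewrite -spq expf_neq0.
by field; rewrite pn s2.
Qed.

(** Substitute z for [p * y + q * x] and exchange the integrals; completing the square leaves in y a
    normal density, of mass 1. The case [q = 0] is apart because the inner law then has no
    density. *)
Lemma gauss_convolution h p q : continuous h -> (forall x, 0 <= h x)%R ->
  \int[gauss]_y \int[gauss]_x (h (p * y + q * x)%R)%:E =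
  \int[gauss]_z (h (Num.sqrt (p ^+ 2 + q ^+ 2) * z)%R)%:E.
Proof.
move=> ch h0.
have caff (a b : R) : continuous (fun x : R => h (a * x + b)%R).
  move=> x; apply: continuous_comp; last exact: ch.
  by apply: cvgD; [apply: cvgM; [exact: cvg_cst|exact: cvg_id]|exact: cvg_cst].
have mh : measurable_fun setT h by exact: continuous_measurable_fun.
have [q0|q0] := eqVneq q 0%R.
  rewrite q0 expr0n addr0 sqrtr_sqr.
  under eq_integral do under eq_integral do rewrite mul0r.
  have cstE c : \int[gauss]_x c%:E = c%:E.
    by rewrite (integral_cst gauss measurableT) [X in _ * X]probability_setT mule1.
  under eq_integral do rewrite cstE.
  rewrite (@ge0_integral_gauss_abs h p 0%R)//.
  by under eq_integral do rewrite addr0.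
under eq_integral => y _.
  under eq_integral do rewrite addrC.
  rewrite (@ge0_integral_gauss_abs h q (p * y)%R)// ge0_integral_gauss_affine ?normr_gt0//.
  over.
set s := Num.sqrt (p ^+ 2 + q ^+ 2).
have s2 : (s ^+ 2 = q ^+ 2 + p ^+ 2)%R.
  by rewrite sqr_sqrtr 1?addrC// addr_ge0// sqr_ge0.
have s0 : (0 < s)%R.
  by rewrite sqrtr_gt0 ltr_wpDl ?sqr_ge0// exprn_even_gt0.
have mpdf (w : R) : measurable_fun setT (fun yz : R * R => normal_pdf (p * yz.1)%R `|q|%R yz.2).
  under eq_fun do rewrite normal_pdf_explicit ?normr_gt0//.
  apply: measurable_funM => //; apply: measurableT_comp => //.
  apply: measurable_funM => //; apply: measurableT_comp => //.
  apply: measurable_funX; apply: measurable_funM => //.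
  by apply: measurable_funB => //; exact: measurable_funM.
transitivity (\int[gauss]_y \int[leb]_z (h z * normal_pdf (p * y) `|q| z)%:E) => //.
etransitivity.
  apply: (@fubini_tonelli _ _ _ _ _ _ _
    (fun yz : R * R => (h yz.2 * normal_pdf (p * yz.1) `|q| yz.2)%:E)); last first.
    by move=> x; rewrite lee_fin mulr_ge0// normal_pdf_ge0.
  apply/measurable_EFinP/measurable_funM; last exact: (mpdf 0%R).
  exact: (measurableT_comp mh).
have := @ge0_integral_gauss_affine h 0%R s s0 ch h0.
under [in X in X -> _]eq_integral do rewrite addr0.
move=> ->; apply: eq_integral => z _ /=; rewrite /fubini_G /=.
rewrite ge0_integral_gauss; last 2 first.
- apply/measurable_EFinP/measurable_funM => //.
  apply: (@measurableT_comp _ _ _ _ _ _ (fun yz : R * R => normal_pdf (p * yz.1)%R `|q|%R yz.2)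
    _ (fun y => (y, z))); first exact: (mpdf 0%R).
  exact: measurable_fun_pair.
- by move=> x; rewrite lee_fin mulr_ge0// normal_pdf_ge0.
under eq_integral => y _.
  rewrite -EFinM -mulrA (@normal_pdf_mul _ _ s)//; last 2 first.
    by rewrite normr_gt0.
    by rewrite real_normK ?num_real.
  rewrite mulrA EFinM; over.
rewrite ge0_integralZl//; last 3 first.
- by apply/measurable_EFinP; exact: measurable_normal_pdf.
- by move=> x _; rewrite lee_fin normal_pdf_ge0.
- by rewrite lee_fin mulr_ge0// normal_pdf_ge0.
by rewrite integral_leb_normal_pdf mule1.
Qed.

Lemma ge0_integral_centered_gaussian d (O : measurableType d)
    (P : probability O R) (X : {RV P >-> R}) h s : (0 <= s)%R ->
  (forall A, measurable A -> P (X @^-1` A) = centered_normal s A) ->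
  continuous h -> (forall x, 0 <= h x)%R ->
  \int[P]_w (h (X w))%:E = \int[gauss]_x (h (s * x)%R)%:E.
Proof.
move=> s0 lawX ch h0; have mh : measurable_fun setT h by exact: continuous_measurable_fun.
have mhE : measurable_fun setT (EFin \o h) by exact/measurable_EFinP.
transitivity (\int[distribution P X]_x (h x)%:E).
  by rewrite ge0_integral_distribution//; move=> x; rewrite lee_fin.
have [s_eq0|s_neq0] := eqVneq s 0%R.
  transitivity (\int[\d_(0%R : R)]_x (h x)%:E).
    by apply: eq_measure_integral => A mA _; rewrite [LHS]lawX// /centered_normal s_eq0 eqxx.
  rewrite integral_dirac//= diracT mul1e s_eq0.
  under eq_integral do rewrite mul0r.
  by rewrite (integral_cst gauss measurableT) [X in _ * X]probability_setT mule1.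
have {}s0 : (0 < s)%R by rewrite lt_neqAle eq_sym s_neq0.
have hE0 x : 0 <= (h x)%:E by rewrite lee_fin.
rewrite (@ge0_integral_density _ _ (normal_pdf 0 s))//; last first.
- move=> A mA; rewrite [LHS]lawX// /centered_normal (negbTE s_neq0).
  exact: normal_prob_leb.
- exact: leb_integrable_normal_pdf.
- exact: measurable_normal_pdf.
have := @ge0_integral_gauss_affine h 0%R s s0 ch h0.
by under [in X in X -> _]eq_integral do rewrite addr0.
Qed.

End gaussian_convolution.

Section gaussian_linear_forms.
Variable R : realType.
Local Open Scope ereal_scope.
Local Notation gauss := (@gauss R).

(** Coefficients are sequences on [nat], so that dropping the head coordinate is the shift
    [fun i => a i.+1], with no change of type. *)
Definition dot n (a : nat -> R) (x : n.-tuple R) : R := (\sum_(i < n) a i * tnth x i)%R.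

Definition sqnorm n (a : nat -> R) : R := (\sum_(i < n) a i ^+ 2)%R.

Lemma dot_tcons n a (y : R) (u : n.-tuple R) :
  dot a (tcons (y, u)) = (a 0%N * y + dot (fun i => a i.+1) u)%R.
Proof.
rewrite /dot big_ord_recl /=; congr (_ + _)%R.
by apply: eq_bigr => i _; rewrite [tcons _]/= tnthS.
Qed.

Lemma measurable_dot n a : measurable_fun setT (@dot n a).
Proof.
apply: measurable_sum => i; apply: measurable_funM => //.
exact: measurable_tnth.
Qed.

Lemma sqnorm_ge0 n a : (0 <= sqnorm n a)%R.
Proof. by apply: sumr_ge0 => i _; exact: sqr_ge0. Qed.

(** Induction on [n]: the tail of the form acts as one Gaussian of variance [sqnorm], and
    [gauss_convolution] adds the variance of the head. *)
Lemma ge0_integral_gaussn_dot n a (h : R -> R) : continuous h ->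
  (forall x, 0 <= h x)%R ->
  \int[gaussn R n]_x (h (dot a x))%:E =
  \int[gauss]_z (h (Num.sqrt (sqnorm n a) * z)%R)%:E.
Proof.
elim: n a h => [|n IH] a h ch h0.
  rewrite /= integral_dirac//; last first.
    apply/measurable_EFinP/measurableT_comp; last exact: measurable_dot.
    exact: continuous_measurable_fun.
  rewrite diracT mul1e /dot big_ord0 /sqnorm big_ord0 sqrtr0.
  under [RHS]eq_integral do rewrite mul0r.
  by rewrite (integral_cst gauss measurableT) [X in _ * X]probability_setT mule1.
rewrite ge0_integral_gaussnS; last 2 first.
- apply/measurable_EFinP/measurableT_comp; last exact: measurable_dot.
  exact: continuous_measurable_fun.
- by move=> x; rewrite lee_fin.
under eq_integral => y _.
  under eq_integral do rewrite dot_tcons.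
  rewrite (IH _ (fun v => h (a 0%N * y + v)%R))//; last first.
    move=> v; apply: continuous_comp; last exact: ch.
    by apply: cvgD; [exact: cvg_cst|exact: cvg_id].
  over.
rewrite gauss_convolution//; apply: eq_integral => z _.
by rewrite sqr_sqrtr ?sqnorm_ge0// /sqnorm big_ord_recl.
Qed.

End gaussian_linear_forms.

(** * Orthant probabilities from characteristic functions *)

Section trigonometric_step.
Variable R : realType.
Implicit Types (s t x : R) (k : nat).

Lemma ler_bernoulli x k : 0 <= x <= 1 -> 1 - x *+ k <= (1 - x) ^+ k.
Proof.
move=> /andP[x0 x1]; elim: k => [|k IH]; first by rewrite mulr0n subr0 expr0.
rewrite exprS; apply: le_trans (_ : (1 - x) * (1 - x *+ k) <= _); last first.
  by rewrite ler_wpM2l// subr_ge0.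
rewrite mulrBl mul1r mulrBr mulr1 mulrS -subr_ge0.
rewrite (_ : _ - _ = x * (x *+ k)); last by ring.
by rewrite mulr_ge0// mulrn_wge0.
Qed.

(** Write [t = r ^+ 2]: [r ^+ k *+ k] stays below 1 / (1 - r), and the other factor [r ^+ k] tends
    to 0. *)
Lemma cvg_mulrn_expr t : 0 <= t < 1 -> (t ^+ k *+ k) @[k --> \oo] --> (0 : R).
Proof.
move=> /andP[t0 t1].
have [->|tn0] := eqVneq t 0.
  apply: cvg_near_cst; exists 1%N => // -[//|k] _ /=.
  by rewrite expr0n /= mul0rn.
pose r := Num.sqrt t.
have r0 : 0 < r by rewrite sqrtr_gt0 lt_neqAle eq_sym tn0.
have r1 : r < 1 by rewrite -sqrtr1 ltr_sqrt.
have tE : t = r ^+ 2 by rewrite sqr_sqrtr.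
pose c := (1 - r)^-1.
have c0 : 0 < c by rewrite invr_gt0 subr_gt0.
apply: (@squeeze_cvgr _ _ _ _ (cst 0) (fun k => c * r ^+ k)); last 2 first.
- exact: cvg_cst.
- rewrite -[X in _ --> X](mulr0 c); apply: cvgM; first exact: cvg_cst.
  by apply: cvg_expr; rewrite ger0_norm// ltW.
near=> k; rewrite /= mulrn_wge0 ?exprn_ge0//=.
suff h : r ^+ k *+ k <= c.
  rewrite tE -exprM mul2n -addnn exprD -mulrnAl ler_wpM2r// exprn_ge0// ltW//.
rewrite /c -[leRHS]mul1r ler_pdivlMr ?subr_gt0//.
suff : r ^+ k *+ k * (1 - r) <= 1 - r ^+ k.
  by move=> /le_trans; apply; rewrite lerBlDr lerDl exprn_ge0// ltW.
elim: (k) => [|j IH]; first by rewrite mulr0n mul0r expr0 subrr.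
have rj : 0 <= 1 - r ^+ j.+1 by rewrite subr_ge0 exprn_ile1// ltW.
have := mulr_ge0 (ltW (_ : 0 < 1 - r)) rj; rewrite subr_gt0 => /(_ r1) h.
have := ler_wpM2l (ltW r0) IH.
rewrite exprS in h *; set a := r ^+ j in IH h *.
rewrite (_ : _ *+ j.+1 * _ = r * (a *+ j * (1 - r)) + r * a * (1 - r)); last by ring.
rewrite (_ : 1 - r * a = r * (1 - a) + r * a * (1 - r) + (1 - r) * (1 - r * a)); last by ring.
by move=> IHr; rewrite -[leLHS]addr0 lerD// lerD.
Unshelve. all: by end_near. Qed.

(** The polynomials of the elementary proof of the Stone-Weierstrass theorem. With u = (1 - s) / 2,
    the factor [2 ^ k] in the exponent puts the jump at u = 1/2, and the factor [k] sends the value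
    there to 0, so that the limit is the indicator of the strict inequality s > 0. *)
Definition step k s : R := (1 - ((1 - s) / 2) ^+ k) ^+ (k * 2 ^ k).

Lemma step_itv k s : -1 <= s <= 1 -> 0 <= step k s <= 1.
Proof.
move=> s1; have u : 0 <= ((1 - s) / 2) ^+ k <= 1.
  by rewrite exprn_ge0 ?exprn_ile1//; lra.
by rewrite exprn_ge0 ?exprn_ile1//; lra.
Qed.

(** For s > 0, Bernoulli's inequality gives the lower bound 1 - k (2u)^k with 2u < 1. For s <= 0,
    [1 + x <= expR x] gives the upper bound e^(-k), because (2u)^k >= 1. *)
Lemma cvg_step s : -1 <= s <= 1 -> step k s @[k --> \oo] --> ((0 < s)%R%:R : R).
Proof.
move=> s1; pose u := (1 - s) / 2.
have u01 : 0 <= u <= 1 by rewrite /u; lra.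
have uk k : 0 <= u ^+ k <= 1 by case/andP: u01 => *; rewrite exprn_ge0 ?exprn_ile1.
have [s0|s0] /= := ltP 0 s.
  apply: (@squeeze_cvgr _ _ _ _ (fun k => 1 - ((2 * u) ^+ k *+ k)) (cst 1)).
  - near=> k; have /andP[_ ->] := step_itv k s1; rewrite andbT.
    apply: le_trans (ler_bernoulli (k * 2 ^ k) (uk k)).
    by rewrite exprMn -natrX mulr_natl -mulrnA mulnC.
  - rewrite -[X in _ --> X](subr0 1); apply: cvgB; first exact: cvg_cst.
    by apply: cvg_mulrn_expr; rewrite /u; lra.
  - exact: cvg_cst.
have e1 : `|expR (-1) : R| < 1 by rewrite ger0_norm ?expR_ge0// -[ltRHS]expR0 ltr_expR.
apply: (@squeeze_cvgr _ _ _ _ (cst 0) (fun k => expR (-1) ^+ k)).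
- near=> k; have /andP[-> _] /= := step_itv k s1.
  apply: le_trans (_ : expR (- u ^+ k) ^+ (k * 2 ^ k) <= _).
    apply: lerXn2r; rewrite ?nnegrE ?expR_ge0//; first by have := uk k; rewrite subr_ge0 => /andP[].
    exact: expR_ge1Dx.
  rewrite -!expRM_natl ler_expR mulrN mulrN1 lerN2.
  rewrite natrM -mulrA ler_peMr// natrX -exprMn exprn_ege1//.
  by rewrite /u; lra.
- exact: cvg_cst.
- exact: cvg_expr.
Unshelve. all: by end_near. Qed.

(** For large k the quotient lies in [- pi, pi], where the sine detects positivity; the sequence is
    eventually constant. *)
Lemma cvg_sin_step x :
  ((0 < sin (x / k.+1%:R))%R%:R : R) @[k --> \oo] --> ((0 < x)%R%:R : R).
Proof.
have n0 k : 0 < k.+1%:R :> R by rewrite ltr0n.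
apply: cvg_near_cst; near=> k; congr ((nat_of_bool _)%:R); apply/idP/idP; last first.
  move=> x0; apply: sin_gt0_pi; rewrite divr_gt0//= ltr_pdivrMr//.
  rewrite -ltr_pdivrMl ?pi_gt0// mulrC; apply: lt_trans (_ : k%:R < _); last by rewrite ltr_nat.
  by near: k; exact: nbhs_infty_gtr.
rewrite !ltNge; apply: contraNN => x0.
rewrite -oppr_ge0 -sinN -mulNr; apply: sin_ge0_pi; rewrite divr_ge0 ?oppr_ge0//=.
rewrite ler_pdivrMr// -ler_pdivrMl ?pi_gt0// mulrC.
apply: le_trans (_ : k%:R <= _); last by rewrite ler_nat.
by near: k; exact: nbhs_infty_ger.
Unshelve. all: by end_near. Qed.

End trigonometric_step.

Section trigonometric_polynomials.
Variables (R : realType) (I : finType).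
Implicit Types (F G : (I -> R) -> R) (a x : I -> R) (b c : R).

(** The phase [b] brings in the sines, and the product formula for cosines makes this span an
    algebra. Polynomials in sines thus belong to it, while the expectation of each member is
    determined by those of the cosines. *)
Inductive trig_poly : ((I -> R) -> R) -> Prop :=
| trig_cos a b : trig_poly (fun x => cos (\sum_i a i * x i + b))
| trig_add F G : trig_poly F -> trig_poly G -> trig_poly (fun x => F x + G x)
| trig_scale c F : trig_poly F -> trig_poly (fun x => c * F x).

Lemma trig_cst c : trig_poly (fun=> c).
Proof.
have := trig_scale c (trig_cos (fun=> 0) 0).
congr trig_poly; apply/funext => x.
by rewrite big1 ?addr0 ?cos0 ?mulr1// => i _; rewrite mul0r.
Qed.

Lemma trig_mul F G : trig_poly F -> trig_poly G -> trig_poly (fun x => F x * G x).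
Proof.
move=> tF; elim: tF G => {F} [a b G tG|F1 F2 _ IH1 _ IH2 G tG|c F _ IH G tG].
- elim: tG => {G} [a' b'|G1 G2 _ IH1 _ IH2|c G _ IH].
  + have := trig_scale 2^-1 (trig_add (trig_cos (fun i => a i + a' i) (b + b'))
      (trig_cos (fun i => a i - a' i) (b - b'))).
    congr trig_poly; apply/funext => x.
    have E1 : \sum_i (a i + a' i) * x i + (b + b') =
        (\sum_i a i * x i + b) + (\sum_i a' i * x i + b').
      by rewrite addrACA -big_split; congr (_ + _); apply: eq_bigr => i _; rewrite mulrDl.
    have E2 : \sum_i (a i - a' i) * x i + (b - b') =
        (\sum_i a i * x i + b) - (\sum_i a' i * x i + b').
      by rewrite opprD addrACA -sumrB; congr (_ + _); apply: eq_bigr => i _; rewrite mulrBl.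
    by rewrite E1 E2 cosD cosB; field.
  + have := trig_add IH1 IH2.
    by congr trig_poly; apply/funext => x; rewrite mulrDr.
  + have := trig_scale c IH.
    by congr trig_poly; apply/funext => x; rewrite mulrCA.
- have := trig_add (IH1 _ tG) (IH2 _ tG).
  by congr trig_poly; apply/funext => x; rewrite mulrDl.
- have := trig_scale c (IH _ tG).
  by congr trig_poly; apply/funext => x; rewrite mulrA.
Qed.

Lemma trig_exp F n : trig_poly F -> trig_poly (fun x => F x ^+ n).
Proof.
move=> tF; elim: n => [|n IH]; first exact: trig_cst.
have := trig_mul tF IH.
by congr trig_poly; apply/funext => x; rewrite exprS.
Qed.

Lemma trig_prod (J : Type) (s : seq J) (F : J -> (I -> R) -> R) :
  (forall j, trig_poly (F j)) -> trig_poly (fun x => \prod_(j <- s) F j x).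
Proof.
move=> tF; elim: s => [|j s IH].
  by have := trig_cst 1; congr trig_poly; apply/funext => x; rewrite big_nil.
have := trig_mul (tF j) IH.
by congr trig_poly; apply/funext => x; rewrite big_cons.
Qed.

Lemma trig_sin (i : I) c : trig_poly (fun x => sin (x i / c)).
Proof.
have := trig_cos (fun j => (j == i)%:R / c) (- (pi / 2)).
congr trig_poly; apply/funext => x; rewrite cosBpihalf; congr sin.
rewrite (bigD1 i)//= eqxx big1 ?addr0 ?mul1r 1?mulrC// => j /negbTE ->.
by rewrite !mul0r.
Qed.

Lemma trig_step k (i : I) c : trig_poly (fun x => step k (sin (x i / c))).
Proof.
apply: trig_exp.
have := trig_add (trig_cst 1) (trig_scale (- 1) (trig_exp k
  (trig_scale 2^-1 (trig_add (trig_cst 1) (trig_scale (- 1) (trig_sin i c)))))).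
by congr trig_poly; apply/funext => x; rewrite !mulN1r [X in _ = _ - X ^+ _]mulrC.
Qed.

Section expectation.
Context d (O : measurableType d) (P : probability O R) (X : I -> O -> R).
Hypothesis mX : forall i, measurable_fun setT (X i).

Lemma measurable_trig_arg a b : measurable_fun setT (fun w => \sum_i a i * X i w + b).
Proof.
apply: measurable_funD => //; apply: measurable_sum => i.
exact: measurable_funM.
Qed.

Lemma integrable_trig_poly F : trig_poly F ->
  P.-integrable setT (fun w => (F (fun i => X i w))%:E).
Proof.
elim => {F} [a b|F G _ IH1 _ IH2|c F _ IH].
- apply: (@measurable_bounded_integrable _ _ _ P (fun w => cos (\sum_i a i * X i w + b)) setT) => //.
  + by rewrite [ltLHS](@probability_setT _ _ _ P) ltry.
  + apply: measurableT_comp; last exact: measurable_trig_arg.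
    exact: continuous_measurable_fun (@continuous_cos R).
  + exists 1; split; first exact: num_real.
    by move=> y y1 w _ /=; rewrite (le_trans (cos_max _))// ltW.
- have := integrableD measurableT IH1 IH2.
  by congr (_.-integrable); apply/funext => w /=.
- have := integrableZl measurableT c IH.
  by congr (_.-integrable); apply/funext => w /=.
Qed.

End expectation.

Context d1 (O1 : measurableType d1) (P1 : probability O1 R) (X : I -> O1 -> R).
Context d2 (O2 : measurableType d2) (P2 : probability O2 R) (Y : I -> O2 -> R).
Hypotheses (mX : forall i, measurable_fun setT (X i))
           (mY : forall i, measurable_fun setT (Y i)).
Hypothesis eqXY : forall a b,
  (\int[P1]_w (cos (\sum_i a i * X i w + b))%:E =
   \int[P2]_w (cos (\sum_i a i * Y i w + b))%:E)%E.

Lemma eq_integral_trig_poly F : trig_poly F ->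
  (\int[P1]_w (F (fun i => X i w))%:E = \int[P2]_w (F (fun i => Y i w))%:E)%E.
Proof.
elim => {F} [a b|F G tF IH1 tG IH2|c F tF IH]; first exact: eqXY.
- under eq_integral do rewrite EFinD.
  rewrite integralD//; try exact: integrable_trig_poly.
  under [RHS]eq_integral do rewrite EFinD.
  rewrite integralD//; try exact: integrable_trig_poly.
  by rewrite IH1 IH2.
- under eq_integral do rewrite EFinM.
  rewrite integralZl//; try exact: integrable_trig_poly.
  under [RHS]eq_integral do rewrite EFinM.
  rewrite integralZl//; try exact: integrable_trig_poly.
  by rewrite IH.
Qed.

End trigonometric_polynomials.

Section orthants.
Variables (R : realType) (I : finType).

Lemma cvg_integral_bounded1 d (O : measurableType d) (P : probability O R)
    (g : nat -> O -> R) (l : O -> R) :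
  (forall k, measurable_fun setT (g k)) -> measurable_fun setT l ->
  (forall k w, 0 <= g k w <= 1) ->
  (forall w, g k w @[k --> \oo] --> l w) ->
  (\int[P]_w (g k w)%:E @[k --> \oo] --> \int[P]_w (l w)%:E)%E.
Proof.
move=> mg ml g01 gl.
have := @dominated_convergence _ _ _ P setT measurableT
  (fun k w => (g k w)%:E) (fun w => (l w)%:E) (cst 1%E).
case => //.
- by move=> k; exact/measurable_EFinP.
- exact/measurable_EFinP.
- by apply: aeW => w _; apply: cvg_EFin; [exact: nearW|exact: gl].
- exact: finite_measure_integrable_cst.
- by apply: aeW => w k _; rewrite lee_fin ger0_norm; case/andP: (g01 k w).
Qed.

Lemma measurable_gt0_set d (O : measurableType d) (Z : O -> R) :
  measurable_fun setT Z -> measurable [set w | 0 < Z w].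
Proof.
move=> mZ; have := mZ measurableT `]0, +oo[%classic (measurable_itv _).
by rewrite setTI; congr measurable; apply/seteqP; split => w /=; rewrite in_itv /= andbT.
Qed.

Lemma measurable_orthant d (O : measurableType d) (Z : I -> O -> R) :
  (forall i, measurable_fun setT (Z i)) -> measurable [set w | forall i, 0 < Z i w].
Proof.
move=> mZ; rewrite (_ : [set w | _] = \bigcap_(i in setT) [set w | 0 < Z i w]).
  by apply: fin_bigcap_measurable => [|i _]; [exact: finite_finset|exact: measurable_gt0_set].
by apply/seteqP; split => [w h i _|w h i]; exact: h.
Qed.

Lemma cvgr_prod (u : I -> nat -> R) (l : I -> R) :
  (forall i, u i k @[k --> \oo] --> l i) ->
  \prod_i u i k @[k --> \oo] --> \prod_i l i.
Proof.
move=> ul; elim: (index_enum I) => [|i s IH].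
  by rewrite big_nil; under eq_fun do rewrite big_nil; exact: cvg_cst.
rewrite big_cons; under eq_fun do rewrite big_cons.
by apply: cvgM; first exact: ul.
Qed.

(** Two limits under dominated convergence: [step] turns each sin(x_i / (k + 1)) into the indicator
    of its positivity, then k tends to infinity. Before the limits the product over coordinates is a
    trigonometric polynomial. Nothing here requires a density, so degenerate vectors are
    included. *)
Lemma eq_orthant_probability d1 (O1 : measurableType d1) (P1 : probability O1 R)
    (X : I -> O1 -> R) d2 (O2 : measurableType d2) (P2 : probability O2 R)
    (Y : I -> O2 -> R) :
  (forall i, measurable_fun setT (X i)) -> (forall i, measurable_fun setT (Y i)) ->
  (forall a b, \int[P1]_w (cos (\sum_i a i * X i w + b))%:E =
               \int[P2]_w (cos (\sum_i a i * Y i w + b))%:E)%E ->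
  P1 [set w | forall i, 0 < X i w] = P2 [set w | forall i, 0 < Y i w].
Proof.
move=> mX mY eqXY.
have mpos d (O : measurableType d) (Z : I -> O -> R) :
    (forall i, measurable_fun setT (Z i)) -> measurable_fun setT (fun w => \prod_i (0 < Z i w)%R%:R : R).
  move=> mZ; apply: measurable_prod => i _.
  rewrite (_ : (fun w => _) = \1_(Z i @^-1` `]0, +oo[)); last first.
    apply/funext => w; rewrite indicE; congr ((nat_of_bool _)%:R).
    by apply/idP/idP; rewrite inE /= in_itv /= andbT.
  apply: measurable_indic; rewrite -[X in measurable X]setTI; exact: mZ.
have msin d (O : measurableType d) (Z : I -> O -> R) c :
    (forall i, measurable_fun setT (Z i)) ->
    forall i, measurable_fun setT (fun w => sin (Z i w / c)).
  move=> mZ i; apply: measurableT_comp; last exact: measurable_funM.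
  exact: continuous_measurable_fun (@continuous_sin R).
have prod01 (s : I -> R) : (forall i, 0 <= s i <= 1) -> 0 <= \prod_i s i <= 1.
  move=> h; rewrite prodr_ge0 => [|i _]; last by case/andP: (h i).
  by rewrite prodr_ile1// => i _.
have bool01 (b : bool) : 0 <= (b%:R : R) <= 1 by case: b; rewrite /= ?lexx ler01.
have sin_eq (k : nat) :
    (\int[P1]_w (\prod_i (0 < sin (X i w / k.+1%:R))%R%:R)%:E =
     \int[P2]_w (\prod_i (0 < sin (Y i w / k.+1%:R))%R%:R)%:E)%E.
  have cv d (O : measurableType d) (P : probability O R) (Z : I -> O -> R) :
      (forall i, measurable_fun setT (Z i)) ->
      (\int[P]_w (\prod_i step j (sin (Z i w / k.+1%:R)))%:E @[j --> \oo] -->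
       \int[P]_w (\prod_i (0 < sin (Z i w / k.+1%:R))%R%:R)%:E)%E.
    move=> mZ; apply: cvg_integral_bounded1.
    - move=> j; apply: measurable_prod => i _.
      apply: measurable_funX; apply: measurable_funB => //; apply: measurable_funX.
      apply: measurable_funM => //; apply: measurable_funB => //; exact: msin.
    - by apply: (mpos _ _ (fun i w => sin (Z i w / k.+1%:R))); exact: msin.
    - by move=> j w; apply: prod01 => i; apply: step_itv; rewrite sin_geN1 sin_le1.
    - move=> w; apply: cvgr_prod => i.
      by apply: cvg_step; rewrite sin_geN1 sin_le1.
  have c1 := cv _ _ P1 X mX; have c2 := cv _ _ P2 Y mY.
  have E j : (\int[P1]_w (\prod_i step j (sin (X i w / k.+1%:R)))%:E =
      \int[P2]_w (\prod_i step j (sin (Y i w / k.+1%:R)))%:E)%E.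
    apply: (eq_integral_trig_poly mX mY eqXY
      (F := fun x => \prod_i step j (sin (x i / k.+1%:R)))).
    by apply: trig_prod => i; exact: trig_step.
  by move: c1; rewrite (funext E) => c1; exact: (cvg_unique _ c1 c2).
have cv d (O : measurableType d) (P : probability O R) (Z : I -> O -> R) :
    (forall i, measurable_fun setT (Z i)) ->
    (\int[P]_w (\prod_i (0 < sin (Z i w / k.+1%:R))%R%:R)%:E @[k --> \oo] -->
     \int[P]_w (\prod_i (0 < Z i w)%R%:R)%:E)%E.
  move=> mZ; apply: cvg_integral_bounded1.
  - by move=> k; apply: (mpos _ _ (fun i w => sin (Z i w / k.+1%:R))); exact: msin.
  - exact: mpos.
  - by move=> k w; exact: prod01.
  - move=> w; apply: cvgr_prod => i.
    exact: cvg_sin_step.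
have PE d (O : measurableType d) (P : probability O R) (Z : I -> O -> R) :
    (forall i, measurable_fun setT (Z i)) ->
    P [set w | forall i, 0 < Z i w] = (\int[P]_w (\prod_i (0 < Z i w)%R%:R)%:E)%E.
  move=> mZ.
  have prodE w : \prod_i (0 < Z i w)%R%:R = \1_[set w | forall i, 0 < Z i w] w :> R.
    rewrite indicE; have [/set_mem /= h|h] := boolP (w \in _).
      by rewrite big1// => i _; rewrite h.
    have /existsNP[i /negP Zi] : ~ forall i, 0 < Z i w by move=> hw; move/negP: h; apply; rewrite inE.
    by rewrite (bigD1 i)//= (negbTE Zi) mul0r.
  under eq_integral do rewrite prodE.
  rewrite integral_indic ?setIT//.
  exact: measurable_orthant.
have c1 := cv _ _ P1 X mX; have c2 := cv _ _ P2 Y mY.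
rewrite !PE//.
by move: c1; rewrite (funext sin_eq) => c1; exact: (cvg_unique _ c1 c2).
Qed.

End orthants.

(** * Anderson's theorem *)

Section layer_cake.
Variable R : realType.
Local Open Scope ereal_scope.
Local Notation leb := (@leb R).

Lemma leb_itv0 (q : \bar R) : 0 <= q -> leb [set t | (0 < t)%R /\ t%:E < q] = q.
Proof.
move=> q0; case: q q0 => [r| |]// r0.
- rewrite lee_fin in r0; rewrite (_ : [set t | _] = [set` `]0%R, r[]).
    rewrite [LHS](lebesgue_measure_itv `]0%R, r[) /= lte_fin oppr0 adde0.
    case: ltP => // r0'; by congr EFin; apply/eqP; rewrite eq_le r0.
  by apply/seteqP; split => t /=; rewrite in_itv /= lte_fin => /andP.
- rewrite (_ : [set t | _] = [set` `]0%R, +oo[]).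
    by rewrite [LHS](lebesgue_measure_itv `]0%R, +oo[) /= ltry oppr0.
  apply/seteqP; split => t /=; rewrite in_itv /= ?ltry andbT; first by case.
  by [].
Qed.

Context d (T : measurableType d) (mu : {sigma_finite_measure set T -> \bar R}).
Variable q : T -> \bar R.
Hypotheses (mq : measurable_fun setT q) (q0 : forall x, 0 <= q x).

Let A : set (T * R) := [set xt | (0 < xt.2)%R /\ xt.2%:E < q xt.1].

Let mA : measurable A.
Proof.
apply: (@measurableI _ _ [set xt : T * R | (0 < xt.2)%R]).
  exact: measurable_gt0_set.
rewrite -[X in measurable X]setTI.
apply: (@measurable_lte _ (T * R)%type R setT measurableT) => //.
- exact/measurable_EFinP.
- exact: measurableT_comp.
Qed.

Let secE t : ysection A t = [set x | (0 < t)%R /\ t%:E < q x].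
Proof. by apply/seteqP; split => x; rewrite /ysection /= inE. Qed.

(** Tonelli on the region under the graph of [q]. The condition [0 < t] stays inside the sets
    because the outer integral runs over the whole line. *)
Lemma layer_cake :
  \int[mu]_x q x = \int[leb]_t mu [set x | (0 < t)%R /\ t%:E < q x].
Proof.
have := @indic_fubini_tonelli _ _ _ _ _ mu leb A mA.
rewrite indic_fubini_tonelli_FE// indic_fubini_tonelli_GE//.
under eq_integral => x _.
  rewrite /= (_ : xsection A x = [set t : R | (0 < t)%R /\ t%:E < q x]); last first.
    by apply/seteqP; split => t; rewrite /xsection /= inE.
  rewrite leb_itv0//; over.
by move=> ->; apply: eq_integral => t _ /=; rewrite secE.
Qed.

Lemma measurable_layer :
  measurable_fun setT (fun t : R => mu [set x | (0 < t)%R /\ t%:E < q x]).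
Proof.
have := @measurable_fun_ysection _ _ _ _ _ mu _ mA.
by congr measurable_fun; apply/funext => t /=; rewrite secE.
Qed.

End layer_cake.

Section interval_length.
Variable R : realType.
Local Open Scope ereal_scope.
Local Notation leb := (@leb R).

(** Trades a bound on a length for a pair of points, a form preserved by reflections and convex
    combinations. This carries the one-dimensional Brunn-Minkowski inequality for intervals. *)
Lemma leb_gtP (A : set R) (t : R) : (0 <= t)%R -> measurable A -> is_interval A ->
  t%:E < leb A <-> exists a b, [/\ A a, A b & (t < b - a)%R].
Proof.
move=> t0 mA iA; split; last first.
  move=> [a [b [Aa Ab tab]]].
  have ab : (a < b)%R by rewrite -subr_gt0 (le_lt_trans t0).
  apply: (@lt_le_trans _ _ (leb [set` `[a, b]])).
    by rewrite [ltRHS](lebesgue_measure_itv `[a, b]) /= lte_fin ab -EFinB lte_fin.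
  apply: le_measure; rewrite ?inE// => x /=; rewrite in_itv /= => /andP[ax xb].
  by apply: (iA a b) => //; rewrite ax.
move=> tA; apply: contrapT => nex.
have le_t a b : A a -> A b -> (b - a <= t)%R.
  by move=> Aa Ab; rewrite leNgt; apply/negP => tab; apply: nex; exists a, b.
have [A0|/set0P[c Ac]] := eqVneq A set0.
  by move: tA; rewrite A0 measure0 ltNge lee_fin t0.
have ubA : has_ubound A by exists (c + t)%R => x Ax; rewrite -lerBlDl le_t.
have supA x : A x -> (sup A - t <= x)%R.
  move=> Ax; rewrite lerBlDr; apply: ge_sup; first by exists c.
  by move=> y Ay; rewrite -lerBlDl le_t.
suff : leb A <= t%:E by rewrite leNgt tA.
apply: (@le_trans _ _ (leb [set` `[(sup A - t)%R, sup A]])).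
  apply: le_measure; rewrite ?inE// => x Ax /=.
  by rewrite in_itv /= supA//= ub_le_sup.
rewrite [leLHS](lebesgue_measure_itv `[(sup A - t)%R, sup A]) /= lte_fin.
by case: ifP => // _; rewrite -EFinB opprB addrCA subrr addr0.
Qed.

End interval_length.

Section anderson.
Variable R : realType.
Local Open Scope ereal_scope.
Local Notation leb := (@leb R).
Local Notation gauss := (@gauss R).

Definition tlin n (a b : R) (u v : n.-tuple R) : n.-tuple R :=
  [tuple (a * tnth u i + b * tnth v i)%R | i < n].

Lemma tlin_tcons n a b x y (u v : n.-tuple R) :
  tlin a b (tcons (x, u)) (tcons (y, v)) = tcons ((a * x + b * y)%R, tlin a b u v).
Proof.
apply: eq_from_tnth => i; rewrite tnth_mktuple.
by case: (unliftP ord0 i) => [j ->|->] //; rewrite !tnthS tnth_mktuple.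
Qed.

(** Joint symmetry and convexity in R^n x R; [tlin (-1) 0 u u] is - u. The last coordinate is kept
    apart as the parameter of the fibres. *)
Definition sym_convex n (L : set (n.-tuple R * R)) :=
  (forall u y, L (u, y) -> L (tlin (-1) 0 u u, - y)%R) /\
  (forall l u v y z, (0 <= l <= 1)%R -> L (u, y) -> L (v, z) ->
     L (tlin l (1 - l) u v, l * y + (1 - l) * z)%R).

(** The combination of (u, y) and its reflection (- u, - y) with weight (1 + th) / 2 on the former
    has last coordinate th y. *)
Lemma sym_convex_scale n L (u : n.-tuple R) y th : sym_convex L ->
  (`|th| <= 1)%R -> L (u, y) -> exists v, L (v, th * y)%R.
Proof.
move=> [sL cL] th1 Luy; have Ln := sL _ _ Luy.
exists (tlin ((1 + th) / 2) (1 - (1 + th) / 2) u (tlin (-1) 0 u u)).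
have := cL ((1 + th) / 2)%R _ _ _ _ _ Luy Ln.
rewrite (_ : ((1 + th) / 2 * y + _ = th * y)%R); last by field.
by apply; move: th1; rewrite ler_norml; lra.
Qed.

Lemma tlin_id n l (u : n.-tuple R) : tlin l (1 - l) u u = u.
Proof.
by apply: eq_from_tnth => i; rewrite tnth_mktuple -mulrDl subrKC mul1r.
Qed.

Lemma gauss_pdf_le (x y : R) : (`|y| <= `|x|)%R -> (gauss_pdf x <= gauss_pdf y)%R.
Proof.
move=> yx; rewrite /gauss_pdf !normal_pdf_explicit// !subr0 !divr1.
rewrite ler_wpM2l ?invr_ge0 ?mulr_ge0 ?sqrtr_ge0// ler_expR !mulNr lerN2.
by rewrite ler_pM2r ?invr_gt0// -real_normK ?num_real// -[leRHS]real_normK ?num_real// lerXn2r ?nnegrE.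
Qed.

Section step.
Variable n : nat.
Variable L : set (n.+1.-tuple R * R).
Hypotheses (mL : measurable L) (scL : sym_convex L).

(* [s] is a level of the Gaussian density of the first coordinate. *)
Let M : set ((n.-tuple R * R * R) * R) :=
  [set w | [/\ (0 < w.1.2)%R, (w.1.2 < gauss_pdf w.2)%R & L (tcons (w.2, w.1.1.1), w.1.1.2)]].

Let mM : measurable M.
Proof.
rewrite (_ : M = [set w | (0 < w.1.2)%R] `&` [set w | (0 < gauss_pdf w.2 - w.1.2)%R] `&`
  (fun w => (tcons (w.2, w.1.1.1), w.1.1.2)) @^-1` L); last first.
  apply/seteqP; split => w /=; first by move=> [? ? ?]; rewrite subr_gt0.
  by rewrite subr_gt0 => -[[]].
have m1 : measurable_fun setT (fun w : (n.-tuple R * R * R) * R => w.1.2).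
  exact: measurableT_comp.
have m11 : measurable_fun setT (fun w : (n.-tuple R * R * R) * R => w.1.1).
  exact: measurableT_comp.
apply: measurableI; first apply: measurableI.
- exact: measurable_gt0_set.
- apply: measurable_gt0_set; apply: measurable_funB => //.
  apply: (@measurableT_comp _ _ _ _ _ _ (@gauss_pdf R)) => //.
  exact: measurable_gauss_pdf.
- rewrite -[X in measurable X]setTI.
  suff : measurable_fun setT (fun w : (n.-tuple R * R * R) * R => (tcons (w.2, w.1.1.1), w.1.1.2)).
    by apply.
  apply: measurable_fun_pair; last exact: measurableT_comp.
  apply: (@measurableT_comp _ _ _ _ _ _ (@tcons R n)); first exact: measurable_tcons.
  by apply: measurable_fun_pair => //; exact: measurableT_comp.
Qed.

(** Cutting at the density level [s] replaces the Gaussian weight of the head coordinate by the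
    length of a chord of [L]. *)
Let q s u y := leb (xsection M (u, y, s)).

Let secE s u y : xsection M (u, y, s) =
  [set x | [/\ (0 < s)%R, (s < gauss_pdf x)%R & L (tcons (x, u), y)]].
Proof. by apply/seteqP; split => x; rewrite /xsection /= inE. Qed.

Let mq : measurable_fun setT (fun w => q w.2 w.1.1 w.1.2).
Proof.
have := @measurable_fun_xsection _ _ _ _ _ leb _ mM.
by congr measurable_fun; apply/funext => -[[u y] s].
Qed.

Let M_sym s u y a : xsection M (u, y, s) a -> xsection M (tlin (-1) 0 u u, - y, s)%R (- a)%R.
Proof.
rewrite !secE /= => -[s0 sa La]; split => //.
  by rewrite (lt_le_trans sa)// gauss_pdf_le// normrN.
have := scL.1 _ _ La; rewrite tlin_tcons mul0r addr0.
by rewrite mulN1r.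
Qed.

(** Superlevel sets of [gauss_pdf] are convex: the modulus of a convex combination is at most the
    larger of the two moduli, and the density decreases in the modulus. *)
Let M_cvx s l u v y z a b : (0 <= l <= 1)%R ->
  xsection M (u, y, s) a -> xsection M (v, z, s) b ->
  xsection M (tlin l (1 - l) u v, l * y + (1 - l) * z, s)%R (l * a + (1 - l) * b)%R.
Proof.
move=> l01; rewrite !secE /= => -[s0 sa La] [_ sb Lb]; split => //; last first.
  by have := scL.2 _ _ _ _ _ l01 La Lb; rewrite tlin_tcons.
have ab (c : R) : (`|a| <= c)%R -> (`|b| <= c)%R -> (`|l * a + (1 - l) * b| <= c)%R.
  rewrite !ler_norml => /andP[? ?] /andP[? ?]; move/andP: l01 => [? ?].
  apply/andP; split; nra.
have [ba|ab'] := leP (`|b|)%R (`|a|)%R.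
  by apply: (lt_le_trans sa); apply: gauss_pdf_le; exact: ab.
by apply: (lt_le_trans sb); apply: gauss_pdf_le; apply: ab => //; exact: ltW.
Qed.

Let q_interval s u y : is_interval (xsection M (u, y, s)).
Proof.
move=> x z Mx Mz c /andP[xc cz].
have [xz|xz] := eqVneq x z; first by have -> : c = x by apply/eqP; rewrite eq_le xc andbT xz.
have xz0 : (0 < z - x)%R by rewrite subr_gt0 lt_neqAle xz (le_trans xc).
have l01 : (0 <= (z - c) / (z - x) <= 1)%R.
  by rewrite divr_ge0 ?subr_ge0 ?(le_trans xc)//= ler_pdivrMr// mul1r lerD2l lerN2.
have := M_cvx l01 Mx Mz; rewrite tlin_id -!mulrDl subrKC !mul1r.
suff -> : ((z - c) / (z - x) * x + (1 - (z - c) / (z - x)) * z = c)%R by [].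
by field; rewrite gt_eqF.
Qed.

Let level s t : set (n.-tuple R * R) := [set p | (0 < t)%R /\ t%:E < q s p.1 p.2].

Let msec s u y : measurable (xsection M (u, y, s)).
Proof. exact: measurable_xsection. Qed.

Let mlevel s t : measurable (level s t).
Proof.
have [t0|t0] := ltP 0%R t; last first.
  by rewrite (_ : level s t = set0)// -subset0 => p [/lt_le_trans /(_ t0)]; rewrite ltxx.
rewrite (_ : level s t = setT `&` [set p | cst t%:E p < q s p.1 p.2]); last first.
  by apply/seteqP; split => p /= => [[]|[]].
apply: measurable_lte => //.
apply: (@measurableT_comp _ _ _ _ _ _ (fun w : n.-tuple R * R * R => q w.2 w.1.1 w.1.2)
  _ (fun p => (p, s))); first exact: mq.
exact: measurable_fun_pair.
Qed.

(** Convex combinations of the end points of two chords lie in the combined fibre, so chord length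
    is concave in (u, y); reflection preserves it. *)
Let level_sym_convex s t : sym_convex (level s t).
Proof.
split => [u y /= [t0]|l u v y z l01 /= [t0] + [_]]; rewrite /q.
  move=> /(leb_gtP (ltW t0) (@msec _ _ _) (@q_interval _ _ _))[a [b [Ma Mb tab]]].
  split => //; apply/leb_gtP => //; first exact: ltW.
  by exists (- b)%R, (- a)%R; split; [exact: M_sym|exact: M_sym|rewrite opprK addrC].
move=> /(leb_gtP (ltW t0) (@msec _ _ _) (@q_interval _ _ _))[a [b [Ma Mb tab]]].
move=> /(leb_gtP (ltW t0) (@msec _ _ _) (@q_interval _ _ _))[a' [b' [Ma' Mb' tab']]].
split => //; apply/leb_gtP => //; first exact: ltW.
exists (l * a + (1 - l) * a')%R, (l * b + (1 - l) * b')%R; split; try exact: M_cvx.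
rewrite (_ : (_ - _)%R = l * (b - a) + (1 - l) * (b' - a'))%R; last by ring.
have /andP[l0 l1] := l01.
rewrite -subr_gt0 (_ : _ - t = l * (b - a - t) + (1 - l) * (b' - a' - t))%R; last by ring.
have [->|ln0] := eqVneq l 0%R; first by rewrite mul0r add0r subr0 mul1r subr_gt0.
have {ln0}l0 : (0 < l)%R by rewrite lt_neqAle eq_sym ln0.
apply: ltr_pwDl; first by rewrite mulr_gt0// subr_gt0.
by rewrite mulr_ge0// subr_ge0// ltW.
Qed.

Let mq_u s y : measurable_fun setT (fun u => q s u y).
Proof.
apply: (@measurableT_comp _ _ _ _ _ _ (fun w : n.-tuple R * R * R => q w.2 w.1.1 w.1.2)
  _ (fun u => (u, y, s))); first exact: mq.
by apply: measurable_fun_pair => //; exact: measurable_fun_pair.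
Qed.

Let mq_us y : measurable_fun setT (fun us : n.-tuple R * R => q us.2 us.1 y).
Proof.
apply: (@measurableT_comp _ _ _ _ _ _ (fun w : n.-tuple R * R * R => q w.2 w.1.1 w.1.2)
  _ (fun us => (us.1, y, us.2))); first exact: mq.
by apply: measurable_fun_pair => //; exact: measurable_fun_pair.
Qed.

Let q_ge0 s u y : 0 <= q s u y. Proof. exact: measure_ge0. Qed.

Let gaussE u y :
  gauss [set x | L (tcons (x, u), y)] = \int[leb]_s q s u y.
Proof.
have mB : measurable [set x | L (tcons (x, u), y)].
  rewrite -[X in measurable X]setTI.
  suff : measurable_fun setT (fun x : R => (tcons (x, u), y)) by apply.
  apply: measurable_fun_pair => //.
  apply: (@measurableT_comp _ _ _ _ _ _ (@tcons R n)); first exact: measurable_tcons.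
  exact: measurable_fun_pair.
rewrite [LHS](gauss_leb mB) integral_mkcond layer_cake; last 2 first.
- apply/(measurable_restrictT _ mB)/measurable_funTS/measurable_EFinP.
  exact: measurable_gauss_pdf.
- by move=> x; rewrite erestrict_ge0// => ? _; rewrite lee_fin gauss_pdf_ge0.
apply: eq_integral => s _; rewrite /q secE; congr leb; apply/seteqP; split => x /=.
  rewrite patchE; case: ifPn => [/set_mem|] //= Bx [s0]; first by rewrite lte_fin.
  by rewrite lte_fin => /(lt_trans s0); rewrite ltxx.
by move=> [s0 sx Lx]; rewrite patchE ifT ?lte_fin// inE.
Qed.

Let gaussnE y : gaussn R n.+1 [set v | L (v, y)] =
  \int[leb]_s \int[gaussn R n]_u q s u y.
Proof.
have mLy : measurable [set v | L (v, y)].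
  rewrite -[X in measurable X]setTI.
  suff : measurable_fun setT (fun v : n.+1.-tuple R => (v, y)) by apply.
  exact: measurable_fun_pair.
rewrite gaussnS2//.
under eq_integral do rewrite gaussE.
apply: (@fubini_tonelli _ _ _ _ _ (gaussn R n) leb (fun us => q us.2 us.1 y)) => //.
Qed.

Hypothesis IH : forall (L' : set (n.-tuple R * R)) y th, measurable L' ->
  sym_convex L' -> (`|th| <= 1)%R ->
  gaussn R n [set u | L' (u, y)] <= gaussn R n [set u | L' (u, th * y)%R].

(** Sliced by the density level [s] and then by the chord length [t], both sides become integrals of
    Gaussian measures of n-dimensional fibres of [level s t], which the induction hypothesis
    compares slice by slice. *)
Lemma anderson_step y th : (`|th| <= 1)%R ->
  gaussn R n.+1 [set v | L (v, y)] <= gaussn R n.+1 [set v | L (v, th * y)%R].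
Proof.
move=> th1; rewrite !gaussnE.
have mint z : measurable_fun setT (fun s => \int[gaussn R n]_u q s u z).
  apply: (@measurable_fun_fubini_tonelli_G _ _ _ _ _ (gaussn R n) (fun us => q us.2 us.1 z)) => //.
apply: ge0_le_integral => //.
- by move=> s _; apply: integral_ge0 => u _; exact: q_ge0.
move=> s _; have LC z : \int[gaussn R n]_u q s u z =
    \int[leb]_t gaussn R n [set u | (0 < t)%R /\ t%:E < q s u z].
  by apply: layer_cake.
rewrite !LC.
apply: ge0_le_integral => //.
- exact: measurable_layer.
- exact: measurable_layer.
by move=> t _; exact: (IH y (@mlevel s t) (@level_sym_convex s t)).
Qed.

End step.

(** A translation of a symmetric convex set is replaced by the motion of a fibre in one more
    dimension: this is the form that the slabs below need, and it is stable under the induction. *)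
Theorem anderson n (L : set (n.-tuple R * R)) y th : measurable L ->
  sym_convex L -> (`|th| <= 1)%R ->
  gaussn R n [set u | L (u, y)] <= gaussn R n [set u | L (u, th * y)%R].
Proof.
elim: n L y th => [|n IH] L y th mL scL th1; last exact: anderson_step.
(* In dimension 0 the measure is a Dirac mass, and the claim is that membership of the single point
   passes from y to th y. *)
rewrite /= !diracE lee_fin ler_nat.
case: (boolP ([tuple] \in [set u | L (u, y)])) => // /set_mem /=.
by move=> /(sym_convex_scale scL th1)[v]; rewrite (tuple0 v) => Lv; rewrite mem_set.
Qed.

End anderson.

(** * Sidak's inequality *)

Section same_law.
Variable R : realType.

(* Equality of characteristic functions: the centered Gaussian vectors [X] and [Y] have
   the same law. *)
Definition same_law (I : finType) d1 (O1 : measurableType d1) (P1 : probability O1 R)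
    (X : I -> O1 -> R) d2 (O2 : measurableType d2) (P2 : probability O2 R)
    (Y : I -> O2 -> R) := forall a b,
  (\int[P1]_w (cos (\sum_i a i * X i w + b))%:E =
   \int[P2]_w (cos (\sum_i a i * Y i w + b))%:E)%E.

Context (I : finType).
Context d1 (O1 : measurableType d1) (P1 : probability O1 R) (X : I -> O1 -> R).
Context d2 (O2 : measurableType d2) (P2 : probability O2 R) (Y : I -> O2 -> R).
Hypotheses (mX : forall i, measurable_fun setT (X i))
           (mY : forall i, measurable_fun setT (Y i)).
Hypothesis eqXY : same_law P1 X P2 Y.

(** Combinations of the affine forms are again linear forms of [X] plus a constant, and the constant
    goes into the phase [b]; the orthant result then applies to the forms. *)
Lemma same_law_halfspaces (J : finType) (B : J -> I -> R) (c : J -> R) :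
  P1 [set w | forall j, c j < \sum_i B j i * X i w] =
  P2 [set w | forall j, c j < \sum_i B j i * Y i w].
Proof.
have E d (O : measurableType d) (P : probability O R) (Z : I -> O -> R) :
    [set w | forall j, c j < \sum_i B j i * Z i w] =
    [set w | forall j, 0 < \sum_i B j i * Z i w - c j].
  by apply/seteqP; split => w /= h j; have := h j; rewrite subr_gt0.
rewrite (E _ _ P1) (E _ _ P2).
apply: (@eq_orthant_probability _ _ _ _ _ (fun j w => \sum_i B j i * X i w - c j)
  _ _ _ (fun j w => \sum_i B j i * Y i w - c j)).
- move=> j; apply: measurable_funB => //; apply: measurable_sum => i.
  exact: measurable_funM.
- move=> j; apply: measurable_funB => //; apply: measurable_sum => i.
  exact: measurable_funM.
move=> a b.
have S (x : I -> R) : \sum_j a j * (\sum_i B j i * x i - c j) + b =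
    \sum_i (\sum_j a j * B j i) * x i + (b - \sum_j a j * c j).
  under eq_bigr do rewrite mulrBr.
  rewrite sumrB -addrA [- _ + b]addrC; congr (_ + _).
  under eq_bigr do rewrite mulr_sumr.
  rewrite exchange_big; apply: eq_bigr => i _; rewrite mulr_suml.
  by apply: eq_bigr => j _; rewrite mulrA.
under eq_integral do rewrite (S (fun i => X i _)).
under [RHS]eq_integral do rewrite (S (fun i => Y i _)).
exact: eqXY.
Qed.

Lemma same_law_slabs (c : I -> R) :
  P1 [set w | forall i, `|X i w| < c i] = P2 [set w | forall i, `|Y i w| < c i].
Proof.
(* A slab is the intersection of two half-spaces, hence two copies of the index set. *)
pose B (j : I + I) i : R := match j with inl j => (j == i)%:R | inr j => - (j == i)%:R end.
pose c' (j : I + I) := match j with inl j => - c j | inr j => - c j end.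
have Bl (x : I -> R) (j : I) : \sum_i B (inl j) i * x i = x j.
  rewrite (bigD1 j)//= eqxx mul1r big1 ?addr0// => i.
  by rewrite eq_sym => /negbTE ->; rewrite mul0r.
have Br (x : I -> R) (j : I) : \sum_i B (inr j) i * x i = - x j.
  by under eq_bigr do rewrite mulNr; rewrite sumrN (Bl x).
have E d (O : measurableType d) (P : probability O R) (Z : I -> O -> R) :
    [set w | forall i, `|Z i w| < c i] =
    [set w | forall j, c' j < \sum_i B j i * Z i w].
  apply/seteqP; split => w /= h.
    move=> [j|j]; have := h j; rewrite ltr_norml => /andP[h1 h2].
      by rewrite (Bl (Z ^~ w)).
    by rewrite (Br (Z ^~ w)) ltrN2.
  move=> i; have := h (inl i); have := h (inr i).
  by rewrite (Bl (Z ^~ w)) (Br (Z ^~ w)) /= ltrN2 ltr_norml => -> ->.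
by rewrite (E _ _ P1) (E _ _ P2); exact: same_law_halfspaces.
Qed.

End same_law.

(** * Gaussian families and their Gram matrices *)

Section gaussian_families.
Variable R : realType.
Local Notation gauss := (@gauss R).

Lemma integral_1Dcos d (O : measurableType d) (P : probability O R) (Z : O -> R) :
  measurable_fun setT Z ->
  (\int[P]_w (1 + cos (Z w))%:E = 1 + \int[P]_w (cos (Z w))%:E)%E.
Proof.
move=> mZ.
have mc : measurable_fun setT (fun w => cos (Z w)).
  by apply: measurableT_comp => //; exact: continuous_measurable_fun (@continuous_cos R).
under eq_integral do rewrite EFinD.
rewrite integralD//.
- by rewrite (integral_cst P measurableT) [X in (_ * X + _)%E]probability_setT mule1.
- exact: finite_measure_integrable_cst.
- apply: (@measurable_bounded_integrable _ _ _ P (fun w => cos (Z w)) setT) => //.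
    by rewrite [ltLHS](@probability_setT _ _ _ P) ltry.
  exists 1; split; first exact: num_real.
  by move=> y y1 w _ /=; rewrite (le_trans (cos_max _))// ltW.
Qed.

(** The formulas for Gaussian integrals concern nonnegative integrands; they apply to 1 + cos, and
    the constant is then subtracted. *)
Lemma eq_integral_cos d (O : measurableType d) (P : probability O R) (Z : O -> R)
    d' (O' : measurableType d') (P' : probability O' R) (Z' : O' -> R) :
  measurable_fun setT Z -> measurable_fun setT Z' ->
  (\int[P]_w (1 + cos (Z w))%:E = \int[P']_w (1 + cos (Z' w))%:E)%E ->
  (\int[P]_w (cos (Z w))%:E = \int[P']_w (cos (Z' w))%:E)%E.
Proof.
move=> mZ mZ'; rewrite !integral_1Dcos// => h; have := congr1 (fun x => x - 1)%E h.
by rewrite !(addeC 1%E) !addeK.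
Qed.

Lemma continuous_1Dcos b : continuous (fun z : R => 1 + cos (z + b)).
Proof.
move=> z; apply: cvgD; first exact: cvg_cst.
apply: continuous_comp; last exact: continuous_cos.
by apply: cvgD; [exact: cvg_id|exact: cvg_cst].
Qed.

Definition gram n (v w : nat -> R) : R := \sum_(l < n) v l * w l.

Lemma gram_sqnorm n v : gram n v v = sqnorm n v.
Proof. by apply: eq_bigr => l _; rewrite expr2. Qed.

Lemma sum_dot (I : finType) n (a : I -> R) (v : I -> nat -> R) (x : n.-tuple R) :
  \sum_i a i * dot (v i) x = dot (fun l => \sum_i a i * v i l) x.
Proof.
rewrite /dot; under eq_bigr do rewrite mulr_sumr.
rewrite exchange_big; apply: eq_bigr => l _; rewrite mulr_suml.
by apply: eq_bigr => i _; rewrite mulrA.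
Qed.

Lemma sqnorm_sum (I : finType) n (a : I -> R) (v : I -> nat -> R) :
  sqnorm n (fun l => \sum_i a i * v i l) =
  \sum_i \sum_j a i * a j * gram n (v i) (v j).
Proof.
rewrite -gram_sqnorm /gram.
under eq_bigr do rewrite mulr_suml.
rewrite exchange_big; apply: eq_bigr => i _.
under eq_bigr do rewrite mulr_sumr.
rewrite exchange_big; apply: eq_bigr => j _; rewrite mulr_sumr.
by apply: eq_bigr => l _; rewrite mulrACA.
Qed.

Lemma gaussn_cos_dot n a b :
  (\int[gaussn R n]_x (cos (dot a x + b))%:E =
   \int[gauss]_z (cos (Num.sqrt (sqnorm n a) * z + b))%:E)%E.
Proof.
apply: eq_integral_cos.
- by apply: measurable_funD => //; exact: measurable_dot.
- by apply: measurable_funD => //; exact: measurable_funM.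
apply: (@ge0_integral_gaussn_dot _ n a (fun z => 1 + cos (z + b))).
  exact: continuous_1Dcos.
by move=> z; rewrite -lerBlDl sub0r cos_geN1.
Qed.

(** Both sides depend only on the norms of linear combinations of the vectors, hence on Gram
    matrices; the two dimensions may differ. *)
Lemma same_law_gram (I : finType) n (v : I -> nat -> R) m (w : I -> nat -> R) :
  (forall i j, gram n (v i) (v j) = gram m (w i) (w j)) ->
  same_law (gaussn R n) (fun i => @dot R n (v i)) (gaussn R m) (fun i => @dot R m (w i)).
Proof.
move=> vw a b.
under eq_integral do rewrite sum_dot.
under [RHS]eq_integral do rewrite sum_dot.
rewrite !gaussn_cos_dot !sqnorm_sum.
by under eq_bigr do under eq_bigr do rewrite vw.
Qed.

End gaussian_families.

(** * Gram representation of positive semi-definite kernels *)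

Section cholesky.
Variable R : realType.
Implicit Types (D : nat -> nat -> R) (a : nat -> R).

Definition quad k D a : R := \sum_(i < k) \sum_(j < k) a i * a j * D i j.

Lemma quadS k D a : (forall i j, D i j = D j i) ->
  quad k.+1 D a = a 0%N ^+ 2 * D 0%N 0%N + a 0%N * (\sum_(i < k) a i.+1 * D i.+1 0%N) *+ 2 +
    quad k (fun i j => D i.+1 j.+1) (fun i => a i.+1).
Proof.
move=> sD; rewrite /quad big_ord_recl /= big_ord_recl /=.
under [X in _ + _ + X = _]eq_bigr do rewrite big_ord_recl /=.
rewrite big_split /= mulr2n mulr_sumr -expr2 !addrA; congr (_ + _ + _ + _).
  by apply: eq_bigr => i _; rewrite sD mulrA.
by apply: eq_bigr => i _; rewrite mulrCA mulrA.
Qed.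

(** On vectors with head t and tail the i-th unit vector, the form is affine in t; it can stay
    nonnegative only if its slope is 0. *)
Lemma psd_col0 k D i : (forall i j, D i j = D j i) -> (forall a, 0 <= quad k.+1 D a) ->
  D 0%N 0%N = 0 -> (i < k)%N -> D i.+1 0%N = 0.
Proof.
move=> sD pD d0 ik.
pose a t j : R := if j is j'.+1 then (j' == i)%:R else t.
have dE (g : nat -> R) : \sum_(j < k) (val j == i)%:R * g j = g i.
  rewrite (bigD1 (Ordinal ik))//= eqxx mul1r big1 ?addr0// => j.
  by rewrite -val_eqE /= => /negbTE ->; rewrite mul0r.
have qE t : quad k.+1 D (a t) = t * D i.+1 0%N *+ 2 + D i.+1 i.+1.
  rewrite quadS// d0 mulr0 add0r /= (dE (fun j => D j.+1 0%N)); congr (_ + _).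
  rewrite /quad /=; under eq_bigr do under eq_bigr do rewrite -mulrA.
  under eq_bigr do rewrite -mulr_sumr (dE (fun j => D _.+1 j.+1)).
  exact: (dE (fun j => D j.+1 i.+1)).
have [//|Dn0] := eqVneq (D i.+1 0%N) 0.
have := pD (a (- (D i.+1 i.+1 + 1) / (D i.+1 0%N *+ 2))).
rewrite qE (_ : _ *+ 2 = - (D i.+1 i.+1 + 1)); last by field.
by rewrite opprD addrAC addNr add0r oppr_ge0 ler10.
Qed.

(** Induction on the Schur complement of the pivot [d]. The second conclusion puts the first vector
    on the first axis: in Sidak's induction the first slab then constrains one coordinate alone. *)
Lemma cholesky k D : (forall i j, D i j = D j i) -> (forall a, 0 <= quad k D a) ->
  exists v : nat -> nat -> R,
    (forall i j, (i < k)%N -> (j < k)%N -> D i j = gram k (v i) (v j)) /\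
    (forall l, v 0%N l.+1 = 0).
Proof.
elim: k D => [|k IH] D sD pD; first by exists (fun _ _ => 0); split => // -[].
set d := D 0%N 0%N.
have d0 : 0 <= d.
  have := pD (fun j => if j is 0%N then 1 else 0); rewrite quadS//= expr1n !mul1r.
  rewrite big1 ?mul0rn ?addr0 => [|i _]; last by rewrite mul0r.
  rewrite /quad big1 ?addr0// => i _; rewrite big1// => j _; by rewrite !mul0r.
(* When [d = 0] this is 0 by the convention on division, the right value because [psd_col0] makes
   the column vanish. *)
pose w i := D i.+1 0%N / Num.sqrt d.
have wd i : (i < k)%N -> D i.+1 0%N = w i * Num.sqrt d.
  move=> ik; have [dz|dn] := eqVneq d 0; last first.
    by rewrite /w divfK// gt_eqF// sqrtr_gt0 lt_neqAle eq_sym dn.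
  by rewrite dz sqrtr0 mulr0; apply: (psd_col0 sD pD).
pose D' i j := D i.+1 j.+1 - w i * w j.
have [||v [vD _]] := IH D'.
- by move=> i j; rewrite /D' sD mulrC.
- move=> a; pose W := \sum_(i < k) a i * w i.
  have q'E : quad k D' a = quad k (fun i j => D i.+1 j.+1) a - W ^+ 2.
    rewrite /quad /D' expr2 mulr_suml -sumrB; apply: eq_bigr => i _.
    rewrite mulr_sumr -sumrB; apply: eq_bigr => j _; ring.
  have WE : \sum_(i < k) a i * D i.+1 0%N = W * Num.sqrt d.
    by rewrite mulr_suml; apply: eq_bigr => i _; rewrite wd// mulrA.
  (* For [d > 0] this head coefficient minimises the form, and the minimum is the form of the Schur
     complement. *)
  have := pD (fun j => if j is j'.+1 then a j' else - W / Num.sqrt d).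
  rewrite quadS//= WE q'E -/d.
  have [dz|dn] := eqVneq d 0.
    have W0 : W = 0.
      by rewrite /W big1// => i _; rewrite /w dz sqrtr0 invr0 !mulr0.
    by rewrite dz W0 mulr0 mul0r mulr0 mul0rn !add0r expr0n subr0.
  have sd : Num.sqrt d != 0 by rewrite gt_eqF// sqrtr_gt0 lt_neqAle eq_sym dn.
  have -> : (- W / Num.sqrt d) ^+ 2 * d = W ^+ 2.
    by rewrite -{2}(sqr_sqrtr d0); field.
  have -> : - W / Num.sqrt d * (W * Num.sqrt d) *+ 2 = - (W ^+ 2 *+ 2) by field.
  by rewrite mulr2n opprD addrA subrr add0r addrC.
exists (fun i l => match i, l with
  | 0%N, 0%N => Num.sqrt d | 0%N, _ => 0 | i'.+1, 0%N => w i' | i'.+1, l'.+1 => v i' l' end).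
split => // -[|i] [|j]; rewrite ?ltnS => ik jk; rewrite /gram big_ord_recl /=.
- rewrite -expr2 sqr_sqrtr// big1 ?addr0// => l _; by rewrite mul0r.
- by rewrite sD wd// mulrC big1 ?addr0// => l _; rewrite mul0r.
- by rewrite wd// big1 ?addr0// => l _; rewrite mulr0.
- by have := vD i j ik jk; rewrite /gram => <-; rewrite /D' addrCA subrr addr0.
Qed.

End cholesky.

Section association.
Variable R : realType.
Local Open Scope ereal_scope.
Local Notation gauss := (@gauss R).

Lemma measurable_slab (al c : R) : measurable [set y : R | (`|al * y| < c)%R].
Proof.
have : measurable [set y : R | (0 < c - `|al * y|)%R].
  apply: measurable_gt0_set; apply: measurable_funB => //.
  by apply: measurableT_comp => //; exact: measurable_funM.
by congr measurable; apply/seteqP; split => y /=; rewrite subr_gt0.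
Qed.

(** Chebyshev's association inequality: the value [kap] of [H] at the edge of the slab separates its
    values inside from those outside. *)
Lemma gauss_association (H : R -> \bar R) (al c : R) : (0 < c)%R ->
  measurable_fun setT H -> (forall y, 0 <= H y) ->
  (forall y y', (`|y| <= `|y'|)%R -> H y' <= H y) ->
  gauss [set y | (`|al * y| < c)%R] * \int[gauss]_y H y <=
  \int[gauss]_(y in [set y | (`|al * y| < c)%R]) H y.
Proof.
move=> c0 mH H0 Hdec; set S := [set y | _].
have mS : measurable S := measurable_slab al c.
have [al0|aln0] := eqVneq al 0%R.
  have -> : S = setT by apply/seteqP; split => // y _; rewrite /S /= al0 mul0r normr0.
  by rewrite [X in X * _]probability_setT mul1e.
have gal : (0 < `|al|)%R by rewrite normr_gt0.
pose kap := H (c / `|al|)%R.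
have y0 : (`|c / `|al| | = c / `|al|)%R by rewrite ger0_norm// divr_ge0// ltW.
have hS : kap * gauss S <= \int[gauss]_(y in S) H y.
  rewrite -(integral_cst gauss mS); apply: ge0_le_integral => //.
  - by move=> y _; exact: H0.
  - exact: measurable_funTS.
  - move=> y; rewrite /S /= normrM => yS; apply: Hdec.
    by rewrite y0 ler_pdivlMr// mulrC ltW.
have hC : \int[gauss]_(y in ~` S) H y <= kap * gauss (~` S).
  have mC := measurableC mS.
  rewrite -(integral_cst gauss mC); apply: ge0_le_integral => //.
  - exact: measurable_funTS.
  - move=> y; rewrite /S /= => /negP; rewrite -leNgt normrM => yS; apply: Hdec.
    by rewrite y0 ler_pdivrMr// mulrC.
have TE : \int[gauss]_y H y = \int[gauss]_(y in S) H y + \int[gauss]_(y in ~` S) H y.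
  rewrite -ge0_integral_setU//; first by rewrite setUv.
  - exact: measurableC.
  - by rewrite setUv.
  - by rewrite disj_set2E setICr.
have i0 (A : set R) : 0 <= \int[gauss]_(y in A) H y by exact: integral_ge0.
rewrite TE ge0_muleDr//.
apply: (@le_trans _ _ (gauss S * \int[gauss]_(y in S) H y +
    gauss (~` S) * \int[gauss]_(y in S) H y)).
  rewrite leeD2l//.
  apply: (@le_trans _ _ (gauss S * (kap * gauss (~` S)))).
    by rewrite lee_wpmul2l//; exact: measure_ge0.
  rewrite muleA (muleC _ kap) muleC lee_wpmul2l//; exact: measure_ge0.
rewrite -ge0_muleDl ?measure_ge0// -measureU ?setUv ?setICr//; last exact: measurableC.
by rewrite [X in X * _]probability_setT mul1e.
Qed.

End association.

Section sidak.
Variable R : realType.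
Local Open Scope ereal_scope.
Local Notation gauss := (@gauss R).

Definition slab_prob (s c : R) : R := fine (gauss [set z | (`|s * z| < c)%R]).

Lemma slab_probE s c : (slab_prob s c)%:E = gauss [set z | (`|s * z| < c)%R].
Proof. by rewrite fineK// fin_num_measure//; exact: measurable_slab. Qed.

Lemma slab_prob_ge0 s c : (0 <= slab_prob s c)%R.
Proof. by rewrite fine_ge0. Qed.

Lemma slab_prob_norm s c : slab_prob `|s|%R c = slab_prob s c.
Proof.
rewrite /slab_prob; congr (fine (gauss _)); apply/seteqP; split => z /=;
by rewrite !normrM normr_id.
Qed.

Lemma dot_tlin n (a : nat -> R) l m (u v : n.-tuple R) :
  dot a (tlin l m u v) = (l * dot a u + m * dot a v)%R.
Proof.
rewrite /dot !mulr_sumr -big_split; apply: eq_bigr => i _.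
by rewrite tnth_mktuple /=; ring.
Qed.

Section fibres.
Variables (n k : nat) (v : nat -> nat -> R) (c : nat -> R).

Let L : set (n.-tuple R * R) := [set p |
  forall i : 'I_k, (`|v i 0%N * p.2 + dot (fun l => v i l.+1) p.1| < c i)%R].

Let mL : measurable L.
Proof.
have : measurable [set p : n.-tuple R * R |
    forall i : 'I_k, (0 < c i - `|v i 0%N * p.2 + dot (fun l => v i l.+1) p.1|)%R].
  apply: measurable_orthant => i; apply: measurable_funB => //.
  apply: measurableT_comp => //; apply: measurable_funD; first exact: measurable_funM.
  by apply: measurableT_comp => //; exact: measurable_dot.
by congr measurable; apply/seteqP; split => p /= h i; have := h i; rewrite subr_gt0.
Qed.

Let scL : sym_convex L.
Proof.
split=> [u y /= Lu i|l u w y z /andP[l0 l1] /= Lu Lw i].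
  have := Lu i; congr (_ < _)%R; rewrite dot_tlin mul0r addr0 mulN1r mulrN.
  by rewrite -opprD normrN.
rewrite /= dot_tlin.
rewrite (_ : (v i 0%N * _ + _)%R = (l * (v i 0%N * y + dot (fun l => v i l.+1) u) +
  (1 - l) * (v i 0%N * z + dot (fun l => v i l.+1) w))%R); last by ring.
apply: le_lt_trans (ler_normD _ _) _; rewrite !normrM (ger0_norm l0).
rewrite [X in (_ + X * _)%R]ger0_norm ?subr_ge0//.
have [->|ln0] := eqVneq l 0%R; first by rewrite mul0r add0r subr0 mul1r.
rewrite -[ltRHS](_ : (l * c i + (1 - l) * c i = _)%R); last by rewrite -mulrDl subrKC mul1r.
by rewrite ltr_leD ?ltr_pM2l ?ler_wpM2l ?subr_ge0 ?(ltW (Lw i))// lt_neqAle eq_sym ln0.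
Qed.

Definition slab_fibre (y : R) : \bar R := gaussn R n [set u |
  forall i : 'I_k, (`|v i 0%N * y + dot (fun l => v i l.+1) u| < c i)%R].

Lemma measurable_slab_fibre : measurable_fun setT slab_fibre.
Proof.
have := @measurable_fun_ysection _ _ _ _ _ (gaussn R n) _ mL.
congr measurable_fun; apply/funext => y; rewrite /slab_fibre /=; congr (gaussn R n _).
by apply/seteqP; split => u; rewrite /ysection /= inE.
Qed.

(** Finitely many slabs cut out a symmetric convex set in (u, y), to which Anderson's theorem
    applies with ratio y / y'. *)
Lemma slab_fibre_le y y' : (`|y| <= `|y'|)%R -> slab_fibre y' <= slab_fibre y.
Proof.
move=> yy'; have [y0|y0] := eqVneq y' 0%R.
  by move: yy'; rewrite y0 normr0 normr_le0 => /eqP ->.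
have -> : y = (y / y' * y')%R by rewrite divfK.
apply: (anderson _ mL scL).
by rewrite normrM normfV ler_pdivrMr ?normr_gt0// mul1r.
Qed.

End fibres.

Lemma dot_zero n (u : n.-tuple R) (a : nat -> R) : (forall l, a l = 0%R) -> dot a u = 0%R.
Proof. by move=> a0; rewrite /dot big1// => i _; rewrite a0 mul0r. Qed.

(** In Cholesky coordinates the first form depends on the head y only, so the probability is the
    integral over a slab in y of the fibre measure of the other slabs. That measure decreases in
    |y|, so association splits off the first factor; what remains is the probability of the other
    [k] slabs. *)
Theorem sidak k n (v : nat -> nat -> R) (c : nat -> R) : (forall i, (0 < c i)%R) ->
  (\prod_(i < k) slab_prob (Num.sqrt (sqnorm n (v i))) (c i))%:E <=
  gaussn R n [set x | forall i : 'I_k, (`|dot (v i) x| < c i)%R].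
Proof.
elim: k n v c => [|k IH] n v c c0.
  rewrite big_ord0 (_ : [set x | _] = setT) ?probability_setT//.
  by apply/seteqP; split => // x _ [].
have [||w [vw w0]] := @cholesky R k.+1 (fun i j => gram n (v i) (v j)).
- by move=> i j; apply: eq_bigr => l _; rewrite mulrC.
- move=> a; rewrite /quad.
  by have := @sqnorm_sum _ _ n (fun i : 'I_k.+1 => a i) v => <-; exact: sqnorm_ge0.
have sqE (i : 'I_k.+1) : sqnorm n (v i) = sqnorm k.+1 (w i).
  by rewrite -!gram_sqnorm; exact: vw.
have -> : gaussn R n [set x | forall i : 'I_k.+1, (`|dot (v i) x| < c i)%R] =
    gaussn R k.+1 [set x | forall i : 'I_k.+1, (`|dot (w i) x| < c i)%R].
  apply: (@same_law_slabs _ _ _ _ _ (fun i : 'I_k.+1 => @dot R n (v i))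
    _ _ _ (fun i : 'I_k.+1 => @dot R k.+1 (w i))).
  - by move=> i; exact: measurable_dot.
  - by move=> i; exact: measurable_dot.
  - by apply: same_law_gram => i j; exact: vw.
have mslabs (m p : nat) (a : nat -> nat -> R) (e : nat -> R) :
    measurable [set x : p.-tuple R | forall i : 'I_m, (`|dot (a i) x| < e i)%R].
  have : measurable [set x : p.-tuple R | forall i : 'I_m, (0 < e i - `|dot (a i) x|)%R].
    apply: measurable_orthant => i; apply: measurable_funB => //.
    by apply: measurableT_comp => //; exact: measurable_dot.
  by congr measurable; apply/seteqP; split => p0 /= h i; have := h i; rewrite subr_gt0.
rewrite gaussnS//.
pose H := slab_fibre k k (fun i => w i.+1) (fun i => c i.+1).
have -> : \int[gauss]_y gaussn R k
    [set u | [set x | forall i : 'I_k.+1, (`|dot (w i) x| < c i)%R] (tcons (y, u))] =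
    \int[gauss]_(y in [set y | (`|w 0%N 0%N * y| < c 0%N)%R]) H y.
  rewrite [RHS]integral_mkcond; apply: eq_integral => y _.
  rewrite patchE; case: ifPn => [/set_mem|/negP] /= yS; last first.
    rewrite (_ : [set u | _] = set0) ?measure0// -subset0 => u /= /(_ ord0) hu.
    apply: yS; rewrite inE /=; move: hu.
    by rewrite dot_tcons dot_zero// addr0.
  congr (gaussn R k _); apply/seteqP; split => u /= hu i.
    by have := hu (lift ord0 i); rewrite dot_tcons.
  rewrite dot_tcons; case: (unliftP ord0 i) => [j ->|->]; first exact: hu.
  by rewrite dot_zero ?addr0.
apply: le_trans; last first.
  apply: (gauss_association _ (c0 0%N) (measurable_slab_fibre _ _ _ _)).
  - by move=> y; exact: (measure_ge0 (gaussn R k)).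
  - exact: slab_fibre_le.
have -> : \int[gauss]_y H y =
    gaussn R k.+1 [set x | forall i : 'I_k, (`|dot (w i.+1) x| < c i.+1)%R].
  rewrite gaussnS; last exact: (mslabs k k.+1 (fun i => w i.+1) (fun i => c i.+1)).
  apply: eq_integral => y _; congr (gaussn R k _).
  by apply/seteqP; split => u /= hu i; have := hu i; rewrite dot_tcons.
rewrite big_ord_recl EFinM; apply: lee_pmul.
- by rewrite lee_fin slab_prob_ge0.
- by rewrite lee_fin; apply: prodr_ge0 => i _; exact: slab_prob_ge0.
- rewrite -slab_probE lee_fin (sqE ord0) /sqnorm big_ord_recl big1 ?addr0; last first.
    by move=> i _; rewrite w0 expr0n.
  by rewrite sqrtr_sqr slab_prob_norm.
- under eq_bigr => i _ do rewrite (sqE (lift ord0 i)).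
  exact: (IH k.+1 (fun i => w i.+1) (fun i => c i.+1)).
Qed.

End sidak.

(** * Lower bound for finitely many times *)

Section finite_persistence.
Variable R : realType.
Local Open Scope ereal_scope.
Local Notation gauss := (@gauss R).

(* Centered Gaussian vectors of covariance [C], through their characteristic function. *)
Definition gaussian_family d (O : measurableType d) (P : probability O R) k
    (X : nat -> O -> R) (C : nat -> nat -> R) := forall (a : nat -> R) b,
  \int[P]_w (cos (\sum_(i < k) a i * X i w + b)%R)%:E =
  \int[gauss]_z (cos (Num.sqrt (quad k C a) * z + b)%R)%:E.

Lemma measurable_gt_set (s c : R) : measurable [set z : R | (c < s * z)%R].
Proof.
have : measurable [set z : R | (0 < s * z - c)%R].
  by apply: measurable_gt0_set; apply: measurable_funB => //; exact: measurable_funM.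
by congr measurable; apply/seteqP; split => y /=; rewrite subr_gt0.
Qed.

Context d (O : measurableType d) (P : probability O R).
Variables (k : nat) (X : nat -> O -> R) (C : nat -> nat -> R) (w : nat -> R) (s : R).
Hypotheses (mX : forall i, measurable_fun setT (X i))
  (symC : forall i j, C i j = C j i) (gX : gaussian_family P k X C).
Hypotheses (s0 : (0 < s)%R) (sw : forall i, (i < k)%N -> (s / 2 <= w i)%R).
Let D i j : R := C i j - w i * w j.
Hypothesis psdD : forall a, (0 <= quad k D a)%R.

Variables (m : nat) (b : nat -> nat -> R) (e : nat -> R) (eta ell : R).
Hypotheses (e0 : forall j, (0 < e j)%R) (ell0 : (0 < ell)%R).
Hypothesis slabs_sub : forall y : nat -> R,
  (forall j, (j < m)%N -> `|\sum_(i < k) b j i * y i| < e j)%R ->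
  (forall i, (i < k)%N -> `|y i| < eta)%R.

(* [X] has the law of [w * Z + Y] with [Z] standard Gaussian and [Y] an independent
   Gaussian vector of covariance [D]. *)
Lemma gaussian_persistence :
  gauss [set z | (ell < s * z)%R] *
    (\prod_(j < m) slab_prob (Num.sqrt (quad k D (b j))) (e j))%:E <=
  P [set x | forall i : 'I_k, (ell / 2 - eta < X i x)%R].
Proof.
have symD i j : D i j = D j i by rewrite /D symC mulrC.
have [v [vD _]] := cholesky symD psdD.
(* Coordinate 0 plays Z, with coefficient [w i]; the later coordinates carry the independent part of
   covariance [D]. *)
pose W i l : R := if l is l'.+1 then v i l' else w i.
have WC (i j : 'I_k) : gram k.+1 (W i) (W j) = C i j.
  rewrite /gram big_ord_recl /=.
  by have := vD i j (ltn_ord i) (ltn_ord j); rewrite /gram => <-; rewrite addrC subrK.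
have mdot (i : 'I_k) : measurable_fun setT (@dot R k.+1 (W i)) by exact: measurable_dot.
have same : same_law P (fun i : 'I_k => X i) (gaussn R k.+1) (fun i : 'I_k => @dot R k.+1 (W i)).
  move=> a c.
  pose a' (j : nat) : R := if insub j is Some j' then a j' else 0%R.
  have a'E (i : 'I_k) : a' i = a i by rewrite /a' valK.
  under [RHS]eq_integral do rewrite sum_dot.
  rewrite gaussn_cos_dot sqnorm_sum.
  have := gX a' c; under eq_integral do under eq_bigr do rewrite a'E.
  move=> ->; apply: eq_integral => z _; congr (cos (Num.sqrt _ * z + c)%R)%:E.
  by apply: eq_bigr => i _; apply: eq_bigr => j _; rewrite !a'E WC.
have h1 (d' : measure_display) (O' : measurableType d') (Y : 'I_k -> O' -> R) :
    [set x | forall i : 'I_k, (ell / 2 - eta < Y i x)%R] =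
    [set x | forall i : 'I_k, (ell / 2 - eta < \sum_(j < k) (i == j)%:R * Y j x)%R].
  have E (i : 'I_k) x : (\sum_(j < k) (i == j)%:R * Y j x = Y i x)%R.
    rewrite (bigD1 i)//= eqxx mul1r big1 ?addr0// => j.
    by rewrite eq_sym => /negbTE ->; rewrite mul0r.
  by apply/seteqP; split => x /= h i; have := h i; rewrite E.
rewrite (h1 _ _ (fun i : 'I_k => X i)).
rewrite (same_law_halfspaces (fun i : 'I_k => mX i) mdot same (fun i j : 'I_k => (i == j)%:R : R)
  (fun=> ell / 2 - eta)%R).
rewrite -(h1 _ _ (fun i : 'I_k => @dot R k.+1 (W i))).
have mEv : measurable [set x : k.+1.-tuple R | forall i : 'I_k, (ell / 2 - eta < dot (W i) x)%R].
  have : measurable [set x : k.+1.-tuple R | forall i : 'I_k, (0 < dot (W i) x - (ell / 2 - eta))%R].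
    apply: (@measurable_orthant _ _ _ _ (fun (i : 'I_k) (x : k.+1.-tuple R) => dot (W i) x - (ell / 2 - eta))%R) => i.
    by apply: measurable_funB => //; exact: mdot.
  by congr measurable; apply/seteqP; split => x /= h i; have := h i; rewrite subr_gt0.
rewrite gaussnS//.
pose u j l : R := (\sum_(i < k) b j i * v i l)%R.
pose K := [set x : k.-tuple R | forall j : 'I_m, (`|dot (u j) x| < e j)%R].
have mK : measurable K.
  have : measurable [set x : k.-tuple R | forall i : 'I_m, (0 < e i - `|dot (u i) x|)%R].
    apply: (@measurable_orthant _ _ _ _ (fun (i : 'I_m) (x : k.-tuple R) => e i - `|dot (u i) x|)%R) => i.
    apply: measurable_funB => //; by apply: measurableT_comp => //; exact: measurable_dot.
  by congr measurable; apply/seteqP; split => p0 /= h i; have := h i; rewrite subr_gt0.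
have sid : (\prod_(j < m) slab_prob (Num.sqrt (quad k D (b j))) (e j))%:E <= gaussn R k K.
  apply: le_trans (sidak m k u e0); rewrite lee_fin le_eqVlt; apply/orP; left; apply/eqP.
  apply: eq_bigr => j _; congr (slab_prob (Num.sqrt _) _).
  rewrite (@sqnorm_sum _ _ k (fun i : 'I_k => b j i) (fun i => v i)).
  by apply: eq_bigr => i _; apply: eq_bigr => i' _; rewrite (vD i i').
have mS := measurable_gt_set s ell.
apply: (@le_trans _ _ (gauss [set z | (ell < s * z)%R] * gaussn R k K)).
  by rewrite lee_wpmul2l//; exact: measure_ge0.
rewrite muleC -(integral_cst gauss mS) integral_mkcond.
have mfib := @measurable_fun_xsection _ _ _ _ _ (gaussn R k) _ (measurable_preimage_tcons mEv).
apply: ge0_le_integral => //.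
- move=> y _; rewrite patchE; case: ifPn => // _; exact: (measure_ge0 (gaussn R k)).
- exact/(measurable_restrictT _ mS)/measurable_cst.
- move: mfib; congr measurable_fun; apply/funext => y /=; congr (gaussn R k _).
  by apply/seteqP; split => x; rewrite /xsection /= inE.
move=> y _; rewrite patchE; case: ifPn => [/set_mem /= sy|_]; last exact: measure_ge0.
apply: le_measure; rewrite ?inE//.
  have := measurable_xsection y (measurable_preimage_tcons mEv).
  by congr measurable; apply/seteqP; split => x; rewrite /xsection /= inE.
move=> x Kx i /=; rewrite dot_tcons /=.
have y0 : (0 < y)%R by rewrite -(pmulr_rgt0 _ s0) (lt_trans ell0).
have : (`|dot (v i) x| < eta)%R.
  apply: (slabs_sub (y := fun i => dot (v i) x)) => // j jm.
  by have := Kx (Ordinal jm); rewrite /u -(sum_dot (fun i : 'I_k => b j i) (fun i => v i)).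
rewrite ltr_norml => /andP[h _].
(* The drift satisfies w_i y >= (s / 2) y > ell / 2, against a perturbation smaller than [eta]. *)
have : (s / 2 * y <= w i * y)%R by rewrite ler_pM2r// sw.
have : (ell / 2 < s / 2 * y)%R by rewrite mulrAC ltr_pM2r.
by move: h; rewrite /W; set t := dot _ _; set q := (w i * y)%R; set q' := (s / 2 * y)%R; lra.
Qed.

End finite_persistence.

(** * Gaussian stationary processes and spectral measures *)

Section second_moment.
Variable R : realType.
Local Open Scope ereal_scope.
Local Notation gauss := (@gauss R).
Local Notation leb := (@leb R).

(** At s = 1 + t the hypothesis reads t M <= t to first order: t > 0 gives M <= 1 and t < 0 gives M
    >= 1. The explicit [t] are small enough to dominate the second-order terms. *)
Lemma second_moment_bounds (M : R) : (0 <= M)%R ->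
  (forall s : R, 0 < s -> 1 + (1 - s ^- 2) / 2 * M <= s)%R -> M = 1%R.
Proof.
move=> M0 h; apply/eqP; rewrite eq_le; apply/andP; split; rewrite leNgt; apply/negP => M1.
- pose t := (Num.min 1 (M - 1) / 4)%R.
  have t0 : (0 < t)%R by rewrite divr_gt0// lt_min ltr01 subr_gt0.
  have t1 : (t <= 4^-1)%R by rewrite -[leRHS]mul1r ler_pM2r// ge_min lexx.
  have tM : (t <= (M - 1) / 4)%R by rewrite ler_pM2r// ge_min lexx orbT.
  have s0 : (0 < 1 + t)%R by rewrite addr_gt0.
  have := h _ s0.
  have -> : ((1 - (1 + t) ^- 2) / 2 * M = t * (M * (2 + t) / (2 * (1 + t) ^+ 2)))%R.
    by field; rewrite gt_eqF.
  rewrite lerD2l -[leRHS]mulr1 ler_pM2l// ler_pdivrMr ?mul1r; last by rewrite mulr_gt0// exprn_gt0.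
  by clear h s0; clearbody t; nra.
- pose t := ((1 - M) / 4)%R.
  have t0 : (0 < t)%R by rewrite divr_gt0// subr_gt0.
  have t1 : (t <= 4^-1)%R by rewrite -[leRHS]mul1r ler_pM2r// lerBlDr lerDl.
  have tM : M = (1 - 4 * t)%R by rewrite /t; field.
  have s0 : (0 < 1 - t)%R by lra.
  have := h _ s0.
  have -> : (1 + (1 - (1 - t) ^- 2) / 2 * M = 1 - t * (M * (2 - t) / (2 * (1 - t) ^+ 2)))%R.
    by field; rewrite gt_eqF.
  rewrite lerD2l lerN2 -[leLHS]mulr1 ler_pM2l// ler_pdivlMr ?mul1r; last by rewrite mulr_gt0// exprn_gt0.
  by clear h s0; clearbody t; subst M; nra.
Qed.

(* Comparing the densities of N(0,1) and N(0,s^2) for [s] near [1], by [1 + x <= e^x]. *)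
Lemma gauss_second_moment : \int[gauss]_z (z ^+ 2)%:E = 1.
Proof.
pose phi : R -> R := @gauss_pdf R.
have mphi : measurable_fun setT phi by exact: measurable_gauss_pdf.
have phi0 x : (0 <= phi x)%R by exact: gauss_pdf_ge0.
have msq : measurable_fun setT (fun z : R => (z ^+ 2)%R) by exact: measurable_funX.
rewrite ge0_integral_gauss; last 2 first.
- exact/measurable_EFinP.
- by move=> x; rewrite lee_fin sqr_ge0.
set M := (X in X = _).
have pw (s x : R) : (0 < s)%R ->
    (phi x * (1 + (1 - s ^- 2) / 2 * x ^+ 2) <= s * normal_pdf 0 s x)%R.
  move=> s0; rewrite normal_pdf_explicit// /phi /gauss_pdf normal_pdf_explicit//.
  set r := Num.sqrt _; rewrite !subr0 divr1 mul1r.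
  have -> y : (s * ((s * r)^-1 * y) = r^-1 * y)%R.
    by rewrite invfM mulrA [(s * _)%R]mulrA divff ?mul1r// gt_eqF.
  rewrite -[leLHS]mulrA ler_wpM2l ?invr_ge0 ?sqrtr_ge0//.
  have -> : (- (x / s) ^+ 2 / 2 = - x ^+ 2 / 2 + (1 - s ^- 2) / 2 * x ^+ 2)%R.
    by field; rewrite gt_eqF.
  by rewrite expRD ler_wpM2l ?expR_ge0// expR_ge1Dx.
have M0 : 0 <= M by apply: integral_ge0 => x _; rewrite mule_ge0// lee_fin ?sqr_ge0.
have msqphi : measurable_fun setT (fun x : R => (x ^+ 2 * phi x)%:E).
  by apply/measurable_EFinP; exact: measurable_funM.
have mpdf (s : R) : measurable_fun setT (fun x : R => (s * @normal_pdf R 0 s x)%:E).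
  by apply/measurable_EFinP; apply: measurable_funM => //; exact: measurable_normal_pdf.
have spdf (s : R) : (0 < s)%R -> \int[leb]_x (s * normal_pdf 0 s x)%:E = s%:E.
  move=> s0; under eq_integral do rewrite EFinM.
  rewrite ge0_integralZl ?integral_leb_normal_pdf ?mule1//.
  - by apply/measurable_EFinP; exact: measurable_normal_pdf.
  - by move=> x _; rewrite lee_fin normal_pdf_ge0.
  - by rewrite lee_fin ltW.
(* At s = 2 the coefficient of x^2 in [pw] is 3/8 > 0, so the second moment is controlled by the
   mass of N(0, 4). *)
have Mfin : M < +oo.
  apply: (@le_lt_trans _ _ (\int[leb]_x ((4 : R) * (2 * normal_pdf 0 2 x))%:E)).
    apply: ge0_le_integral => //.
    - by move=> x _; rewrite mule_ge0// lee_fin ?sqr_ge0.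
    - under eq_fun do rewrite EFinM.
      by apply: emeasurable_funM => //; exact: mpdf.
    move=> x _; rewrite -EFinM lee_fin.
    have := pw 2%R x; rewrite ltr0n => /(_ erefl) h.
    apply: le_trans (_ : 4 * (phi x * (1 + (1 - 2 ^- 2) / 2 * x ^+ 2)) <= _)%R; last by rewrite ler_pM2l.
    rewrite [leRHS]mulrCA [leLHS]mulrC ler_wpM2l//.
    have := sqr_ge0 x; set q := (x ^+ 2)%R => q0.
    rewrite (_ : 1 - 2 ^- 2 = 3 / 4)%R; last by field.
    by lra.
  under eq_integral do rewrite EFinM.
  rewrite ge0_integralZl ?spdf//; first by rewrite -EFinM ltry.
  by move=> x _; rewrite lee_fin mulr_ge0// normal_pdf_ge0.
have isq : leb.-integrable setT (fun x : R => (x ^+ 2 * phi x)%:E).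
  apply/integrableP; split => //.
  rewrite (_ : \int[leb]_x _ = M) //; apply: eq_integral => x _.
  by rewrite gee0_abs// lee_fin mulr_ge0 ?sqr_ge0 ?phi0.
have iphi : leb.-integrable setT (fun x : R => (phi x)%:E) by exact: leb_integrable_normal_pdf.
have MfinE : M \is a fin_num by rewrite ge0_fin_numE.
rewrite -(fineK MfinE); congr EFin; apply: second_moment_bounds; first exact: fine_ge0.
move=> s s0; rewrite -lee_fin -(spdf s s0) EFinD EFinM (fineK MfinE).
have -> : 1 + ((1 - s ^- 2) / 2)%:E * M =
    \int[leb]_x ((phi x)%:E + ((1 - s ^- 2) / 2)%:E * (x ^+ 2 * phi x)%:E).
  rewrite integralD//; last exact: integrableZl.
  by rewrite integralZl// [X in _ = X + _]integral_leb_normal_pdf.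
apply: le_integral => //.
- by apply: integrableD => //; exact: integrableZl.
- under eq_fun do rewrite EFinM.
  by apply: integrableZl => //; exact: leb_integrable_normal_pdf.
move=> x _; rewrite -EFinM -EFinD lee_fin; apply: le_trans (pw s x s0).
by rewrite le_eqVlt; apply/orP; left; apply/eqP; ring.
Qed.

End second_moment.

Section centered_gaussian_vectors.
Variable R : realType.
Local Open Scope ereal_scope.
Local Notation gauss := (@gauss R).
Context d (O : measurableType d) (P : probability O R).
Implicit Types X Y : O -> R.

Lemma ge0_integral_law X (s : R) (h : R -> R) : measurable_fun setT X -> (0 <= s)%R ->
  (forall A, measurable A -> P (X @^-1` A) = centered_normal s A) ->
  continuous h -> (forall x, 0 <= h x)%R ->
  \int[P]_w (h (X w))%:E = \int[gauss]_x (h (s * x)%R)%:E.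
Proof.
move=> mX; pose X' : {RV P >-> R} := HB.pack X (isMeasurableFun.Build _ _ _ _ X mX).
exact: (@ge0_integral_centered_gaussian _ _ _ P X').
Qed.

Lemma second_moment_law X (s : R) : measurable_fun setT X -> (0 <= s)%R ->
  (forall A, measurable A -> P (X @^-1` A) = centered_normal s A) ->
  \int[P]_w (X w ^+ 2)%:E = (s ^+ 2)%:E.
Proof.
move=> mX s0 lawX.
rewrite (@ge0_integral_law X s (fun x => x ^+ 2)%R)//; last 2 first.
- exact: exprn_continuous.
- by move=> x; exact: sqr_ge0.
under eq_integral do rewrite exprMn EFinM.
rewrite ge0_integralZl//; last 3 first.
- by apply/measurable_EFinP; exact: measurable_funX.
- by move=> x _; rewrite lee_fin sqr_ge0.
- by rewrite lee_fin sqr_ge0.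
by rewrite gauss_second_moment mule1.
Qed.

Definition square_integrable X := measurable_fun setT X /\ \int[P]_w (X w ^+ 2)%:E < +oo.

Lemma square_integrable_mul X Y : square_integrable X -> square_integrable Y ->
  P.-integrable setT (fun w => (X w * Y w)%:E).
Proof.
move=> [mX iX] [mY iY].
have mX2 : measurable_fun setT (fun w => (X w ^+ 2)%:E).
  by apply/measurable_EFinP; exact: measurable_funX.
have mY2 : measurable_fun setT (fun w => (Y w ^+ 2)%:E).
  by apply/measurable_EFinP; exact: measurable_funX.
have mXY : measurable_fun setT (fun w => (X w * Y w)%:E).
  by apply/measurable_EFinP; exact: measurable_funM.
apply/integrableP; split => //.
apply: (@le_lt_trans _ _ (\int[P]_w ((X w ^+ 2)%:E + (Y w ^+ 2)%:E))).
  apply: ge0_le_integral => //.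
  - exact: measurableT_comp.
  - exact: emeasurable_funD.
  move=> w _; rewrite -EFinD /= lee_fin normrM.
  rewrite -[(X w ^+ 2)%R]real_normK ?num_real// -[(Y w ^+ 2)%R]real_normK ?num_real//.
  have := sqr_ge0 (`|X w| - `|Y w|)%R; have := normr_ge0 (X w); have := normr_ge0 (Y w).
  by set x := `|X w|%R; set y := `|Y w|%R => x0 y0 h; nra.
rewrite ge0_integralD//; first by rewrite lte_add_pinfty.
- by move=> w _; rewrite lee_fin sqr_ge0.
- by move=> w _; rewrite lee_fin sqr_ge0.
Qed.

Lemma integral_sqr_sum k (a : nat -> R) (X : nat -> O -> R) :
  (forall i, square_integrable (X i)) ->
  \int[P]_w ((\sum_(i < k) a i * X i w) ^+ 2)%:E =
  (quad k (fun i j => fine (\int[P]_w (X i w * X j w)%:E)) a)%:E.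
Proof.
move=> sX; have iXX i j := square_integrable_mul (sX i) (sX j).
have E w : ((\sum_(i < k) a i * X i w) ^+ 2)%:E =
    \sum_(i < k) \sum_(j < k) (a i * a j)%:E * (X i w * X j w)%:E.
  rewrite expr2 mulr_suml -sumEFin; apply: eq_bigr => i _.
  rewrite mulr_sumr -sumEFin; apply: eq_bigr => j _.
  by rewrite -EFinM mulrACA.
under eq_integral do rewrite E.
have iaXX i j : P.-integrable setT (fun w => (a i * a j)%:E * (X i w * X j w)%:E).
  exact: integrableZl.
rewrite integral_sum//; last first.
  by move=> i; apply: integrable_sum => // j _; exact: iaXX.
rewrite -sumEFin; apply: eq_bigr => i _.
rewrite integral_sum//.
rewrite -sumEFin; apply: eq_bigr => j _.
rewrite integralZl//.
by rewrite [RHS]EFinM fineK// integrable_fin_num.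
Qed.

(** Recovers the mixed moment from the one-dimensional laws of X, Y and X + Y, for which
    stationarity gives shift invariance. *)
Lemma polarization X Y : square_integrable X -> square_integrable Y ->
  \int[P]_w ((X w + Y w) ^+ 2)%:E =
  \int[P]_w (X w ^+ 2)%:E + \int[P]_w (Y w ^+ 2)%:E +
    (fine (\int[P]_w (X w * Y w)%:E) *+ 2)%:E.
Proof.
move=> sX sY; have iXY := square_integrable_mul sX sY.
have [mX iX] := sX; have [mY iY] := sY.
have sq Z : square_integrable Z -> P.-integrable setT (fun w => (Z w ^+ 2)%:E).
  by move=> sZ; have := square_integrable_mul sZ sZ; under eq_fun do rewrite -expr2.
have E w : ((X w + Y w) ^+ 2)%:E =
    (X w ^+ 2)%:E + (Y w ^+ 2)%:E + 2%:E * (X w * Y w)%:E.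
  by rewrite -EFinM -!EFinD; congr EFin; ring.
under eq_integral do rewrite E.
rewrite integralD//; last 2 first.
- by apply: integrableD => //; exact: sq.
- exact: integrableZl.
rewrite integralD//; try exact: sq.
rewrite integralZl//; congr (_ + _).
by rewrite -(mulr_natl (fine _)) [RHS]EFinM fineK// integrable_fin_num.
Qed.

(** Each linear combination is N(0, s^2) for some s, and comparing second moments forces s^2 to be
    the covariance form. *)
Lemma gaussian_family_vector k (X : nat -> O -> R) :
  (forall i, measurable_fun setT (X i)) ->
  (forall m (t : 'I_m -> nat), centered_gaussian_vector P (fun i => X (t i))) ->
  gaussian_family P k X (fun i j => fine (\int[P]_w (X i w * X j w)%:E)).
Proof.
move=> mX gX.
have sX i : square_integrable (X i).
  split => //.
  have [s s0 lawX] := gX 1%N (fun=> i) (fun=> 1%R).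
  rewrite (@second_moment_law (X i) s)// ?ltry// => A mA; rewrite -lawX//.
  congr (P _); apply/seteqP; split => w /=; by rewrite big_ord1 mul1r.
move=> a b.
have [s s0 lawS] := gX k (fun i => i : nat) (fun i => a i).
have mS : measurable_fun setT (fun w => (\sum_(i < k) a i * X i w)%R).
  by apply: measurable_sum => i; exact: measurable_funM.
have s2 : (s ^+ 2)%R = quad k (fun i j => fine (\int[P]_w (X i w * X j w)%:E)) a.
  by apply: EFin_inj; rewrite -integral_sqr_sum// (second_moment_law mS s0 lawS).
rewrite -s2 sqrtr_sqr ger0_norm//.
apply: (@eq_integral_cos _ _ _ P (fun w => \sum_(i < k) a i * X i w + b)%R
  _ _ gauss (fun z => s * z + b)%R).
- exact: measurable_funD.
- by apply: measurable_funD => //; exact: measurable_funM.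
apply: (@ge0_integral_law _ s (fun x => 1 + cos (x + b))%R mS s0 lawS).
  exact: continuous_1Dcos.
by move=> z; rewrite -lerBlDl sub0r cos_geN1.
Qed.

Lemma eq_law_second_moment X Y : measurable_fun setT X -> measurable_fun setT Y ->
  (forall A, measurable A -> P (X @^-1` A) = P (Y @^-1` A)) ->
  \int[P]_w (X w ^+ 2)%:E = \int[P]_w (Y w ^+ 2)%:E.
Proof.
move=> mX mY XY.
pose X' : {RV P >-> R} := HB.pack X (isMeasurableFun.Build _ _ _ _ X mX).
pose Y' : {RV P >-> R} := HB.pack Y (isMeasurableFun.Build _ _ _ _ Y mY).
have m2 : measurable_fun setT (fun x : R => (x ^+ 2)%:E).
  by apply/measurable_EFinP; exact: measurable_funX.
have p2 (x : R) : 0 <= (x ^+ 2)%:E by rewrite lee_fin sqr_ge0.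
have := ge0_integral_distribution X' m2 p2.
have := ge0_integral_distribution Y' m2 p2.
move=> <- <-.
by apply: eq_measure_integral => A mA _; exact: XY.
Qed.

End centered_gaussian_vectors.

Section gaussian_stationary_process.
Context (R : realType) (T : time) (d : measure_display) (O : measurableType d).
Variables (P : probability O R) (f : time_index R T -> {RV P >-> R}).
Local Notation I := (time_index R T).
Hypothesis gspf : GSP f.

Let mf (t : I) : measurable_fun setT (f t : O -> R). Proof. by []. Qed.

Let sf (t : I) : square_integrable P (f t).
Proof.
split => //.
have [s s0 lawX] := GSP_gaussian gspf (fun _ : 'I_1 => t) (fun=> 1%R).
rewrite (@second_moment_law _ _ _ P (f t) s)// ?ltry// => A mA; rewrite -lawX//.
by congr (P _); apply/seteqP; split => w /=; rewrite big_ord1 mul1r.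
Qed.

Let measurable_eval (t : I) :
  measurable_fun [set: g_sigma_algebraType (@cylinders R T)] (fun g : I -> R => g t).
Proof.
move=> _ B mB; rewrite setTI; apply: sub_sigma_algebra.
by exists t, B.
Qed.

Let stationary_law (A : set (I -> R)) s :
  <<s @cylinders R T >> A -> P [set w | A (fun t => f (t + s) w)] = P [set w | A (fun t => f t w)].
Proof. exact: (GSP_stationary gspf). Qed.

Lemma gsp_sqr_shift t u s :
  (\int[P]_w ((f (t + s) w + f (u + s) w) ^+ 2)%:E =
   \int[P]_w ((f t w + f u w) ^+ 2)%:E)%E.
Proof.
apply: (@eq_law_second_moment _ _ _ P (fun w => f (t + s) w + f (u + s) w)
  (fun w => f t w + f u w)); [exact: measurable_funD|exact: measurable_funD|].
move=> B mB; apply: (@stationary_law (fun g => B (g t + g u)) s).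
have : measurable_fun [set: g_sigma_algebraType (@cylinders R T)] (fun g : I -> R => g t + g u).
  exact: measurable_funD.
by move=> /(_ measurableT B mB); rewrite setTI.
Qed.

Lemma gsp_sqr_shift1 t s :
  (\int[P]_w (f (t + s) w ^+ 2)%:E = \int[P]_w (f t w ^+ 2)%:E)%E.
Proof.
apply: (@eq_law_second_moment _ _ _ P (f (t + s)) (f t)) => // B mB.
apply: (@stationary_law (fun g => B (g t)) s).
by move: (measurable_eval t) => /(_ measurableT B mB); rewrite setTI.
Qed.

(** Shifting by [u] preserves the second moments of f(0), f(t - u) and their sum; polarization turns
    this into equality of the mixed moments. *)
Lemma gsp_covariance t u :
  fine (\int[P]_w (f t w * f u w)%:E)%E = cov_kernel f (t - u).
Proof.
have fin v : (\int[P]_w (f v w ^+ 2)%:E)%E \is a fin_num.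
  by rewrite ge0_fin_numE; [case: (sf v)|apply: integral_ge0 => w _; rewrite lee_fin sqr_ge0].
have := polarization (sf 0) (sf (t - u)).
rewrite -(gsp_sqr_shift 0 (t - u) u) add0r subrK -(gsp_sqr_shift1 0 u) add0r.
rewrite -(gsp_sqr_shift1 (t - u) u) subrK (polarization (sf u) (sf t)).
rewrite -(fineK (fin u)) -(fineK (fin t)) -!EFinD => H.
have {}H := addrI _ (EFin_inj H).
have h : fine (\int[P]_w (f u w * f t w)%:E)%E = fine (\int[P]_w (f 0 w * f (t - u) w)%:E)%E.
  by apply: (@pmulrnI _ 2).
rewrite /cov_kernel unlock /= -h; congr fine.
by apply: eq_integral => w _; rewrite mulrC.
Qed.

Lemma gsp_family k (t : nat -> I) :
  gaussian_family P k (fun i => f (t i)) (fun i j => cov_kernel f (t i - t j)).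
Proof.
have := @gaussian_family_vector _ _ _ P k (fun i => f (t i) : O -> R).
have -> : (fun i j => fine (\int[P]_w (f (t i) w * f (t j) w)%:E)%E) =
    (fun i j => cov_kernel f (t i - t j)).
  by apply/funext => i; apply/funext => j; exact: gsp_covariance.
apply; first by move=> i; exact: mf.
by move=> m u; exact: (GSP_gaussian gspf).
Qed.

End gaussian_stationary_process.

(** * Bounded functions in L^2 of the spectral measure *)

Section bounded_functions.
Variables (R : realType) (rho : {finite_measure set R -> \bar R}).
Implicit Types (g h : R -> R) (A : set R).

Definition bounded_measurable g :=
  measurable_fun setT g /\ exists M, forall x, `|g x| <= M.

Lemma bounded_measurable_cst c : bounded_measurable (fun=> c).
Proof. by split => //; exists `|c|. Qed.

Lemma bounded_measurableD g h : bounded_measurable g -> bounded_measurable h ->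
  bounded_measurable (fun x => g x + h x).
Proof.
move=> [mg [M gM]] [mh [N hN]]; split; first exact: measurable_funD.
by exists (M + N) => x; rewrite (le_trans (ler_normD _ _))// lerD.
Qed.

Lemma bounded_measurableM g h : bounded_measurable g -> bounded_measurable h ->
  bounded_measurable (fun x => g x * h x).
Proof.
move=> [mg [M gM]] [mh [N hN]]; split; first exact: measurable_funM.
by exists (M * N) => x; rewrite normrM ler_pM.
Qed.

Lemma bounded_measurable_patch g A : measurable A -> bounded_measurable g ->
  bounded_measurable (g \_ A).
Proof.
move=> mA [mg [M gM]]; split.
  by apply/(measurable_restrictT _ mA); exact: (measurable_funS _ _ mg).
exists M => x; rewrite patchE; case: ifPn => // _.
by rewrite normr0 (le_trans _ (gM x)).
Qed.

Lemma bounded_measurable_sum k (a : nat -> R) (g : nat -> R -> R) :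
  (forall i, bounded_measurable (g i)) ->
  bounded_measurable (fun x => \sum_(i < k) a i * g i x).
Proof.
move=> bg; elim: k => [|k IH].
  by under eq_fun do rewrite big_ord0; exact: bounded_measurable_cst.
under eq_fun do rewrite big_ord_recr /=; apply: bounded_measurableD => //.
by apply: bounded_measurableM => //; exact: bounded_measurable_cst.
Qed.

Lemma bounded_measurable_cos t : bounded_measurable (fun x => cos (x * t)).
Proof.
split; last by exists 1 => x; exact: cos_max.
apply: measurableT_comp; last exact: measurable_funM.
exact: continuous_measurable_fun (@continuous_cos R).
Qed.

Lemma bounded_measurable_sin t : bounded_measurable (fun x => sin (x * t)).
Proof.
split; last by exists 1 => x; exact: sin_max.
apply: measurableT_comp; last exact: measurable_funM.
exact: continuous_measurable_fun (@continuous_sin R).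
Qed.

Lemma bounded_measurable_integrable g A : measurable A -> bounded_measurable g ->
  rho.-integrable A (EFin \o g).
Proof.
move=> mA [mg [M gM]]; apply: measurable_bounded_integrable => //.
- by rewrite -ge0_fin_numE// fin_num_measure.
- by apply: (measurable_funS _ _ mg).
- by exists M; split; [exact: num_real|move=> y My x _ /=; rewrite (le_trans (gM x))// ltW].
Qed.

(** The integral over A of (g - c)^2 is nonnegative at the mean c = J / s; if A is null, both sides
    vanish. *)
Lemma Rintegral_cauchy_schwarz A g : measurable A -> bounded_measurable g ->
  (\int[rho]_(x in A) g x) ^+ 2 <= fine (rho A) * \int[rho]_(x in A) (g x ^+ 2).
Proof.
move=> mA bg; set s := fine (rho A); set J := Rintegral _ _ _.
have bg2 : bounded_measurable (fun x => g x ^+ 2) by exact: bounded_measurableM.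
have i1 := bounded_measurable_integrable mA bg.
have i2 := bounded_measurable_integrable mA bg2.
have s0 : 0 <= s by exact: fine_ge0.
have E c : \int[rho]_(x in A) ((g x - c) ^+ 2) =
    \int[rho]_(x in A) (g x ^+ 2) - c *+ 2 * J + c ^+ 2 * s.
  rewrite -RintegralZl// -(Rintegral_cst rho mA) -RintegralB//; last first.
    by apply: bounded_measurable_integrable => //; apply: bounded_measurableM => //; exact: bounded_measurable_cst.
  rewrite -RintegralD//; last 2 first.
  - apply: bounded_measurable_integrable => //; apply: (@bounded_measurableD _ (fun x => - (c *+ 2 * g x))) => //.
    under eq_fun do rewrite -mulNr.
    by apply: bounded_measurableM => //; exact: bounded_measurable_cst.
  - by apply: bounded_measurable_integrable => //; exact: bounded_measurable_cst.
  by apply: eq_Rintegral => x _; ring.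
have [s_eq0|sn0] := eqVneq s 0.
  have rA0 : rho A = 0%E by apply/eqP; rewrite -(fineK (fin_num_measure rho A mA)) eqe -/s s_eq0.
  rewrite /J /Rintegral null_set_integral ?expr0n ?s_eq0 ?mul0r//.
  by apply: measurable_int i1.
have {}s0 : 0 < s by rewrite lt_neqAle eq_sym sn0.
have : 0 <= \int[rho]_(x in A) ((g x - J / s) ^+ 2).
  by apply: Rintegral_ge0 => x _; exact: sqr_ge0.
rewrite E (_ : _ - _ + _ = \int[rho]_(x in A) (g x ^+ 2) - J ^+ 2 / s); last by field.
by rewrite subr_ge0 ler_pdivrMr// mulrC.
Qed.

Lemma le_slab_prob (s s' c : R) : `|s| <= `|s'| -> slab_prob s' c <= slab_prob s c.
Proof.
move=> ss'; rewrite -lee_fin !slab_probE; apply: le_measure; rewrite ?inE; try exact: measurable_slab.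
by move=> z /=; apply: le_lt_trans; rewrite !normrM ler_wpM2r.
Qed.

End bounded_functions.

Section spectral_representation.
Context (R : realType) (T : time) (d : measure_display) (O : measurableType d).
Variables (P : probability O R) (f : time_index R T -> {RV P >-> R}).
Variable rho : {finite_measure set R -> \bar R}.
Local Notation I := (time_index R T).
Local Notation D := (@freq_domain R T).
Hypotheses (gspf : GSP f) (srho : spectral_measure f rho) (rho1 : rho D = 1%E).
Local Notation tv := (@time_val R T).

Lemma measurable_freq_domain : measurable D.
Proof. by case: T => /=. Qed.
Let mD := measurable_freq_domain.

Lemma time_valB t u : tv (t - u) = tv t - tv u.
Proof. by case: T t u => //= t u; rewrite rmorphB. Qed.

Lemma cov_kernel_cos t : cov_kernel f t = \int[rho]_(x in D) cos (x * tv t).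
Proof.
have := congr1 (@complex.Re R) (spectral_cov srho t) => /= ->.
by apply: eq_Rintegral => x _; rewrite cosN.
Qed.

Lemma cov_kernelB t u : cov_kernel f (t - u) =
  \int[rho]_(x in D) (cos (x * tv t) * cos (x * tv u) + sin (x * tv t) * sin (x * tv u)).
Proof.
rewrite cov_kernel_cos time_valB; apply: eq_Rintegral => x _.
by rewrite mulrBr cosB.
Qed.

Lemma cov_kernelC t u : cov_kernel f (t - u) = cov_kernel f (u - t).
Proof.
by rewrite !cov_kernelB; apply: eq_Rintegral => x _; rewrite mulrC [X in _ + X]mulrC.
Qed.

Variables (k : nat) (t : nat -> I).
Let C i j := cov_kernel f (t i - t j).
Let co i x := cos (x * tv (t i)).
Let si i x := sin (x * tv (t i)).

Let bco i : bounded_measurable (co i). Proof. exact: bounded_measurable_cos. Qed.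
Let bsi i : bounded_measurable (si i). Proof. exact: bounded_measurable_sin. Qed.

Lemma Rintegral_sum_bm A n (a : nat -> R) (g : nat -> R -> R) : measurable A ->
  (forall i, bounded_measurable (g i)) ->
  \int[rho]_(x in A) (\sum_(i < n) a i * g i x) = \sum_(i < n) a i * \int[rho]_(x in A) g i x.
Proof.
move=> mA bg; elim: n => [|n IH].
  under eq_Rintegral do rewrite big_ord0.
  by rewrite big_ord0 Rintegral_cst// mul0r.
under eq_Rintegral do rewrite big_ord_recr /=.
rewrite RintegralD//; last 2 first.
- by apply: bounded_measurable_integrable => //; exact: bounded_measurable_sum.
- apply: bounded_measurable_integrable => //; apply: bounded_measurableM => //.
  exact: bounded_measurable_cst.
by rewrite IH big_ord_recr /= RintegralZl//; exact: bounded_measurable_integrable.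
Qed.

(** The integrand is the squared modulus of the sum of the a_i e^(i x t_i), split into real and
    imaginary parts. *)
Lemma quad_cov (a : nat -> R) : quad k C a =
  \int[rho]_(x in D) ((\sum_(i < k) a i * co i x) ^+ 2 + (\sum_(i < k) a i * si i x) ^+ 2).
Proof.
have -> : quad k C a = \sum_(i < k) a i * \int[rho]_(x in D)
    (\sum_(j < k) a j * (co i x * co j x + si i x * si j x)).
  apply: eq_bigr => i _.
  rewrite (@Rintegral_sum_bm D k a (fun j x => co i x * co j x + si i x * si j x))//; last first.
    by move=> j; apply: bounded_measurableD; apply: bounded_measurableM.
  rewrite mulr_sumr; apply: eq_bigr => j _; rewrite -mulrA /C cov_kernelB.
  by [].
have bs i : bounded_measurable (fun x => \sum_(j < k) a j * (co i x * co j x + si i x * si j x)).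
  apply: (@bounded_measurable_sum _ k a (fun j x => co i x * co j x + si i x * si j x)) => j.
  by apply: bounded_measurableD; apply: bounded_measurableM.
rewrite -(@Rintegral_sum_bm D k a (fun i x => \sum_(j < k) a j * (co i x * co j x + si i x * si j x)))//.
apply: eq_Rintegral => x _.
rewrite !expr2 !mulr_suml -big_split; apply: eq_bigr => i _ /=.
rewrite mulr_sumr !mulr_sumr -big_split; apply: eq_bigr => j _ /=.
by ring.
Qed.

Variable B : set R.
Hypothesis mB : measurable B.
Let s2 := fine (rho (B `&` D)).
Hypothesis s2_gt0 : 0 < s2.
Let s := Num.sqrt s2.
Let w i := (\int[rho]_(x in B `&` D) co i x) / s.

Let mBD : measurable (B `&` D). Proof. exact: measurableI. Qed.
Let s_gt0 : 0 < s. Proof. by rewrite sqrtr_gt0. Qed.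

(** Cauchy-Schwarz against the constant 1 on B; enlarging the domain to [D] and adding the sine part
    only increase the right-hand side. *)
Lemma sqr_sum_spectral (a : nat -> R) : (\sum_(i < k) a i * w i) ^+ 2 <= quad k C a.
Proof.
pose g x := \sum_(i < k) a i * co i x.
have bg : bounded_measurable g by exact: bounded_measurable_sum.
have bg2 : bounded_measurable (fun x => g x ^+ 2) by exact: bounded_measurableM.
have bh2 : bounded_measurable (fun x => (\sum_(i < k) a i * si i x) ^+ 2).
  by apply: bounded_measurableM; exact: bounded_measurable_sum.
have -> : \sum_(i < k) a i * w i = (\int[rho]_(x in B `&` D) g x) / s.
  rewrite /g (@Rintegral_sum_bm _ k a co)// mulr_suml; apply: eq_bigr => i _.
  by rewrite mulrA.
rewrite exprMn exprVn sqr_sqrtr ?(ltW s2_gt0)// ler_pdivrMr//.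
apply: le_trans (Rintegral_cauchy_schwarz rho mBD bg) _.
rewrite mulrC ler_pM2r// quad_cov RintegralD//; try exact: bounded_measurable_integrable.
apply: (@le_trans _ _ (\int[rho]_(x in D) (g x ^+ 2))); last first.
  by rewrite lerDl; apply: Rintegral_ge0 => x _; exact: sqr_ge0.
rewrite Rintegral_mkcondl; apply: le_Rintegral => //.
- apply: bounded_measurable_integrable => //; exact: bounded_measurable_patch.
- exact: bounded_measurable_integrable.
- by move=> x _; rewrite patchE; case: ifPn => // _; exact: sqr_ge0.
Qed.

Hypothesis half : forall i, (i < k)%N -> s2 / 2 <= \int[rho]_(x in B `&` D) co i x.

Variables (m : nat) (b : nat -> nat -> R) (e tau : nat -> R) (eta ell : R).
Hypotheses (e0 : forall j, 0 < e j) (ell0 : 0 < ell).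
Hypothesis slabs_sub : forall y : nat -> R,
  (forall j, (j < m)%N -> `|\sum_(i < k) b j i * y i| < e j) ->
  (forall i, (i < k)%N -> `|y i| < eta).
Hypothesis quad_le : forall j, (j < m)%N -> quad k C (b j) <= tau j ^+ 2.

(** It suffices that [tau] bounds the standard deviations of the forms of [f] itself: removing the
    part along [w] subtracts a square from each variance, and slab probabilities decrease in the
    scale. *)
Lemma spectral_persistence :
  (@gauss R [set z | (ell < s * z)%R] * (\prod_(j < m) slab_prob (tau j) (e j))%:E <=
   P [set x | forall i : 'I_k, (ell / 2 - eta < f (t i) x)%R])%E.
Proof.
pose D' i j := C i j - w i * w j.
have qD a : quad k D' a = quad k C a - (\sum_(i < k) a i * w i) ^+ 2.
  rewrite /quad expr2 mulr_suml -sumrB; apply: eq_bigr => i _.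
  by rewrite mulr_sumr -sumrB; apply: eq_bigr => j _; rewrite /D'; ring.
apply: le_trans (gaussian_persistence (C := C) (w := w) (s := s) (b := b) (e := e) _ _
  (gsp_family gspf k t) s_gt0 _ _ e0 ell0 slabs_sub).
- rewrite lee_wpmul2l// lee_fin; apply: ler_prod => j _; rewrite slab_prob_ge0/=.
  apply: le_slab_prob; rewrite ger0_norm ?sqrtr_ge0// -sqrtr_sqr ler_wsqrtr//.
  apply: le_trans (quad_le (ltn_ord j)); rewrite qD gerBl; exact: sqr_ge0.
- by [].
- by move=> i j; exact: cov_kernelC.
- move=> i ik; rewrite /w ler_pdivlMr//.
  by rewrite mulrAC -expr2 sqr_sqrtr ?(ltW s2_gt0)//; exact: half.
- by move=> a; rewrite qD subr_ge0; exact: sqr_sum_spectral.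
Qed.

End spectral_representation.

(** * Gaussian tails and chaining constants *)

Section gaussian_tails.
Variable R : realType.
Local Notation gauss := (@gauss R).
Local Notation leb := (@leb R).
Implicit Types (u x c : R).

Definition tail x : R := 1 - slab_prob 1 x.

Lemma slab_prob_le1 (s c : R) : slab_prob s c <= 1.
Proof. by rewrite -lee_fin slab_probE; apply: probability_le1; exact: measurable_slab. Qed.

Lemma tail_ge0 x : 0 <= tail x.
Proof. by rewrite subr_ge0 slab_prob_le1. Qed.

Lemma slab_prob_scale (s c : R) : 0 < s -> slab_prob s c = slab_prob 1 (c / s).
Proof.
move=> s0; rewrite /slab_prob; congr (fine (gauss _)); apply/seteqP; split => z /=;
  by rewrite mul1r normrM (gtr0_norm s0) ltr_pdivlMr// mulrC.
Qed.

Lemma tailE x : (tail x)%:E = gauss [set z | x <= `|z|].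
Proof.
rewrite EFinB slab_probE -probability_setC; last exact: measurable_slab.
congr (gauss _); apply/seteqP; split => z /=; rewrite mul1r leNgt; by move/negP.
Qed.

Lemma measurable_tail x : measurable [set z : R | x <= `|z|].
Proof.
have := measurableC (measurable_slab 1 x).
congr measurable; apply/seteqP; split => z /=; rewrite mul1r leNgt; by move/negP.
Qed.

(** For |z| >= x, half of the exponent z^2 / 2 is at least x^2 / 4; the other half is, up to
    normalisation, the density of N(0, 2). *)
Lemma tail_le x : 0 <= x -> tail x <= Num.sqrt 2 * expR (- x ^+ 2 / 4).
Proof.
move=> x0; rewrite -lee_fin tailE [leLHS](gauss_leb (measurable_tail x)).
have s20 : 0 < Num.sqrt 2 :> R by rewrite sqrtr_gt0.
have pw z : x <= `|z| -> gauss_pdf z <=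
    Num.sqrt 2 * expR (- x ^+ 2 / 4) * normal_pdf 0 (Num.sqrt 2) z.
  move=> xz; rewrite /gauss_pdf !normal_pdf_explicit// !subr0 divr1 mul1r.
  set r := Num.sqrt (pi *+ 2).
  have r0 : 0 < r by rewrite sqrtr_gt0 pmulrn_lgt0// pi_gt0.
  rewrite [leRHS](_ : _ = r^-1 *
      (expR (- x ^+ 2 / 4) * expR (- (z / Num.sqrt 2) ^+ 2 / 2))); last first.
    by field; rewrite !gt_eqF.
  rewrite ler_wpM2l ?invr_ge0 ?sqrtr_ge0// -expRD ler_expR exprMn exprVn sqr_sqrtr//.
  have : x ^+ 2 <= z ^+ 2 by rewrite -(real_normK (num_real z)) lerXn2r ?nnegrE.
  by set q := z ^+ 2; set q' := x ^+ 2 => h; lra.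
have mpdf : measurable_fun setT (fun z => (Num.sqrt 2 * expR (- x ^+ 2 / 4) * normal_pdf 0 (Num.sqrt 2) z)%:E).
  apply/measurable_EFinP; apply: measurable_funM => //; exact: measurable_normal_pdf.
have c0 : 0 <= Num.sqrt 2 * expR (- x ^+ 2 / 4) by rewrite mulr_ge0 ?sqrtr_ge0 ?expR_ge0.
apply: (@le_trans _ _ (\int[leb]_z (Num.sqrt 2 * expR (- x ^+ 2 / 4) * normal_pdf 0 (Num.sqrt 2) z)%:E)%E).
  apply: (@le_trans _ _ (\int[leb]_(z in [set z : R | (x <= `|z|)%R])
      (Num.sqrt 2 * expR (- x ^+ 2 / 4) * normal_pdf 0 (Num.sqrt 2) z)%:E)%E).
    apply: ge0_le_integral => //.
    - exact: measurable_tail.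
    - by move=> z _; rewrite lee_fin gauss_pdf_ge0.
    - by apply/measurable_funTS/measurable_EFinP; exact: measurable_gauss_pdf.
    - exact: measurable_funTS.
  apply: ge0_subset_integral => //; first exact: measurable_tail.
  by move=> z _; rewrite lee_fin mulr_ge0// normal_pdf_ge0.
under eq_integral do rewrite EFinM.
rewrite ge0_integralZl//.
- by rewrite integral_leb_normal_pdf mule1.
- by apply/measurable_EFinP; exact: measurable_normal_pdf.
- by move=> z _; rewrite lee_fin normal_pdf_ge0.
Qed.

Lemma gauss_itv_ge (a b : R) (p : R) : a <= b -> (forall z, a < z < b -> p <= gauss_pdf z) ->
  0 <= p -> ((p * (b - a))%:E <= gauss [set z | (a < z < b)%R])%E.
Proof.
move=> ab pz p0.
have -> : [set z : R | (a < z < b)%R] = [set` `]a, b[].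
  by apply/seteqP; split => z /=; rewrite in_itv.
have mI : measurable [set` `]a, b[%R] by exact: measurable_itv.
rewrite [leRHS](gauss_leb mI).
apply: (@le_trans _ _ (\int[leb]_(z in [set` `]a, b[]) (cst p%:E z))%E).
  rewrite (integral_cst leb mI) [X in (_ <= _ * X)%E](lebesgue_measure_itv `]a, b[) /= lte_fin.
  case: ifPn => [_|]; first by rewrite -EFinB -EFinM.
  by rewrite -leNgt => ba; rewrite mule0 lee_fin mulr_ge0_le0// subr_le0.
apply: ge0_le_integral => //.
- by apply/measurable_funTS/measurable_EFinP; exact: measurable_gauss_pdf.
Qed.

Lemma gauss_gt_ge u : 0 <= u -> ((gauss_pdf (u + 1))%:E <= gauss [set z | (u < z)%R])%E.
Proof.
move=> u0.
have mu : measurable [set z : R | (u < z)%R].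
  by have := measurable_gt_set 1 u; under eq_set do rewrite mul1r.
have := @gauss_itv_ge u (u + 1) (gauss_pdf (u + 1)).
rewrite addrAC subrr add0r mulr1 => h.
apply: le_trans (h _ _ _) _; rewrite ?lerDl ?gauss_pdf_ge0//.
  move=> z /andP[uz zu]; apply: gauss_pdf_le.
  by rewrite !ger0_norm ?addr_ge0// ltW// (le_lt_trans u0).
apply: le_measure; rewrite ?inE//; last by move=> z /= /andP[].
have := measurable_itv `]u, (u + 1)[.
by congr measurable; apply/seteqP; split => z /=; rewrite in_itv.
Qed.

Lemma gauss_pdf_gt0 x : 0 < gauss_pdf x.
Proof.
rewrite /gauss_pdf normal_pdf_explicit// mulr_gt0 ?expR_gt0// invr_gt0 mulr_gt0// sqrtr_gt0.
by rewrite pmulrn_lgt0// pi_gt0.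
Qed.

Lemma gauss_gt_le_tail u : (gauss [set z | (u < z)%R] <= (tail u)%:E)%E.
Proof.
rewrite tailE; apply: le_measure; rewrite ?inE.
- by have := measurable_gt_set 1 u; under eq_set do rewrite mul1r.
- exact: measurable_tail.
- by move=> z /= /ltW uz; rewrite (le_trans uz)// ler_norm.
Qed.

Lemma tail_ge u : 0 <= u -> gauss_pdf (u + 1) <= tail u.
Proof. by move=> u0; rewrite -lee_fin (le_trans (gauss_gt_ge u0))// gauss_gt_le_tail. Qed.

Lemma slab_prob_gt0 (s c : R) : 0 < c -> 0 < slab_prob s c.
Proof.
move=> c0; have [s0|sn0] := eqVneq s 0.
  rewrite -lte_fin slab_probE (_ : [set z | _] = setT) ?probability_setT//.
  by apply/seteqP; split => // z _ /=; rewrite s0 mul0r normr0.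
rewrite -slab_prob_norm slab_prob_scale ?normr_gt0//.
set q := c / _; have q0 : 0 < q by rewrite divr_gt0 ?normr_gt0.
apply: (@lt_le_trans _ _ (gauss_pdf q * (q - 0))); first by rewrite mulr_gt0 ?gauss_pdf_gt0 ?subr_gt0.
rewrite -lee_fin slab_probE.
apply: le_trans (gauss_itv_ge (ltW q0) _ _) _; rewrite ?gauss_pdf_ge0//.
  move=> z /andP[z0 zq]; apply: gauss_pdf_le.
  by rewrite !ger0_norm ?ltW.
apply: le_measure; rewrite ?inE; last first.
- by move=> z /= /andP[z0 zq]; rewrite mul1r gtr0_norm.
- exact: measurable_slab.
have := measurable_itv `]0, q[.
by congr measurable; apply/seteqP; split => z /=; rewrite in_itv.
Qed.

Lemma expR_le_pow (J : nat) x : 0 < x -> expR (- x) <= J.+1`!%:R / x ^+ J.+1.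
Proof.
move=> x0; rewrite expRN -[leRHS]invrK lef_pV2 ?posrE ?expR_gt0//; last first.
  by rewrite invr_gt0 divr_gt0 ?exprn_gt0// ltr0n fact_gt0.
rewrite invf_div; apply: le_trans (expR_ge1Dxn J (ltW x0)).
by rewrite lerDr.
Qed.

(** For u >= 1 the tail at u is at least of order e^(-(u+1)^2/2) >= e^(-2u^2), the tail at cu at
    most of order e^(-c^2u^2/4). The condition c >= 4 is c^2/4 - 2 >= c^2/8, so the ratio is at most
    of order e^(-c^2/8), below any power of 1/c. *)
Lemma tail_decay (J : nat) : exists2 C : R, 0 < C & forall c u, 4 <= c -> 1 <= u ->
  tail (c * u) <= C / c ^+ J.+1 * tail u.
Proof.
pose r := Num.sqrt (pi *+ 2 : R).
have r0 : 0 < r by rewrite sqrtr_gt0 pmulrn_lgt0// pi_gt0.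
have s20 : 0 < Num.sqrt 2 :> R by rewrite sqrtr_gt0.
exists (Num.sqrt 2 * r * (J.+1`!%:R * 8 ^+ J.+1)).
  by rewrite !mulr_gt0 ?exprn_gt0// ltr0n fact_gt0.
move=> c u c4 u1.
have c0 : 0 < c by lra.
have u0 : 0 < u by lra.
apply: le_trans (tail_le _) _; first by rewrite mulr_ge0 ?ltW.
have hu : r^-1 * expR (- (2 * u ^+ 2)) <= tail u.
  apply: le_trans (tail_ge (ltW u0)); rewrite /gauss_pdf normal_pdf_explicit// mul1r -/r.
  rewrite ler_wpM2l ?invr_ge0 ?(ltW r0)// ler_expR subr0 divr1.
  have : (u + 1) ^+ 2 <= (2 * u) ^+ 2 by rewrite lerXn2r ?nnegrE; lra.
  by rewrite exprMn; set q := (u + 1) ^+ 2; set q' := u ^+ 2; lra.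
apply: le_trans (_ : Num.sqrt 2 * r * (J.+1`!%:R * 8 ^+ J.+1) / c ^+ J.+1 *
    (r^-1 * expR (- (2 * u ^+ 2))) <= _); last first.
  by rewrite ler_wpM2l// !mulr_ge0 ?exprn_ge0 ?invr_ge0 ?exprn_ge0 ?(ltW r0) ?(ltW s20) ?(ltW c0).
have -> : Num.sqrt 2 * r * (J.+1`!%:R * 8 ^+ J.+1) / c ^+ J.+1 * (r^-1 * expR (- (2 * u ^+ 2))) =
    Num.sqrt 2 * (J.+1`!%:R * (8 ^+ J.+1 / c ^+ J.+1) * expR (- (2 * u ^+ 2))).
  by field; rewrite expf_neq0 ?gt_eqF.
rewrite ler_wpM2l ?(ltW s20)//.
have -> : - (c * u) ^+ 2 / 4 = - ((c ^+ 2 / 4 - 2) * u ^+ 2) + - (2 * u ^+ 2) by field.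
rewrite expRD ler_wpM2r ?expR_ge0//.
have c8 : 0 < c ^+ 2 / 8 by rewrite divr_gt0// exprn_gt0.
apply: le_trans (_ : expR (- (c ^+ 2 / 8)) <= _).
  rewrite ler_expR lerN2.
  have h16 : 16 <= c ^+ 2.
    by have := @lerXn2r R 2 4 c; rewrite !nnegrE => /(_ _ _ c4); rewrite -natrX; apply; lra.
  have u21 : 1 <= u ^+ 2 by rewrite exprn_ege1.
  apply: le_trans (_ : (c ^+ 2 / 4 - 2) * 1 <= _); first by move: h16; set q := c ^+ 2; lra.
  by rewrite ler_wpM2l//; move: h16; set q := c ^+ 2; lra.
apply: le_trans (expR_le_pow J c8) _.
rewrite ler_wpM2l// -!exprVn -exprMn invf_div lerXn2r ?nnegrE ?divr_ge0 ?exprn_ge0 ?(ltW c0)//.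
rewrite ler_wpM2l// lef_pV2 ?posrE ?exprn_gt0//.
by rewrite expr2 ler_peMl ?(ltW c0)//; lra.
Qed.

End gaussian_tails.

(** * Constants for the chaining sums *)

Section chaining_constants.
Variable R : realType.
Implicit Types (a : R) (x : nat -> R).

Lemma ler_1Dexpr a k : 0 <= a -> 1 + a *+ k <= (1 + a) ^+ k.
Proof.
move=> a0; elim: k => [|k IH]; first by rewrite mulr0n addr0 expr0.
rewrite exprS; apply: le_trans (_ : (1 + a) * (1 + a *+ k) <= _); last first.
  by rewrite ler_wpM2l// addr_ge0.
rewrite mulrDl mul1r mulrDr mulr1 mulrS -subr_ge0.
rewrite (_ : _ - _ = a * (a *+ k)); last by ring.
by rewrite mulr_ge0// mulrn_wge0.
Qed.

(** Weierstrass' product inequality with multiplicities; the first conclusion is carried along for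
    the induction. *)
Lemma prod_bernoulli n x (m : nat -> nat) : (forall j, 0 <= x j <= 1) ->
  0 <= \prod_(j < n) (1 - x j) ^+ m j <= 1 /\
  1 - \sum_(j < n) x j *+ m j <= \prod_(j < n) (1 - x j) ^+ m j.
Proof.
move=> x01; elim: n => [|n [/andP[P0 P1] IH]].
  by rewrite !big_ord0 ler01 lexx subr0.
rewrite !big_ord_recr /=; set Q := \prod_(j < n) _ in P0 P1 IH *.
have /andP[x0 x1] := x01 n.
have q0 : 0 <= (1 - x n) ^+ m n by rewrite exprn_ge0// subr_ge0.
have q1 : (1 - x n) ^+ m n <= 1 by rewrite exprn_ile1// ?subr_ge0// lerBlDr lerDl.
split; first by rewrite mulr_ge0//= mulr_ile1.
apply: le_trans (_ : Q * (1 - x n *+ m n) <= _); last first.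
  by rewrite ler_wpM2l// ler_bernoulli// x0.
rewrite mulrBr mulr1 opprD addrA lerB//.
by rewrite ler_piMl// mulrn_wge0.
Qed.

Lemma sum_half_le n : \sum_(j < n) (2^-1 : R) ^+ j <= 2.
Proof.
suff -> : \sum_(j < n) (2^-1 : R) ^+ j = 2 - 2 * 2^-1 ^+ n.
  by rewrite gerBl mulr_ge0// exprn_ge0.
elim: n => [|n IH]; first by rewrite big_ord0 expr0 mulr1 subrr.
by rewrite big_ord_recr /= IH exprS; field.
Qed.

(** With u = ell / be, the j-th argument is A a^j u. The polynomial decay of tails bounds the j-th
    term by (C / A) tail(u) 2^(-j), and the geometric series sums to at most 2. *)
Lemma chaining_constant (kap a : R) (K : nat) : 0 < kap -> 1 < a -> (0 < K)%N ->
  exists2 be : R, 0 < be & forall ell n, be <= ell ->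
    \sum_(j < n) tail (ell * kap * a ^+ j) *+ 2 ^ j <= tail (ell / be) / K%:R.
Proof.
move=> kap0 a1 K0.
(* A decay of order J + 1 contributes 4^(-j), which beats the multiplicity 2^j and still leaves a
   summable 2^(-j). *)
have [J aJ] : exists J : nat, 4 <= a ^+ J.+1.
  have [J HJ] : exists J : nat, 4 / (a - 1) <= J%:R.
    exists (Num.bound (4 / (a - 1))); apply: ltW; apply: archi_boundP.
    by rewrite divr_ge0// subr_ge0 ltW.
  exists J; have := @ler_1Dexpr (a - 1) J.+1; rewrite subr_ge0 (ltW a1) subrKC => /(_ erefl).
  apply: le_trans; move: HJ; rewrite ler_pdivrMr ?subr_gt0// => HJ.
  rewrite -(mulr_natl (a - 1)) -[J.+1%:R]natr1 mulrDl mul1r.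
  by move: HJ; move: (J%:R * _) => X HJ; lra.
have [C C0 decay] := @tail_decay R J.
have Kr : 0 < K%:R :> R by rewrite ltr0n.
(* The 4 meets the condition of [tail_decay]; the rest makes 2 C / A at most 1 / K. *)
pose A : R := 4 + C * 2 * K%:R.
have CK : 0 < C * 2 * K%:R by rewrite !mulr_gt0.
have A4 : 4 <= A by rewrite lerDl ltW.
have A0 : 0 < A by rewrite (lt_le_trans _ A4).
exists (A / kap); first by rewrite divr_gt0.
move=> ell n ellb; set u := ell / (A / kap).
have u1 : 1 <= u by rewrite ler_pdivlMr ?divr_gt0// mul1r.
have t0 := tail_ge0 u.
have term (j : 'I_n) : tail (ell * kap * a ^+ j) *+ 2 ^ j <= C / A * tail u * 2^-1 ^+ j.
  have aj1 : 1 <= a ^+ j by rewrite exprn_ege1// ltW.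
  have -> : ell * kap * a ^+ j = A * a ^+ j * u.
    by rewrite /u; field; rewrite !gt_eqF.
  have c4 : 4 <= A * a ^+ j by rewrite (le_trans A4)// ler_peMr// ltW.
  have := decay _ _ c4 u1.
  rewrite -(ler_pMn2r (_ : 0 < 2 ^ j)%N) ?expn_gt0// => /le_trans; apply.
  rewrite -[leLHS]mulr_natr natrX.
  apply: le_trans (_ : C / (A * 4 ^+ j) * tail u * 2 ^+ j <= _).
    rewrite ler_wpM2r ?exprn_ge0// ler_wpM2r// ler_wpM2l ?(ltW C0)//.
    rewrite lef_pV2 ?posrE ?mulr_gt0 ?exprn_gt0 ?mulr_gt0 ?exprn_gt0 ?(lt_trans ltr01 a1)//.
    rewrite exprMn ler_pM ?exprn_ge0 ?(ltW A0)//.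
      by rewrite exprS ler_peMr ?(ltW A0)// exprn_ege1// (le_trans _ A4)// ler1n.
    by rewrite -exprM mulnC exprM lerXn2r ?nnegrE ?exprn_ge0// ltW// (lt_trans ltr01 a1).
  rewrite le_eqVlt; apply/orP; left; apply/eqP.
  rewrite (_ : 4 = 2 * 2 :> R); last by rewrite -natrM.
  rewrite exprMn exprVn; field.
  by rewrite expf_neq0//= gt_eqF.
apply: (@le_trans _ _ (\sum_(j < n) C / A * tail u * 2^-1 ^+ j)).
  by apply: ler_sum => j _; exact: term.
rewrite -mulr_sumr; apply: (@le_trans _ _ (C / A * tail u * 2)).
  by rewrite ler_wpM2l ?sum_half_le// mulr_ge0// divr_ge0 ?ltW.
rewrite (_ : C / A * tail u * 2 = tail u * (C * 2 / A)); last by field; rewrite gt_eqF.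
by rewrite ler_wpM2l// ler_pdivrMr// [leRHS]mulrC ler_pdivlMr// /A lerDr.
Qed.

End chaining_constants.

Section cosine_bounds.
Variable R : realType.
Implicit Types (x y : R).

Lemma normr_sin_le x : `|sin x| <= `|x|.
Proof.
wlog x0 : x / 0 <= x.
  move=> h; have [x0|x0] := leP 0 x; first exact: h.
  by rewrite -normrN -sinN -[leRHS]normrN; apply: h; rewrite oppr_ge0 ltW.
have [c _ ->] : exists2 c, c \in `[0, x] & sin x = cos c * x.
  have [c cx E] := @MVT_segment R sin cos 0 x x0 (fun y _ => is_derive_sin y)
    (continuous_subspaceT (@continuous_sin R)).
  by exists c => //; move: E; rewrite sin0 !subr0.
by rewrite normrM ler_piMl// cos_max.
Qed.

Lemma one_minus_cosE x : 1 - cos x = sin (x / 2) ^+ 2 *+ 2.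
Proof.
have E : x = x / 2 *+ 2 by rewrite mulr2n; field.
rewrite {1}E cos_mulr2n cos2sin2; set q := sin _ ^+ 2.
by rewrite !mulr2n; ring.
Qed.

Lemma one_minus_cos_le x : 1 - cos x <= x ^+ 2 / 2.
Proof.
rewrite one_minus_cosE -(real_normK (num_real (sin _))) -(real_normK (num_real x)).
have := normr_sin_le (x / 2); rewrite normrM normfV (ger0_norm (ler0n _ 2)) => h.
have : `|sin (x / 2)| ^+ 2 <= (`|x| / 2) ^+ 2 by rewrite lerXn2r ?nnegrE ?divr_ge0.
rewrite exprMn; set q := `|x| ^+ 2; set q' := `|_| ^+ 2; rewrite exprVn => h'.
rewrite -mulr_natr; apply: le_trans (ler_wpM2r (ler0n _ 2) h') _.
by rewrite le_eqVlt; apply/orP; left; apply/eqP; field.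
Qed.

Lemma cos_ge_half x : `|x| <= 1 -> 2^-1 <= cos x.
Proof.
move=> x1; have := one_minus_cos_le x.
have : x ^+ 2 <= 1 by rewrite -(real_normK (num_real x)) exprn_ile1.
by set q := x ^+ 2; lra.
Qed.

(** The trivial bound 2 serves for |x| > 1; for |x| <= 1 one has x^2 / 2 <= |x| <= |x|^de, where de
    <= 1 enters. *)
Lemma one_minus_cos_le_powR (de x : R) : 0 < de <= 1 -> 1 - cos x <= 2 * `|x| `^ de.
Proof.
move=> /andP[d0 d1].
have [x1|x1] := leP `|x| 1; last first.
  apply: le_trans (_ : 2 * 1 <= _); first by have := cos_geN1 x; lra.
  rewrite ler_wpM2l//; have := @ge0_ler_powR _ de (ltW d0) 1 `|x|.
  by rewrite powR1; apply; rewrite ?nnegrE ?ler01 ?normr_ge0 ?(ltW x1).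
have [->|xn0] := eqVneq x 0.
  by rewrite cos0 subrr mulr_ge0 ?powR_ge0.
have xp : 0 < `|x| by rewrite normr_gt0.
apply: le_trans (one_minus_cos_le x) _.
apply: le_trans (_ : `|x| `^ 1 <= _); last first.
  apply: le_trans (_ : `|x| `^ de <= _); last by rewrite ler_peMl ?powR_ge0 ?ler1n.
  by apply: ger_powR; rewrite ?xp ?x1.
rewrite powRr1 ?normr_ge0// -(real_normK (num_real x)).
have := ler_wpM2l (normr_ge0 x) x1; rewrite mulr1 -expr2.
by have := normr_ge0 x; set q := `|x|; set q' := q ^+ 2; lra.
Qed.

End cosine_bounds.

Section deterministic_chaining.
Variable R : realType.

(** Here [y i] stands for the value at i / 2^n, so p / 2^j has index p 2^(n - j). Each point of
    level j + 1 is linked to its parent [p./2] of level j: itself for even p, its left neighbour for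
    odd p. The links telescope. *)
Lemma chaining_bound (N : R) (n : nat) (e y : nat -> R) :
  (forall p, p%:R <= N -> `|y (p * 2 ^ n)%N| < e 0%N) ->
  (forall j p, (j < n)%N -> p%:R <= N * 2 ^+ j.+1 ->
     `|y (p * 2 ^ (n - j.+1))%N - y (p./2 * 2 ^ (n - j))%N| < e j.+1) ->
  forall p, p%:R <= N * 2 ^+ n -> `|y p| < \sum_(j < n.+1) e j.
Proof.
move=> h0 hS.
suff H j : (j <= n)%N -> forall p, p%:R <= N * 2 ^+ j ->
    `|y (p * 2 ^ (n - j))%N| < \sum_(i < j.+1) e i.
  by move=> p pN; have := H n (leqnn n) p pN; rewrite subnn expn0 muln1.
elim: j => [|j IH] jn p pN.
  by rewrite big_ord_recr big_ord0 /= add0r subn0; apply: h0; rewrite expr0 mulr1 in pN.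
rewrite big_ord_recr /= addrC.
rewrite -(subrK (y (p./2 * 2 ^ (n - j))%N) (y _)).
apply: le_lt_trans (ler_normD _ _) _; apply: ltrD; first exact: hS.
apply: IH; first exact: ltnW.
rewrite -(ler_pM2r (ltr0n _ 2)) -natrM -mulrA -exprSr.
by apply: le_trans pN; rewrite ler_nat muln2 -[leqRHS]odd_double_half leq_addl.
Qed.

End deterministic_chaining.

(** * Integer time *)

Section persistence_lower_bounds.
Context (R : realType) (T : time) (d : measure_display) (O : measurableType d).
Variables (P : probability O R) (f : time_index R T -> {RV P >-> R}).

(** Removing from [A] a null set that contains the exceptional paths keeps its probability and puts
    it inside the persistence event; the outer measure is monotone. *)
Lemma persistence_ge (N : R) (A : set O) : measurable A ->
  {ae P, forall w, A w -> forall t, 0 < time_val t <= N -> 0 < f t w} ->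
  (P A <= persistence f N)%E.
Proof.
move=> mA [Z [mZ PZ0 subZ]].
rewrite /persistence; apply: (@le_trans _ _ (P (A `\` Z))).
  have -> : P (A `\` Z) = P A.
    have AZ0 : P (A `&` Z) = 0%E.
      apply/eqP; rewrite eq_le measure_ge0 andbT -PZ0; apply: le_measure; rewrite ?inE//.
      exact: measurableI.
    by rewrite [RHS](measureDI P mA mZ) [X in (_ + X)%E]AZ0 adde0.
  by [].
rewrite -(measurable_mu_extE P (measurableD mA mZ)).
apply: le_mu_ext => w [Aw Zw] /= t tN; apply: contrapT => ftw.
by apply: Zw; apply: subZ => /= h; exact: ftw (h Aw t tN).
Qed.

End persistence_lower_bounds.

Section spectral_bounds.
Context (R : realType) (T : time) (d : measure_display) (O : measurableType d).
Variables (P : probability O R) (f : time_index R T -> {RV P >-> R}).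
Variable rho : {finite_measure set R -> \bar R}.
Local Notation D := (@freq_domain R T).
Hypotheses (gspf : GSP f) (srho : spectral_measure f rho) (rho1 : rho D = 1%E).

Lemma spectral_mass_domain (B : set R) : measurable B -> rho (B `&` D) = rho B.
Proof.
move=> mB; have mD := @measurable_freq_domain R T.
have := measureU0 (mu := rho) (measurableI _ _ mB mD) (measurableC mD) (spectral_support srho).
move=> h; apply/eqP; rewrite eq_le; apply/andP; split.
  by apply: le_measure; rewrite ?inE; [exact: measurableI|exact: mB|move=> x []].
rewrite -h; apply: le_measure; rewrite ?inE; first exact: mB.
  by apply: measurableU; [exact: measurableI|exact: measurableC].
by move=> x Bx; have [Dx|nDx] := pselect (D x); [left|right].
Qed.

Lemma cov_kernel0 : cov_kernel f 0 = 1.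
Proof.
rewrite (cov_kernel_cos srho).
have -> : time_val (0 : time_index R T) = 0 by case: (T).
under eq_Rintegral do rewrite mulr0 cos0.
by rewrite (Rintegral_cst rho (@measurable_freq_domain R T)) mul1r [X in fine X]rho1.
Qed.

(* For [|x| <= 1/N] and [0 <= t <= N] one has [cos (x t) >= cos 1 >= 1/2]. *)
Lemma low_frequency_half (N : R) (t : time_index R T) : 0 < N -> 0 <= time_val t <= N ->
  fine (rho (`[- N^-1, N^-1] `&` D)) / 2 <=
  \int[rho]_(x in `[- N^-1, N^-1] `&` D) cos (x * time_val t).
Proof.
move=> N0 /andP[t0 tN].
have mB : measurable (`[- N^-1, N^-1] `&` D).
  by apply: measurableI => //; exact: measurable_freq_domain.
rewrite mulrC -(Rintegral_cst rho mB); apply: le_Rintegral => //.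
- by apply: bounded_measurable_integrable => //; exact: bounded_measurable_cst.
- by apply: bounded_measurable_integrable => //; exact: bounded_measurable_cos.
move=> x [/= + _]; rewrite in_itv /= => /andP[x1 x2]; apply: cos_ge_half.
rewrite normrM (ger0_norm t0) -(mulVf (lt0r_neq0 N0)).
by apply: ler_pM => //; rewrite ler_norml x1.
Qed.

Lemma sigma_le_sqrt (N : R) : 0 < N ->
  sigma_ rho N <= Num.sqrt (fine (rho (`[- N^-1, N^-1] `&` D))).
Proof.
move=> N0; rewrite spectral_mass_domain// ler_wsqrtr// fine_le ?fin_num_measure//.
apply: le_measure; rewrite ?inE// => x /=; rewrite !in_itv /= => /andP[x0 ->].
by rewrite andbT (le_trans _ x0)// oppr_le0 invr_ge0 ltW.
Qed.

Lemma gauss_gt_le (s s' ell : R) : 0 <= s <= s' -> 0 < ell ->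
  (@gauss R [set z | (ell < s * z)%R] <= @gauss R [set z | (ell < s' * z)%R])%E.
Proof.
move=> /andP[s0 ss'] ell0; apply: le_measure; rewrite ?inE; try exact: measurable_gt_set.
move=> z /= h; apply: (lt_le_trans h); rewrite ler_wpM2r//.
rewrite leNgt; apply/negP => z0.
by have := lt_trans ell0 h; rewrite ltNge mulr_ge0_le0// ltW.
Qed.

End spectral_bounds.

Section integer_time.
Context (R : realType) (d : measure_display) (O : measurableType d).
Variables (P : probability O R) (f : time_index R Integers -> {RV P >-> R}).
Variable rho : {finite_measure set R -> \bar R}.
Local Notation D := (@freq_domain R Integers).
Hypotheses (gspf : GSP f) (srho : spectral_measure f rho) (rho1 : rho D = 1%E).

(** The values of g at 1, ..., floor N are kept below eta = ell / (2 sqrt 2) < ell / 2, which yields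
    beta = 2 sqrt 2. Since floor N <= N, the N-th power is the smaller one, and no threshold on ell
    is needed. *)
Lemma integer_persistence (ell N : R) : 0 < ell -> 0 < N ->
  (@gauss R [set z | (ell < sigma_ rho N * z)%R] *
   ((slab_prob (2 * Num.sqrt 2) ell) `^ N)%:E <= persistence f N)%E.
Proof.
move=> ell0 N0; pose s2 := fine (rho (`[- N^-1, N^-1] `&` D)).
have mB : measurable (`[- N^-1, N^-1] : set R) by exact: measurable_itv.
have s20 : 0 <= s2 by exact: fine_ge0.
have sig := sigma_le_sqrt srho N0.
have r2 : 1 < Num.sqrt 2 :> R by rewrite -{1}sqrtr1 ltr_sqrt// ltr1n.
have [s2_eq0|s2n0] := eqVneq s2 0.
  have -> : sigma_ rho N = 0.
    by apply/eqP; rewrite eq_le sqrtr_ge0 andbT (le_trans sig)// -/s2 s2_eq0 sqrtr0.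
  rewrite (_ : [set z | _] = set0) ?measure0 ?mul0e; last first.
    by rewrite -subset0 => z /=; rewrite mul0r ltNge ltW.
  exact: mu_ext_ge0.
have s2_gt0 : 0 < s2 by rewrite lt_neqAle eq_sym s2n0.
pose k := Num.truncn N.
have kN : k%:R <= N by rewrite truncn_le ltW.
(* Time 0 is excluded from (0, N], so there are exactly floor N points. *)
pose t (i : nat) : time_index R Integers := (i.+1)%:Z.
pose eta := ell / (2 * Num.sqrt 2).
have eta0 : 0 < eta by rewrite divr_gt0// mulr_gt0// (lt_trans ltr01).
have dE (y : nat -> R) j : (j < k)%N -> \sum_(i < k) (j == i)%:R * y i = y j.
  move=> jk; rewrite (bigD1 (Ordinal jk))//= eqxx mul1r big1 ?addr0// => i.
  by rewrite -val_eqE eq_sym /= => /negbTE ->; rewrite mul0r.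
have half i : (i < k)%N -> s2 / 2 <= \int[rho]_(x in `[- N^-1, N^-1] `&` D) cos (x * time_val (t i)).
  move=> ik; apply: low_frequency_half => //.
  by rewrite /= ler0z /= (le_trans _ kN)// -pmulrn ler_nat.
have slabs (y : nat -> R) :
    (forall j, (j < k)%N -> `|\sum_(i < k) (j == i)%:R * y i| < eta) ->
    forall i, (i < k)%N -> `|y i| < eta.
  by move=> h i ik; have := h i ik; rewrite (dE y).
have quadle j : (j < k)%N ->
    quad k (fun i i' => cov_kernel f (t i - t i')) (fun i => (j == i)%:R) <= 1 ^+ 2.
  move=> jk; rewrite expr1n /quad (bigD1 (Ordinal jk))//= (bigD1 (Ordinal jk))//= eqxx !mul1r.
  rewrite subrr (cov_kernel0 srho rho1) !big1 ?addr0// => i; rewrite -val_eqE /= eq_sym => /negbTE ji.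
    by rewrite big1// => i' _; rewrite ji !mul0r.
  by rewrite ji mulr0 mul0r.
apply: (le_trans _ (le_trans (spectral_persistence gspf srho mB s2_gt0 half
  (e := fun=> eta) (tau := fun=> 1) (fun=> eta0) ell0 slabs quadle) _)).
- apply: lee_pmul => //.
  + by rewrite lee_fin powR_ge0.
  + by apply: gauss_gt_le; rewrite ?sqrtr_ge0.
  rewrite lee_fin prodr_const card_ord.
  have -> : slab_prob 1 eta = slab_prob (2 * Num.sqrt 2) ell.
    by rewrite [RHS]slab_prob_scale// mulr_gt0// (lt_trans ltr01).
  have p0 : 0 < slab_prob (2 * Num.sqrt 2) ell by exact: slab_prob_gt0.
  rewrite -powR_mulrn; last exact: ltW.
  apply: ger_powR => //.
  by rewrite p0 slab_prob_le1.
- apply: persistence_ge; last first.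
    apply: aeW => w h'' u /= /andP[u0 uN].
    have {u0}u0 : 0 < u by rewrite -(ltr0z R).
    case: u u0 uN => [[|u]|u] // _ uN.
    have uk : (u < k)%N by rewrite /k truncn_gt_nat.
    have := h'' (Ordinal uk); apply: lt_trans.
    by rewrite /eta subr_gt0 ltr_pM2l// ltf_pV2 ?posrE ?mulr_gt0 ?(lt_trans ltr01 r2)// ltr_pMr.
  have : measurable [set x | forall i : 'I_k, (0 < f (t i) x - (ell / 2 - eta))%R].
    by apply: measurable_orthant => i; exact: measurable_funB.
  by congr measurable; apply/seteqP; split => x /= h'' i; have := h'' i; rewrite subr_gt0.
Qed.

End integer_time.

Section constants.
Variable R : realType.
Local Notation gauss := (@gauss R).

(* [level_count N j] points [p / 2 ^ j] lie in [[0, N]]. *)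
Definition level_count (N : R) (j : nat) : nat := (Num.truncn (N * 2 ^+ j)).+1.

(* The Gaussian probability of all the slabs of the chaining down to level [n]. *)
Definition chain_product (kap a N ell : R) (n : nat) : R :=
  \prod_(j < n.+1) (1 - tail (ell * kap * a ^+ j)) ^+ level_count N j.

(* Below [t0] the window is the whole line; there [N] may be too small for the
   [N]-th power to absorb the chaining, and a threshold [L] far below [ell] leaves room. *)
Definition good_constants (kap a t0 be ell0 : R) : Prop :=
  [/\ 0 < be, 0 < ell0 &
  forall ell N : R, ell0 < ell -> 0 < N ->
    (t0 <= N -> forall n, slab_prob be ell `^ N <= chain_product kap a N ell n) /\
    (N < t0 -> exists2 L : R, 0 < L & forall n,
      (gauss [set z | (ell < z)%R] <=
       gauss [set z | (L < z)%R] * (chain_product kap a N L n)%:E)%E)].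

Lemma level_count_le (N : R) j : 0 <= N ->
  (level_count N j <= 2 ^ j * (Num.truncn N).+1)%N.
Proof.
move=> N0; rewrite /level_count truncn_lt_nat; last by rewrite mulr_ge0// exprn_ge0.
by rewrite natrM natrX mulrC ltr_pM2l ?exprn_gt0// truncnS_gt.
Qed.

Lemma tail_itv (x : R) : 0 < x -> 0 <= tail x < 1.
Proof. by move=> x0; rewrite tail_ge0/= ltrBlDr ltrDl slab_prob_gt0. Qed.

Lemma chain_product_ge (kap a N L T : R) n : 0 < kap -> 1 < a -> 0 < L -> 0 <= N -> T <= 1 ->
  \sum_(j < n.+1) tail (L * kap * a ^+ j) *+ 2 ^ j <= T ->
  (1 - T) ^+ (Num.truncn N).+1 <= chain_product kap a N L n.
Proof.
move=> k0 a1 L0 N0 T1 sumT.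
pose x j := tail (L * kap * a ^+ j).
have x01 j : 0 <= x j <= 1.
  have /tail_itv/andP[-> /ltW ->//] : 0 < L * kap * a ^+ j.
  by rewrite !mulr_gt0// exprn_gt0// (lt_trans ltr01).
have [_ pb] := prod_bernoulli n.+1 (fun j => 2 ^ j)%N x01.
apply: (@le_trans _ _ ((\prod_(j < n.+1) (1 - x j) ^+ (2 ^ j)) ^+ (Num.truncn N).+1)).
  rewrite lerXn2r ?nnegrE ?subr_ge0//.
    by apply: prodr_ge0 => j _; rewrite exprn_ge0// subr_ge0; case/andP: (x01 j).
  by apply: le_trans pb; rewrite lerD2l lerN2.
rewrite -prodrXl; apply: ler_prod => j _; have /andP[x0 x1] := x01 j.
rewrite !exprn_ge0 ?subr_ge0//= -exprM.
apply: ler_wiXn2l; rewrite ?subr_ge0// ?lerBlDr ?lerDl//.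
exact: level_count_le.
Qed.

Lemma good_constants_exist (kap a t0 : R) : 0 < kap -> 1 < a -> 0 < t0 <= 1 ->
  exists be ell0, good_constants kap a t0 be ell0.
Proof.
move=> k0 a1 /andP[t00 t01].
(* Thus floor N + 1 <= N + 1 <= K N whenever N >= t0, and by Bernoulli 1 - T <= (1 - T / K)^K
   absorbs the factor K. *)
have [K KP] : exists K : nat, 1 + t0^-1 <= K%:R.
  exists (Num.bound (1 + t0^-1)); apply: ltW; apply: archi_boundP.
  by rewrite addr_ge0// invr_ge0 ltW.
have K1 : 1 <= K%:R :> R by rewrite (le_trans _ KP)// lerDl invr_ge0 ltW.
have K0 : (0 < K)%N by move: K1; rewrite ler1n.
have Kr : 0 < K%:R :> R by rewrite ltr0n.
have [be be0 chain] := chaining_constant k0 a1 K0.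
have TK (x : R) : 0 < x -> tail x / K%:R <= tail x.
  by move=> x0; rewrite ler_pdivrMr// ler_peMr// tail_ge0.
pose g := fine (gauss [set z | (be < z)%R]).
have mgt (u : R) : measurable [set z : R | (u < z)%R].
  by have := measurable_gt_set 1 u; under eq_set do rewrite mul1r.
have gE : g%:E = gauss [set z | (be < z)%R] by rewrite fineK// fin_num_measure.
have g0 : 0 < g.
  by rewrite -lte_fin gE (lt_le_trans _ (gauss_gt_ge (ltW be0)))// lte_fin gauss_pdf_gt0.
pose c := g * (1 - tail 1).
have /andP[_ tail1] := tail_itv (@ltr01 R).
have c0 : 0 < c by rewrite mulr_gt0// subr_gt0.
(* The first summand ensures be <= ell. The second makes the tail bound sqrt 2 e^(-ell^2/4) at most
   the constant [c], using only e^x >= 1 + x. *)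
exists be, (be + 2 * (Num.sqrt 2 / c + 1)); split => //.
  by rewrite addr_gt0// mulr_gt0// addr_gt0// divr_gt0// sqrtr_gt0.
move=> ell N ell0 N0.
have s2c : 0 < Num.sqrt 2 / c by rewrite divr_gt0// sqrtr_gt0.
have bell : be <= ell by rewrite (le_trans _ (ltW ell0))// lerDl mulr_ge0// ltW// addr_gt0.
have ellp : 0 < ell by rewrite (lt_le_trans be0).
split => [tN n|Nt].
  set T := tail (ell / be).
  have /andP[T0 T1] : 0 <= T < 1 by apply: tail_itv; rewrite divr_gt0.
  have TKT : T / K%:R <= T by apply: TK; rewrite divr_gt0.
  have TK1 : T / K%:R < 1 by rewrite (le_lt_trans TKT).
  apply: le_trans (chain_product_ge k0 a1 ellp (ltW N0) (ltW TK1) (chain _ n.+1 bell)).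
  set b := 1 - T / K%:R.
  have b0 : 0 < b by rewrite subr_gt0.
  have b1 : b <= 1 by rewrite lerBlDr lerDl divr_ge0// ltW.
  rewrite slab_prob_scale//.
  have -> : slab_prob 1 (ell / be) = 1 - T by rewrite /T /tail subKr.
  apply: (@le_trans _ _ ((b ^+ K) `^ N)).
    apply: ge0_ler_powR; rewrite ?nnegrE ?(ltW N0) ?exprn_ge0 ?(ltW b0) ?subr_ge0 ?(ltW T1)//.
    have := @ler_bernoulli _ (T / K%:R) K; rewrite divr_ge0 ?(ltW TK1) ?(ltW Kr)//= => /(_ erefl).
    by rewrite -(mulr_natr (T / K%:R)) divfK// gt_eqF.
  rewrite -(powR_mulrn _ (ltW b0)) -powRrM -(powR_mulrn _ (ltW b0)).
  apply: ger_powR; first by rewrite b0.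
  rewrite -natr1; apply: (@le_trans _ _ (N + 1)); first by rewrite lerD2r truncn_le ltW.
  apply: (@le_trans _ _ ((1 + t0^-1) * N)); last by rewrite ler_pM2r.
  by rewrite mulrDl mul1r lerD2l mulrC ler_pdivlMr// mul1r.
(* With L = be the ratio L / be is 1, and floor N = 0 because N < t0 <= 1; the chaining product is
   then at least [1 - tail 1] for every [n]. *)
exists be => // n.
set T := tail (be / be).
have TE : T = tail 1 by rewrite /T divff// gt_eqF.
have TKT : T / K%:R <= T by apply: TK; rewrite divr_gt0.
have TK1 : T / K%:R < 1 by rewrite (le_lt_trans TKT)// TE.
have := chain_product_ge k0 a1 be0 (ltW N0) (ltW TK1) (chain _ n.+1 (lexx be)).
have -> : Num.truncn N = 0%N.
  by apply/eqP; rewrite -leqn0 truncn_le_nat (lt_le_trans Nt).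
rewrite expr1 => cp.
apply: (@le_trans _ _ c%:E); last first.
  rewrite -gE -EFinM lee_fin ler_wpM2l ?(ltW g0)// (le_trans _ cp)//.
  by rewrite lerD2l lerN2 -TE.
apply: le_trans (gauss_gt_le_tail ell) _; rewrite lee_fin.
apply: le_trans (tail_le (ltW ellp)) _.
rewrite -ler_pdivlMl ?sqrtr_gt0// mulNr expRN -[leRHS]invrK lef_pV2 ?posrE ?expR_gt0//; last first.
  by rewrite invr_gt0 mulr_gt0// invr_gt0 sqrtr_gt0.
rewrite invfM invrK; apply: le_trans (expR_ge1Dx _).
have h : 2 * (Num.sqrt 2 / c + 1) <= ell by rewrite (le_trans _ (ltW ell0))// lerDr ltW.
have h2 : (2 * (Num.sqrt 2 / c + 1)) ^+ 2 <= ell ^+ 2.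
  by rewrite lerXn2r ?nnegrE ?(ltW ellp)// mulr_ge0// ltW// addr_gt0.
move: h2 s2c; rewrite exprMn; move: (Num.sqrt 2 / c) (ell ^+ 2) => y q h2 y0.
by rewrite (_ : 1 + q / 4 = q / 4 + 1)//; nra.
Qed.

End constants.

(** * Real time *)

Section spectral_increments.
Context (R : realType) (d : measure_display) (O : measurableType d).
Variables (P : probability O R) (f : time_index R Reals -> {RV P >-> R}).
Variable rho : {finite_measure set R -> \bar R}.
Local Notation D := (@freq_domain R Reals).
Hypotheses (gspf : GSP f) (srho : spectral_measure f rho) (rho1 : rho D = 1%E).
Variable delta : R.
Hypotheses (delta0 : 0 < delta) (finite_moment : (spectral_moment Reals rho delta < +oo)%E).
Local Notation m := (fine (spectral_moment Reals rho delta)).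
Local Notation de := (Num.min delta 1).

Lemma spectral_moment_ge0 : 0 <= m.
Proof. by apply: fine_ge0; apply: integral_ge0 => x _; rewrite lee_fin powR_ge0. Qed.

(** The left side is the variance of an increment over time t. Cutting the exponent at 1 permits the
    cosine bound, and |x|^de <= 1 + |x|^delta brings back the given moment. *)
Lemma increment_le (t : R) :
  \int[rho]_(x in D) (2 - 2 * cos (x * t)) <= 4 * (1 + m) * `|t| `^ de.
Proof.
have mD := @measurable_freq_domain R Reals.
have de01 : 0 < de <= 1 by rewrite lt_min delta0 ltr01 ge_min lexx orbT.
have mp : measurable_fun D (fun x : R => `|x| `^ delta).
  exact: (measurableT_comp (measurable_powR delta)).
have imom : rho.-integrable D (EFin \o (fun x : R => `|x| `^ delta)).
  apply/integrableP; split; first exact/measurable_EFinP.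
  rewrite (_ : (\int[rho]_(x in D) _)%E = spectral_moment Reals rho delta)//.
  by apply: eq_integral => x _ /=; rewrite ger0_norm ?powR_ge0.
have icst c : rho.-integrable D (EFin \o cst c).
  by apply: bounded_measurable_integrable => //; exact: bounded_measurable_cst.
have isum : rho.-integrable D (EFin \o (fun x : R => 1 + `|x| `^ delta)).
  exact: (integrableD _ (icst 1) imom).
pose c := 4 * `|t| `^ de.
have -> : 4 * (1 + m) * `|t| `^ de = \int[rho]_(x in D) (c * (1 + `|x| `^ delta)).
  rewrite RintegralZl// RintegralD//; last exact: (icst 1).
  rewrite (Rintegral_cst rho mD) (congr1 fine rho1) mulr1.
  by rewrite /Rintegral -/(spectral_moment Reals rho delta) /c mulrAC.
apply: le_Rintegral => //.
- apply: bounded_measurable_integrable => //; apply: bounded_measurableD.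
    exact: bounded_measurable_cst.
  under eq_fun do rewrite -mulNr.
  apply: bounded_measurableM; [exact: bounded_measurable_cst|exact: bounded_measurable_cos].
- exact: (integrableZl _ _ isum).
move=> x _.
have h := one_minus_cos_le_powR (x * t) de01.
rewrite normrM powRM// in h.
apply: (@le_trans _ _ (c * `|x| `^ de)).
  by rewrite /c; move: h; set u := _ `^ _; set v := _ `^ _; set w := cos _; nra.
rewrite ler_wpM2l ?mulr_ge0 ?powR_ge0//.
have [x1|x1] := leP `|x| 1.
  rewrite (@le_trans _ _ 1)// ?lerDl ?powR_ge0//.
  have := @ge0_ler_powR _ de _ `|x| 1; rewrite powR1; apply; rewrite ?nnegrE//.
  by case/andP: de01 => /ltW.
rewrite (@le_trans _ _ (`|x| `^ delta)) ?lerDr//.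
by apply: ler_powR; [exact: ltW|rewrite ge_min lexx].
Qed.

Lemma cov_increment (t : R) : 2 - 2 * cov_kernel f t = \int[rho]_(x in D) (2 - 2 * cos (x * t)).
Proof.
have mD := @measurable_freq_domain R Reals.
rewrite RintegralB//; last 2 first.
- by apply: bounded_measurable_integrable => //; exact: bounded_measurable_cst.
- apply: bounded_measurable_integrable => //; apply: bounded_measurableM.
  + exact: bounded_measurable_cst.
  + exact: bounded_measurable_cos.
rewrite (Rintegral_cst rho mD) (congr1 fine rho1) mulr1 RintegralZl//; last first.
  by apply: bounded_measurable_integrable => //; exact: bounded_measurable_cos.
by rewrite (cov_kernel_cos srho).
Qed.

(** Up to this time the increment variance 2 - 2 r(t) is at most 1/2. This permits the whole line as
    window on short horizons, where the cosine mean is r(t) itself. *)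
Lemma short_time_half (t : R) : 0 <= t <= (8 * (1 + m))^-1 `^ de^-1 -> 2^-1 <= cov_kernel f t.
Proof.
move=> /andP[t0 th]; have m0 := spectral_moment_ge0.
have m1 : 0 < 1 + m by rewrite (lt_le_trans ltr01)// lerDl.
have de0 : 0 < de by rewrite lt_min delta0 ltr01.
have := increment_le t; rewrite -cov_increment ger0_norm//.
have : t `^ de <= (8 * (1 + m))^-1.
  have := @ge0_ler_powR _ de (ltW de0) t ((8 * (1 + m))^-1 `^ de^-1).
  rewrite -powRrM mulVf ?gt_eqF// powRr1 ?invr_ge0 ?mulr_ge0 ?(ltW m1)//.
  by apply; rewrite ?nnegrE ?powR_ge0.
move=> h1 h2.
have : 4 * (1 + m) * t `^ de <= 4 * (1 + m) * (8 * (1 + m))^-1.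
  by rewrite ler_wpM2l// mulr_ge0// ltW.
rewrite (_ : 4 * (1 + m) * (8 * (1 + m))^-1 = 2^-1); last by field; rewrite gt_eqF.
by move: h2; lra.
Qed.

End spectral_increments.

(** * Chaining down to one dyadic level *)

Section dyadic_level.
Context (R : realType) (d : measure_display) (O : measurableType d).
Variables (P : probability O R) (f : time_index R Reals -> {RV P >-> R}).
Variable rho : {finite_measure set R -> \bar R}.
Local Notation D := (@freq_domain R Reals).
Hypotheses (gspf : GSP f) (srho : spectral_measure f rho) (rho1 : rho D = 1%E).
Variables (c a : R).
Hypotheses (c0 : 0 < c) (a1 : 1 < a).
Hypothesis increment : forall j, 2 - 2 * cov_kernel f (2^-1 ^+ j) <= (c * a^-1 ^+ j.*2) ^+ 2.
Hypothesis c1 : 1 <= c ^+ 2.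

Lemma level_countP (N : R) j p : 0 <= N -> (p < level_count N j)%N = (p%:R <= N * 2 ^+ j).
Proof. by move=> N0; rewrite ltnS truncn_ge_nat// mulr_ge0// exprn_ge0. Qed.

Lemma sum_pointwise k u (y : nat -> R) : (u < k)%N -> \sum_(i < k) (u == i)%:R * y i = y u.
Proof.
move=> uk; rewrite (bigD1 (Ordinal uk))//= eqxx mul1r big1 ?addr0// => i.
by rewrite -val_eqE eq_sym /= => /negbTE ->; rewrite mul0r.
Qed.

Lemma sum_difference k u v (y : nat -> R) : (u < k)%N -> (v < k)%N ->
  \sum_(i < k) ((u == i)%:R - (v == i)%:R) * y i = y u - y v.
Proof.
move=> uk vk; rewrite -(sum_pointwise y uk) -(sum_pointwise y vk) -sumrB.
by apply: eq_bigr => i _; rewrite mulrBl.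
Qed.

Variables (N ell : R) (n : nat).
Hypotheses (N0 : 0 < N) (ell0 : 0 < ell).
Let k := level_count N n.
Let t (i : nat) : time_index R Reals := i%:R / 2 ^+ n.
Let lam := a^-1.
(** Normalised so that the widths sum to at most ell / 4. The deviations [tau] decay like lam^(2j),
    so the ratio of width to deviation grows like a^j. *)
Let e j := ell * (1 - lam) / 4 * lam ^+ j.
Let tau j := c * lam ^+ j.*2.
Let lam0 : 0 < lam. Proof. by rewrite invr_gt0 (lt_trans ltr01). Qed.
Let lam1 : lam < 1. Proof. by rewrite invf_lt1 // (lt_trans ltr01). Qed.
Let e_gt0 j : 0 < e j.
Proof. by rewrite mulr_gt0 ?exprn_gt0// mulr_gt0// mulr_gt0// subr_gt0. Qed.

Let cs := [seq (j, p) | j <- iota 0 n.+1, p <- iota 0 (level_count N j)].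
(** Coefficients, on the grid of mesh 2^(-n), of the value at an integer time (level 0) or of the
    difference between a dyadic point and its parent. *)
Let form (q : nat * nat) (i : nat) : R :=
  if q.1 is j.+1 then (q.2 * 2 ^ (n - j.+1) == i)%N%:R - (q.2./2 * 2 ^ (n - j) == i)%N%:R
  else (q.2 * 2 ^ n == i)%N%:R.

Let csP j p : ((j, p) \in cs) = (j <= n)%N && (p%:R <= N * 2 ^+ j).
Proof.
rewrite -level_countP ?(ltW N0)//; apply/allpairsPdep/andP => [[j' [p' [+ + [-> ->]]]]|[jn pN]].
  by rewrite !mem_iota !add0n.
by exists j, p; rewrite !mem_iota.
Qed.

Let parent_le j p : p%:R <= N * 2 ^+ j.+1 -> p./2%:R <= N * 2 ^+ j.
Proof.
move=> pN; rewrite -(ler_pM2r (ltr0n _ 2)) -natrM -mulrA -exprSr.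
by apply: le_trans pN; rewrite ler_nat muln2 -[leqRHS]odd_double_half leq_addl.
Qed.

Let refine_lt j p : (j <= n)%N -> p%:R <= N * 2 ^+ j -> (p * 2 ^ (n - j) < k)%N.
Proof.
move=> jn pN; rewrite /k level_countP ?(ltW N0)// natrM natrX.
have -> : 2 ^+ n = 2 ^+ j * 2 ^+ (n - j) :> R by rewrite -exprD subnKC.
by rewrite mulrA ler_pM2r ?exprn_gt0.
Qed.

Let form0 p (y : nat -> R) : p%:R <= N ->
  \sum_(i < k) form (0%N, p) i * y i = y (p * 2 ^ n)%N.
Proof. by move=> pN; apply: sum_pointwise; rewrite -[n]subn0 refine_lt// expr0 mulr1. Qed.

Let formS j p (y : nat -> R) : (j < n)%N -> p%:R <= N * 2 ^+ j.+1 ->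
  \sum_(i < k) form (j.+1, p) i * y i =
  y (p * 2 ^ (n - j.+1))%N - y (p./2 * 2 ^ (n - j))%N.
Proof.
move=> jn pN; apply: sum_difference; apply: refine_lt => //; first exact: ltnW.
exact: parent_le.
Qed.

Let form_slabs (y : nat -> R) :
  (forall q, q \in cs -> `|\sum_(i < k) form q i * y i| < e q.1) ->
  forall i, (i < k)%N -> `|y i| < ell / 4.
Proof.
move=> h i; rewrite /k level_countP ?(ltW N0)// => iN.
apply: lt_le_trans (chaining_bound (N := N) (n := n) (e := e) _ _ iN) _.
- move=> p pN; rewrite -(form0 y pN); apply: (h (0%N, p)).
  by rewrite csP expr0 mulr1 pN.
- move=> j p jn pN; rewrite -(formS y jn pN); apply: (h (j.+1, p)).
  by rewrite csP jn pN.
rewrite /e -mulr_sumr (_ : ell * (1 - lam) / 4 = ell / 4 * (1 - lam)); last by field.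
rewrite -mulrA -[leRHS]mulr1 ler_wpM2l ?divr_ge0 ?(ltW ell0)//.
by rewrite -opprB mulNr -subrX1 opprB gerBl exprn_ge0// ltW.
Qed.

Let C i j := cov_kernel f (t i - t j).

Let quadE (b : nat -> R) : quad k C b = \sum_(i < k) b i * \sum_(j < k) b j * C i j.
Proof.
by apply: eq_bigr => i _; rewrite mulr_sumr; apply: eq_bigr => j _; rewrite mulrA.
Qed.

Let Cdiag i : C i i = 1.
Proof. by rewrite /C subrr (cov_kernel0 srho rho1). Qed.

Let dyadicE l p : (l <= n)%N -> t (p * 2 ^ (n - l))%N = p%:R * 2^-1 ^+ l.
Proof.
move=> ln; rewrite /t -[in X in _ / X](subnK ln) exprD natrM natrX exprVn; field.
by rewrite !expf_neq0.
Qed.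

(** At level 0 the variance is 1, which [c1] covers. At level j + 1 it is that of an increment over
    2^(-(j+1)) for odd p, and 0 for even p, where the point is its own parent. *)
Let form_quad q : q \in cs -> quad k C (form q) <= tau q.1 ^+ 2.
Proof.
case: q => -[|j] p; rewrite csP => /andP[jn pN]; rewrite quadE.
  rewrite expr0 mulr1 in pN.
  under eq_bigr do rewrite (form0 (C _) pN).
  by rewrite (form0 (fun i => C i _) pN) Cdiag /tau expr0 mulr1.
under eq_bigr do rewrite (formS (C _) jn pN).
rewrite (formS (fun i => C i _ - C i _) jn pN) !Cdiag.
set u := (p * _)%N; set v := (p./2 * _)%N.
have -> : C v u = C u v by exact: (cov_kernelC srho).
rewrite (_ : _ - _ = 2 - 2 * C u v); last by ring.
have -> : C u v = cov_kernel f (if odd p then 2^-1 ^+ j.+1 else 0).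
  congr cov_kernel; rewrite /u /v !dyadicE//; last exact: ltnW.
  rewrite (exprS _ j) -{1}(odd_double_half p) natrD -muln2 natrM.
  by case: (odd p) => /=; field.
case: ifP => _; first exact: increment.
by rewrite (cov_kernel0 srho rho1) mulr1 subrr sqr_ge0.
Qed.

(** The product over the list of slabs regroups by level into [chain_product]; its first parameter
    is the ratio e_0 / (ell tau_0). *)
Lemma level_persistence (B : set R) : measurable B -> 0 < fine (rho (B `&` D)) ->
  (forall p : nat, p%:R <= N * 2 ^+ n ->
     fine (rho (B `&` D)) / 2 <= \int[rho]_(x in B `&` D) cos (x * (p%:R / 2 ^+ n))) ->
  (@gauss R [set z | (ell < Num.sqrt (fine (rho (B `&` D))) * z)%R] *
   (chain_product ((1 - a^-1) / (4 * c)) a N ell n)%:E <=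
   P [set x | forall i : 'I_k, (ell / 4 < f (t i) x)%R])%E.
Proof.
move=> mB B0 half.
pose b q := form (nth (0, 0)%N cs q).
have := @spectral_persistence R Reals d O P f rho gspf srho k t B mB B0 _
  (size cs) b (fun q => e (nth (0, 0)%N cs q).1) (fun q => tau (nth (0, 0)%N cs q).1)
  (ell / 4) ell _ ell0 _ _.
have -> : ell / 2 - ell / 4 = ell / 4 by field.
have -> : \prod_(q < size cs) slab_prob (tau (nth (0, 0)%N cs q).1) (e (nth (0, 0)%N cs q).1) =
    chain_product ((1 - a^-1) / (4 * c)) a N ell n.
  rewrite -(big_mkord xpredT (fun q => slab_prob (tau (nth (0, 0)%N cs q).1) (e (nth (0, 0)%N cs q).1))).
  rewrite -(big_nth _ xpredT (fun q => slab_prob (tau q.1) (e q.1))) big_allpairs_dep.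
  rewrite -[iota 0 n.+1]/(index_iota 0 n.+1) big_mkord; apply: eq_bigr => j _.
  rewrite -[iota 0 _]/(index_iota 0 (level_count N j)).
  rewrite (eq_bigr (fun=> slab_prob (tau j) (e j)))// prodr_const_nat subn0.
  congr (_ ^+ _); rewrite slab_prob_scale /tail ?subKr; last first.
    by rewrite mulr_gt0// exprn_gt0.
  congr slab_prob; rewrite /e /tau /lam -addnn exprD !exprVn; field.
  by rewrite expf_neq0 ?gt_eqF ?(lt_trans ltr01 a1).
apply.
- by move=> i; rewrite /k level_countP ?(ltW N0)// => /half.
- by move=> q; exact: e_gt0.
- move=> y h; apply: form_slabs => q /(nthP (0, 0)%N)[i ics <-]; exact: h.
- by move=> q qcs; apply: form_quad; exact: mem_nth.
Qed.

End dyadic_level.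

Section dyadic_limit.
Context (R : realType) (d : measure_display) (O : measurableType d).
Variables (P : probability O R) (f : time_index R Reals -> {RV P >-> R}).
Hypothesis gspf : GSP f.
Local Notation dyadic p n := (p%:R / 2 ^+ n : time_index R Reals).

Lemma dyadic_approx (t r : R) : 0 <= t -> 0 < r ->
  exists n, 0 <= t - (Num.truncn (t * 2 ^+ n))%:R / 2 ^+ n < r.
Proof.
move=> t0 r0; exists (Num.bound r^-1); set n := Num.bound _.
have rn : 2 ^- n < r.
  have : r^-1 < n%:R by apply: archi_boundP; rewrite invr_ge0 ltW.
  move=> h; rewrite -[ltRHS]invrK ltf_pV2 ?posrE ?invr_gt0 ?exprn_gt0//.
  by apply: (lt_trans h); rewrite -natrX ltr_nat ltn_expl.
have /truncn_itv/andP[h1 h2] : 0 <= t * 2 ^+ n by rewrite mulr_ge0 ?exprn_ge0.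
have p0 : 0 < 2 ^+ n :> R by rewrite exprn_gt0.
rewrite subr_ge0 ler_pdivrMr// h1/=; apply: lt_trans rn.
rewrite ltrBlDr -[X in _ < X + _]mul1r -mulrDl ltr_pdivlMr//.
by rewrite nat1r.
Qed.

(** The events decrease with the level, so the bound passes to their intersection by continuity from
    above. There a continuous path exceeds [eta] at all dyadic times, and the positive margin keeps
    it from reaching 0 at the remaining ones. *)
Lemma dyadic_persistence (N eta : R) (q : \bar R) : 0 < N -> 0 < eta ->
  (forall n, (q <= P [set x | forall i : 'I_(level_count N n), (eta < f (dyadic i n) x)%R])%E) ->
  (q <= persistence f N)%E.
Proof.
move=> N0 eta0 qP; pose A n := [set x | forall i : 'I_(level_count N n), (eta < f (dyadic i n) x)%R].
have mA n : measurable (A n).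
  have : measurable [set x | forall i : 'I_(level_count N n), (0 < f (dyadic i n) x - eta)%R].
    by apply: measurable_orthant => i; exact: measurable_funB.
  by congr measurable; apply/seteqP; split => x /= h i; have := h i; rewrite subr_gt0.
have mbigA : measurable (\bigcap_n A n) by exact: bigcap_measurable.
have decA : nonincreasing_seq A.
  apply/nonincreasing_seqP => n; apply/subsetPset => x h i.
  have i2 : (i * 2 < level_count N n.+1)%N.
    have := ltn_ord i; rewrite !(level_countP _ _ (ltW N0)) natrM exprSr mulrA.
    by rewrite ler_pM2r.
  have := h (Ordinal i2); congr (_ < f _ x); rewrite /= natrM exprSr; field.
  by rewrite expf_neq0.
apply: (@le_trans _ _ (P (\bigcap_n A n))).
  have cvgA : P \o A @ \oo --> P (\bigcap_n A n).
    apply: nonincreasing_cvg_mu => //.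
    by rewrite (le_lt_trans (probability_le1 _ _)) ?ltry.
  rewrite -(cvg_lim _ cvgA)//; apply: lime_ge; first by apply/cvg_ex; eexists; exact: cvgA.
  by apply: nearW => n; exact: qP.
apply: persistence_ge => //.
have := GSP_continuous gspf; apply: filterS => w cw Aw t /andP[t0 tN].
have ct : {for t, continuous (fun t : R => f t w)}.
  have idc : continuous (id : R -> initial_topology (@time_val R Reals)).
    by apply: continuous_comp_initial => s.
  by move=> U /(cw t); exact: idc.
rewrite ltNge; apply/negP => ft0.
have : \forall s \near t, f s w < eta by apply: (cvgr_lt _ ct); exact: le_lt_trans ft0 eta0.
move=> /nbhs_ballP[r /= r0 br].
(* Approximating from below keeps the dyadic point in [0, N]. *)
have [n /andP[n1 n2]] := dyadic_approx (ltW t0) r0.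
set p := Num.truncn _ in n1 n2.
have pN : (p < level_count N n)%N.
  rewrite (level_countP _ _ (ltW N0)) -ler_pdivrMr ?exprn_gt0//.
  by rewrite (le_trans _ tN)// -subr_ge0.
have /br : ball t r (p%:R / 2 ^+ n) by rewrite /ball/= ger0_norm.
by rewrite ltNge (ltW (Aw n I (Ordinal pN))).
Qed.

End dyadic_limit.

Section real_constants.
Variable R : realType.
Implicit Types delta m : R.

(** The number a = 2^(min(delta, 1) / 4), for which the increment variance over 2^(-j), of order
    2^(-j min(delta, 1)), is the square of a^(-2j). *)
Definition chain_base delta : R := (2^-1 `^ (Num.min delta 1 / 4))^-1.
(** Its square is the constant 4 (1 + m) of [increment_le]. *)
Definition increment_scale m : R := 2 * Num.sqrt (1 + m).
Definition chain_gap delta m : R := (1 - (chain_base delta)^-1) / (4 * increment_scale m).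
(** The range of [short_time_half], cut at 1 so that shorter horizons have floor N = 0. *)
Definition short_horizon delta m : R :=
  Num.min 1 ((8 * (1 + m))^-1 `^ (Num.min delta 1)^-1).

Lemma chain_base_gt1 delta : 0 < delta -> 1 < chain_base delta.
Proof.
move=> delta0; rewrite /chain_base invf_gt1 ?powR_gt0//.
have e0 : 0 < Num.min delta 1 / 4 by rewrite divr_gt0// lt_min delta0 ltr01.
have := @gt0_ltr_powR _ _ e0 2^-1 1; rewrite powR1; apply; rewrite ?nnegrE//.
by rewrite invf_lt1// ltr1n.
Qed.

Lemma increment_scale_gt0 m : 0 <= m -> 0 < increment_scale m.
Proof. by move=> m0; rewrite mulr_gt0// sqrtr_gt0 (lt_le_trans ltr01)// lerDl. Qed.

Lemma increment_scale_sqr m : 0 <= m -> increment_scale m ^+ 2 = 4 * (1 + m).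
Proof. by move=> m0; rewrite exprMn sqr_sqrtr ?addr_ge0// -natrX. Qed.

Lemma chain_base_expr delta j :
  ((chain_base delta)^-1 ^+ j.*2) ^+ 2 = (2^-1 ^+ j) `^ Num.min delta 1.
Proof.
rewrite /chain_base invrK -exprM muln2 -!powR_mulrn ?powR_ge0 ?invr_ge0//.
by rewrite -!powRrM; congr (_ `^ _); rewrite -!muln2 !natrM; field.
Qed.

Lemma real_constants_exist delta m : 0 < delta -> 0 <= m -> exists be ell0,
  good_constants (chain_gap delta m) (chain_base delta) (short_horizon delta m) be ell0.
Proof.
move=> delta0 m0; have a1 := chain_base_gt1 delta0.
apply: good_constants_exist => //.
  apply: divr_gt0; first by rewrite subr_gt0 invf_lt1// (lt_trans ltr01).
  by rewrite mulr_gt0// increment_scale_gt0.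
rewrite lt_min ltr01 ge_min lexx andbT powR_gt0// invr_gt0 mulr_gt0//.
by rewrite (lt_le_trans ltr01)// lerDl.
Qed.

End real_constants.

Section real_time.
Context (R : realType) (d : measure_display) (O : measurableType d).
Variables (P : probability O R) (f : time_index R Reals -> {RV P >-> R}).
Variable rho : {finite_measure set R -> \bar R}.
Local Notation D := (@freq_domain R Reals).
Hypotheses (gspf : GSP f) (srho : spectral_measure f rho) (rho1 : rho D = 1%E).
Variable delta : R.
Hypotheses (delta0 : 0 < delta) (finite_moment : (spectral_moment Reals rho delta < +oo)%E).
Local Notation m := (fine (spectral_moment Reals rho delta)).

Let m0 : 0 <= m. Proof. exact: spectral_moment_ge0. Qed.

(** The window and the threshold are left free, so that long and short horizons are both
    instances. *)
Lemma dyadic_chain_persistence (B : set R) (N ell : R) (q : \bar R) : 0 < N -> 0 < ell ->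
  measurable B -> 0 < fine (rho (B `&` D)) ->
  (forall t : time_index R Reals, 0 <= t <= N ->
     fine (rho (B `&` D)) / 2 <= \int[rho]_(x in B `&` D) cos (x * time_val t)) ->
  (forall n, (q <= @gauss R [set z | (ell < Num.sqrt (fine (rho (B `&` D))) * z)%R] *
     (chain_product (chain_gap delta m) (chain_base delta) N ell n)%:E)%E) ->
  (q <= persistence f N)%E.
Proof.
move=> N0 ell0 mB B0 half qn.
have a1 := chain_base_gt1 delta0.
have inc j : 2 - 2 * cov_kernel f (2^-1 ^+ j) <=
    (increment_scale m * (chain_base delta)^-1 ^+ j.*2) ^+ 2.
  rewrite exprMn chain_base_expr increment_scale_sqr// (cov_increment srho rho1).
  apply: le_trans (increment_le rho1 delta0 finite_moment _) _.
  by rewrite ger0_norm ?exprn_ge0.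
have c1 : 1 <= increment_scale m ^+ 2.
  rewrite increment_scale_sqr// (@le_trans _ _ (1 + m)) ?lerDl// ler_peMl ?ler1n//.
  by rewrite addr_ge0.
apply: (@dyadic_persistence _ _ _ P f gspf N (ell / 4)) => //; first by rewrite divr_gt0.
move=> n; apply: le_trans (qn n) _.
apply: (level_persistence (n := n) gspf srho rho1 (increment_scale_gt0 m0) a1 inc c1 N0 ell0 mB B0).
move=> p pN; apply: half; rewrite divr_ge0 ?exprn_ge0//=.
by rewrite ler_pdivrMr// exprn_gt0.
Qed.

Lemma real_persistence (be ell0 ell N : R) :
  good_constants (chain_gap delta m) (chain_base delta) (short_horizon delta m) be ell0 ->
  ell0 < ell -> 0 < N ->
  (@gauss R [set z | (ell < sigma_ rho N * z)%R] *
   ((slab_prob be ell) `^ N)%:E <= persistence f N)%E.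
Proof.
move=> [be0 ell00 good] ell0l N0; have [goodL goodS] := good _ _ ell0l N0.
have ellp : 0 < ell := lt_trans ell00 ell0l.
have p0 : 0 < slab_prob be ell by exact: slab_prob_gt0.
have sig := sigma_le_sqrt srho N0.
have sig0 : 0 <= sigma_ rho N by exact: sqrtr_ge0.
have [Nt|tN] := ltP N (short_horizon delta m); last first.
  set B := (X in fine (rho X)) in sig.
  have [s2_eq0|s2n0] := eqVneq (fine (rho B)) 0.
    have -> : sigma_ rho N = 0.
      by apply/eqP; rewrite eq_le sig0 andbT (le_trans sig)// s2_eq0 sqrtr0.
    rewrite (_ : [set z | _] = set0) ?measure0 ?mul0e; last first.
      by rewrite -subset0 => z /=; rewrite mul0r ltNge ltW.
    exact: mu_ext_ge0.
  apply: (@dyadic_chain_persistence `[- N^-1, N^-1] N ell) => //.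
  - by rewrite lt_neqAle eq_sym s2n0 fine_ge0.
  - by move=> t t0N; exact: (low_frequency_half (T := Reals) rho N0 t0N).
  move=> n; apply: lee_pmul => //.
  + by rewrite lee_fin powR_ge0.
  + by apply: gauss_gt_le; rewrite ?sig0.
  + by rewrite lee_fin; exact: goodL.
have [L L0 gL] := goodS Nt.
(* The whole line has mass 1, so s = 1 >= sigma_N; the power of the slab probability is simply
   bounded by 1. *)
apply: (@dyadic_chain_persistence setT N L) => //.
- by rewrite setTI (congr1 fine rho1).
- move=> t /andP[t0 tN]; rewrite setTI (congr1 fine rho1) mul1r -(cov_kernel_cos srho).
  apply: (short_time_half srho rho1 delta0 finite_moment); rewrite t0/=.
  by rewrite (le_trans tN)// (le_trans (ltW Nt))// ge_min lexx orbT.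
move=> n; rewrite setTI (congr1 fine rho1) sqrtr1.
have mul1E (u : R) : [set z : R | (u < 1 * z)%R] = [set z | (u < z)%R].
  by apply/seteqP; split => z /=; rewrite mul1r.
rewrite mul1E.
apply: le_trans (gL n).
rewrite -[leRHS]mule1; apply: lee_pmul => //.
- by rewrite lee_fin powR_ge0.
- rewrite -mul1E; apply: gauss_gt_le; rewrite ?sig0//= (le_trans sig)// -sqrtr1 ler_wsqrtr//.
  have mD := @measurable_freq_domain R Reals.
  have mBD := measurableI _ _ (measurable_itv `[- N^-1, N^-1]) mD.
  rewrite -[leRHS](congr1 fine rho1) fine_le ?fin_num_measure//.
  by apply: le_measure; rewrite ?inE// => x [].
rewrite lee_fin; have := @ge0_ler_powR _ N (ltW N0) (slab_prob be ell) 1.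
by rewrite powR1; apply; rewrite ?nnegrE ?(ltW p0)// slab_prob_le1.
Qed.

End real_time.

Lemma gauss_slab_powR (R : realType) (be ell N : R) : 0 <= be ->
  (normal_prob 0 1 [set z : R | (be * `|z| < ell)%R] `^ N = ((slab_prob be ell) `^ N)%:E)%E.
Proof.
move=> be0; rewrite -poweR_EFin slab_probE; congr (_ `^ _)%E; congr (normal_prob _ _ _).
by apply/seteqP; split => z /=; rewrite normrM (ger0_norm be0).
Qed.

Theorem theorem4p1 (R : realType) :
  exists betaR ellR : R -> R -> R,
    (forall delta m : R, 0 < delta -> 0 < betaR delta m /\ 0 < ellR delta m) /\
    forall (T : time) (d : measure_display) (O : measurableType d)
      (P : probability O R) (f : time_index R T -> {RV P >-> R})
      (rho : {finite_measure set R -> \bar R}) (delta : R),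
      GSP f -> spectral_measure f rho -> rho (freq_domain T) = 1%E ->
      0 < delta -> (spectral_moment T rho delta < +oo)%E ->
      let m := fine (spectral_moment T rho delta) in
      let beta := match T with
                  | Reals => betaR delta m | Integers => 2 * Num.sqrt 2 end in
      let ell0 := match T with
                  | Reals => ellR delta m | Integers => 0 end in
      forall ell N : R, ell0 < ell -> 0 < N ->
        (normal_prob 0 1 [set z : R | (ell < sigma_ rho N * z)%R] *
         normal_prob 0 1 [set z : R | (beta * `|z| < ell)%R] `^ N
         <= persistence f N)%E.
Proof.
(* [good_constants] mentions no process, so the constants are functions of (delta, m), fixed before
   any process is given. The absolute value makes them positive for every real m; actual moments are
   nonnegative. *)
have /choice[c cP] : forall x : R * R, exists y : R * R, 0 < x.1 ->
    good_constants (chain_gap x.1 `|x.2|) (chain_base x.1) (short_horizon x.1 `|x.2|) y.1 y.2.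
  move=> [delta m] /=.
  have [d0|_] := ltP 0 delta; last by exists (0, 0).
  by have [be [l0 good]] := real_constants_exist d0 (normr_ge0 m); exists (be, l0).
exists (fun delta m => (c (delta, m)).1), (fun delta m => (c (delta, m)).2); split.
  by move=> delta m d0; have [] := cP (delta, m) d0.
case=> d O P f rho delta gspf srho rho1 d0 mom m beta ell0 ell N ell0l N0.
  rewrite gauss_slab_powR; last by rewrite mulr_ge0// sqrtr_ge0.
  exact: (integer_persistence gspf srho rho1 ell0l N0).
have good := cP (delta, m) d0.
rewrite /= ger0_norm in good; last exact: spectral_moment_ge0.
have [be0 _ _] := good.
rewrite gauss_slab_powR; last exact: ltW.
exact: (real_persistence gspf srho rho1 d0 mom good ell0l N0).
Qed.
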